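(* Suppose that $\mathcal{H}^1(S_\lambda)<\infty$ for all $\lambda\in[0,a)$. Let $((x_j,y_j))\subset\mathcal{C}\times\mathcal{C}$ be a sequence such that $d(x_j,y_j)$ is uniformly bounded. Let $C>0$ and let $\gamma_j\in\Gamma_C^{x_jy_j}$ be such that $L(\gamma_j)=d(x_j,y_j)$, and assume that each $\gamma_j$ has constant speed. Suppose that $\gamma_j$ converges uniformly on $I$ to some $\gamma\in\Gamma_C^{xy}$, where $x,y\in\mathcal{C}$. Then $L(\gamma)=d(x,y)$.
   Context: $I=[0,1]$, $\mathcal{C}=[-1,1]^n$. A set is countably $1$-rectifiable if it is a countable union of Lipschitz images of bounded subsets of $\mathbb{R}$. Fixed: $S\subset\mathcal{C}$ countably $1$-rectifiable and Borel measurable, $a\in[0,\infty]$, $b:S\to[0,\infty)$ lower semi-continuous with $b\le a$ on $S$; $b$ is extended to $\mathcal{C}$ by $b=a$ on $\mathcal{C}\setminus S$. $S_\lambda=\{z\in S\,|\,b(z)\le\lambda\}$. $\Gamma^{xy}$ is the set of Lipschitz paths $\gamma:I\to\mathcal{C}$ with $\gamma(0)=x$, $\gamma(1)=y$, and $\Gamma_C^{xy}$ consists of those with Lipschitz constant at most $C$. A path has constant speed if $|\dot\gamma|$ is Lebesgue-a.e. constant. $L(\gamma)=\int_I b(\gamma)|\dot\gamma|\,\mathrm{d}\mathcal{L}$, and $d(x,y)=\inf_{\gamma\in\Gamma^{xy}}\int_{\gamma(I)}b\,\mathrm{d}\mathcal{H}^1$ (convention $0\cdot\infty=0$). *)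

(* Defs.v *)
From HB Require Import structures.
From mathcomp Require Import all_boot all_order all_algebra.
From mathcomp Require Import all_classical all_reals all_analysis.

Set Implicit Arguments.
Unset Strict Implicit.
Unset Printing Implicit Defensive.

Import Order.TTheory GRing.Theory Num.Theory.
Import numFieldNormedType.Exports.

Local Open Scope classical_set_scope.
Local Open Scope ring_scope.

(* The library norm on ['rV[R]_n] is the sup norm; lengths, speeds, Lipschitz  *)
(* constants and diameters all use the Euclidean norm below. The topology of   *)
(* ['rV[R]_n] (open sets, derivatives, uniform convergence) is the usual one.  *)
Definition norm2 (R : realType) (n : nat) (v : 'rV[R]_n) : R :=
  Num.sqrt (\sum_(i < n) v 0 i ^+ 2).

(* The [0] makes the diameter of the empty set [0] instead of [-oo]. *)
Definition diam2 (R : realType) (n : nat) (A : set 'rV[R]_n) : \bar R :=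
  ereal_sup (0%E |` [set (norm2 (u - v))%:E | u in A & v in A]).

Definition lipschitz2 (R : realType) (n : nat) (C : R) (A : set R)
    (f : R -> 'rV[R]_n) : Prop :=
  forall s t : R, A s -> A t -> norm2 (f s - f t) <= C * `|s - t|.

Section hausdorff.
Variables (R : realType) (n : nat).
Local Open Scope ereal_scope.

Definition diam2_cover (delta : R) (A : set 'rV[R]_n) :
    set ((set 'rV[R]_n)^nat) :=
  [set U | A `<=` \bigcup_i U i /\ forall i, diam2 (U i) <= delta%:E].

Definition hausdorff1_delta (delta : R) (A : set 'rV[R]_n) : \bar R :=
  ereal_inf [set \sum_(i <oo) diam2 (U i) | U in diam2_cover delta A].

(* The one-dimensional normalising constant of Hausdorff measure is 1. *)
Definition hausdorff1 (A : set 'rV[R]_n) : \bar R :=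
  ereal_sup [set hausdorff1_delta delta A | delta in [set e : R | (0 < e)%R]].

Let diam2_ge0 (A : set 'rV[R]_n) : 0 <= diam2 A.
Proof. by apply: ereal_sup_ubound; left. Qed.

Let diam2_set0 : diam2 (set0 : set 'rV[R]_n) = 0.
Proof.
apply/eqP; rewrite eq_le diam2_ge0 andbT; apply: ge_ereal_sup => x [->//|].
by case=> u [].
Qed.

Let hausdorff1_delta_ge0 delta A : 0 <= hausdorff1_delta delta A.
Proof. by apply: le_ereal_inf_tmp => _ [U _ <-]; exact: nneseries_ge0. Qed.

Let le_hausdorff1_delta delta :
  {homo hausdorff1_delta delta : A B / A `<=` B >-> A <= B}.
Proof.
move=> A B AB; apply: ereal_inf_le_tmp => _ [U [BU dU] <-].
by exists U => //; split => //; exact: subset_trans BU.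
Qed.

Let hausdorff1_delta0 delta : (0 < delta)%R -> hausdorff1_delta delta set0 = 0.
Proof.
move=> d0; apply/eqP; rewrite eq_le hausdorff1_delta_ge0 andbT.
apply: ereal_inf_lbound; exists (fun=> set0).
  by split => // i; rewrite diam2_set0 lee_fin ltW.
by rewrite eseries0.
Qed.

Let hausdorff1_delta_sigma_subadditive delta :
  sigma_subadditive (hausdorff1_delta delta).
Proof.
move=> A; have [[i ioo]|] :=
    pselect (exists i, hausdorff1_delta delta (A i) = +oo).
  rewrite (eseries_pinfty _ _ ioo) ?leey// => k _.
  by rewrite -ltNye (lt_le_trans _ (hausdorff1_delta_ge0 _ _)).
rewrite -forallNE => Aoo.
apply/lee_addgt0Pr => _/posnumP[e].
apply: (le_trans _ (epsilon_trick xpredT _ _)) => //.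
pose P k (B : (set 'rV[R]_n)^nat) := diam2_cover delta (A k) B /\
  \sum_(i <oo) diam2 (B i) <=
  hausdorff1_delta delta (A k) + (e%:num / (2 ^ k.+1)%:R)%:E.
have [G PG] : {G : ((set 'rV[R]_n)^nat)^nat & forall k, P k (G k)}.
  apply: (@choice _ _ P) => k; rewrite /P.
  have en1 : (0 < e%:num / (2 ^ k.+1)%:R)%R by [].
  have hfin : hausdorff1_delta delta (A k) \is a fin_num.
    by rewrite ge0_fin_numE// ltey; apply/eqP; exact: Aoo.
  have [x [B cB <-] xS] := lb_ereal_inf_adherent en1 hfin.
  by exists B; split => //; exact/ltW.
apply: (@le_trans _ _ (\esum_(i in setT) (@diam2 R n \o uncurry G) i)).
  apply: ereal_inf_lbound => /=.
  have /card_esym/ppcard_eqP[f] := card_nat2.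
  exists (uncurry G \o f).
    split=> [t [i _ /((PG i).1.1 t)[j _ Gt]]|i]; last first.
      by rewrite /=; case: (f i) => a c /=; exact: (PG a).1.2.
    by exists (f^-1%FUN (i, j)) => //=; rewrite invK ?inE.
  rewrite -(esum_pred_image (@diam2 R n \o uncurry G) _ xpredT) ?[fun=> _]set_true//.
    by rewrite image_eq.
  by move=> k _; exact: diam2_ge0.
rewrite (_ : esum _ _ = \sum_(i <oo) \sum_(j <oo) diam2 (G i j)); last first.
  pose J : nat -> set (nat * nat) := fun i => [set (i, j) | j in setT].
  rewrite (_ : setT = \bigcup_k J k); last first.
    by rewrite predeqE => -[a c]; split => // _; exists a => //; exists c.
  rewrite esum_bigcupT /=; last 2 first.
    - apply/trivIsetP => i j _ _ ij.
      rewrite predeqE => -[k m] /=; split => //= -[] [_] _ [<-{k} _].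
      by move=> [m' _] [] /esym/eqP; rewrite (negbTE ij).
    - by move=> /= x; exact: diam2_ge0.
  rewrite -(image_id [set: nat]) -fun_true esum_pred_image//; last first.
    by move=> k _; apply: esum_ge0 => *; exact: diam2_ge0.
  apply: eq_eseriesr => /= j _.
  rewrite -(esum_pred_image (@diam2 R n \o uncurry G) (pair j) predT)//=; last first.
    by move=> ? ? _ _; exact: (@can_inj _ _ _ snd).
  by congr esum; rewrite predeqE => -[a c]; split; move=> [i _ <-]; exists i.
apply: lee_nneseries => [i _ _|i _]; last exact: (PG i).2.
by apply: nneseries_ge0 => *; exact: diam2_ge0.
Qed.

Let hausdorff1_ge0 A : 0 <= hausdorff1 A.
Proof.
apply: le_trans (hausdorff1_delta_ge0 1 A) _.
by apply: ereal_sup_ubound; exists 1%R => /=.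
Qed.

Let hausdorff10 : hausdorff1 set0 = 0.
Proof.
apply/eqP; rewrite eq_le hausdorff1_ge0 andbT.
by apply: ge_ereal_sup => _ [e /= e0 <-]; rewrite hausdorff1_delta0.
Qed.

Let le_hausdorff1 : {homo hausdorff1 : A B / A `<=` B >-> A <= B}.
Proof.
move=> A B AB; apply: ge_ereal_sup => _ [e e0 <-].
apply: le_trans (le_hausdorff1_delta e AB) _.
by apply: ereal_sup_ubound; exists e.
Qed.

Let hausdorff1_sigma_subadditive : sigma_subadditive hausdorff1.
Proof.
move=> F; apply: ge_ereal_sup => _ [e e0 <-].
apply: le_trans (hausdorff1_delta_sigma_subadditive e F) _.
apply: lee_nneseries => [i _ _|i _]; first exact: hausdorff1_delta_ge0.
by apply: ereal_sup_ubound; exists e.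
Qed.

HB.instance Definition _ := isOuterMeasure.Build R 'rV[R]_n hausdorff1
  hausdorff10 hausdorff1_ge0 le_hausdorff1 hausdorff1_sigma_subadditive.

End hausdorff.

Definition hausdorff1_outer (R : realType) (n : nat) :
    {outer_measure set 'rV[R]_n -> \bar R} := @hausdorff1 R n.

(* As a measure, Hausdorff measure lives on its Caratheodory sigma-algebra,    *)
(* which contains the Borel sets since [hausdorff1] is a metric outer measure. *)
Definition hausdorff1_measure (R : realType) (n : nat) :
    {measure set (caratheodory_type (@hausdorff1_outer R n)) -> \bar R} :=
  @hausdorff1_outer R n.

Section paths.
Variables (R : realType) (n : nat).
Local Open Scope ereal_scope.

Definition cube : set 'rV[R]_n := [set z | forall i, (-1 <= z 0 i <= 1)%R].

Definition borel_set : set (set 'rV[R]_n) := <<s [set U | open U] >>.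

Definition countably_1_rectifiable (A : set 'rV[R]_n) : Prop :=
  exists (B : (set R)^nat) (f : nat -> R -> 'rV[R]_n),
    [/\ forall i, bounded_set (B i),
        forall i, exists C : R, lipschitz2 C (B i) (f i)
      & A = \bigcup_i (f i @` B i)].

(* A path is a total function on [R], of which only the restriction to [0, 1]  *)
(* matters: its values elsewhere only affect derivatives at the two endpoints. *)
Definition paths_lip (C : R) (x y : 'rV[R]_n) : set (R -> 'rV[R]_n) :=
  [set g | [/\ forall t, t \in `[0, 1]%R -> cube (g t),
               g 0%R = x, g 1%R = y & lipschitz2 C `[0%R, 1%R] g]].

Definition paths (x y : 'rV[R]_n) : set (R -> 'rV[R]_n) :=
  [set g | exists C : R, paths_lip C x y g].

(* Lipschitz paths are differentiable almost everywhere; where the derivative  *)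
(* does not exist, [derive1 g t] is a default value.                           *)
Definition speed (g : R -> 'rV[R]_n) (t : R) : R := norm2 (derive1 g t).

Definition constant_speed (g : R -> 'rV[R]_n) : Prop :=
  exists c : R, {ae lebesgue_measure,
    forall t : R, t \in `[0, 1]%R -> speed g t = c}.

(* Only used for [S] inside the cube; the extension is by [a] on all of the    *)
(* complement of [S].                                                          *)
Definition extend (S : set 'rV[R]_n) (a : \bar R) (b : 'rV[R]_n -> R) :
    'rV[R]_n -> \bar R :=
  patch (fun=> a) S (EFin \o b).

(* Semi-continuity relative to [S]: in [subspace S] the points outside [S] are *)
(* isolated, so the values of [b] there are irrelevant.                        *)
Definition lower_semicontinuous_on (S : set 'rV[R]_n) (b : 'rV[R]_n -> R) :
    Prop :=
  lower_semicontinuous (EFin \o b : subspace S -> \bar R).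

Definition sublevel (S : set 'rV[R]_n) (b : 'rV[R]_n -> R) (lambda : R) :
    set 'rV[R]_n :=
  S `&` [set z | (b z <= lambda)%R].

(* Below, [b] is the extended weight; in [\bar R], [0 * +oo = 0]. *)
Definition path_length (b : 'rV[R]_n -> \bar R) (g : R -> 'rV[R]_n) : \bar R :=
  \int[lebesgue_measure]_(t in `[0%R, 1%R]) (b (g t) * (speed g t)%:E).

Definition path_dist (b : 'rV[R]_n -> \bar R) (x y : 'rV[R]_n) : \bar R :=
  ereal_inf [set \int[@hausdorff1_measure R n]_(z in g @` `[0%R, 1%R]) b z
            | g in paths x y].

End paths.

Arguments cube {R n}.

(* Main.v *)
From HB Require Import structures.
Require Import Defs.
From mathcomp Require Import all_boot all_order all_algebra.
From mathcomp Require Import all_classical all_reals all_analysis.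
From mathcomp Require Import measurable_realfun ring lra.
Set Implicit Arguments.
Unset Strict Implicit.
Unset Printing Implicit Defensive.
Import Order.TTheory GRing.Theory Num.Theory.
Import numFieldNormedType.Exports.
Local Open Scope classical_set_scope.
Local Open Scope ring_scope.

(** The inequality that the length of the limit is at least the distance holds
    for every path: the Hausdorff measure of the image of a set of times is at
    most the integral of the speed over that set ([arc_hausdorff]), so that
    integrating the weight over the image gives at most the weighted length
    ([arc_integral_image]). This needs a measurable version of the speed,
    which comes from the densities of the coordinates ([arc_exists]), and the
    fact that Borel sets are measurable for the Hausdorff outer measure
    ([open_caratheodory]).

    For the converse, the first ingredient is lower semicontinuity: if
    infinitely many of the approximating curves have length at most [M] over
    an interval of times, then so has the limit ([length_lsc]). The weight is
    only lower semicontinuous relative to [S], and [S] may be dense, so this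
    is not a matter of topology alone. One truncates the weight at a level
    [lambda] below [a]. The sublevel set then has finite length, hence is
    exhausted up to a small length by a closed set
    ([hausdorff1_inner_closed]), and off the remainder the truncated weight is
    lower semicontinuous. The remainder is harmless because the distance to a
    point, along an approximating curve, has to take all the values between
    those at the two ends, and the values taken in the remainder have small
    measure ([chord_le_hausdorff], [chord_weight_le]). Summing over a
    partition bounds sums of chords of the limit, weighted with the least
    weight on each piece, and Fatou's lemma turns these sums into the weighted
    length ([length_lsc_closed]).

    It remains to bound the lengths of the approximating curves, which are
    distances, by the distance of the limiting end points. If [a] is finite,
    end points that are close are joined by short segments of small weighted
    length ([optimal_limit_finite]). If [a] is infinite, there may be no such
    connections; instead, the approximating curves meet the limit. Their
    lengths being bounded, they spend a fixed length in one sublevel set,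
    which has finite measure; so some point lies on infinitely many of them,
    and then on the limit ([meeting_point]). Doing this on two short pieces of
    the limit near its ends, one may pass from the limit to the approximating
    curve, along which the middle part is optimal, and back; the price is the
    length of the short pieces ([optimal_limit_infinite]). *)

(** * Euclidean norm *)

Section euclidean_norm.
Context {R : realType} {n : nat}.
Implicit Types u v w : 'rV[R]_n.

Definition dotv u v : R := \sum_(i < n) u 0 i * v 0 i.

Lemma norm2_ge0 u : 0 <= norm2 u.
Proof. exact: sqrtr_ge0. Qed.

Lemma norm2_sqr u : norm2 u ^+ 2 = dotv u u.
Proof. by rewrite sqr_sqrtr// sumr_ge0// => i _; exact: sqr_ge0. Qed.

Lemma dotvv_ge0 u : 0 <= dotv u u.
Proof. by rewrite -norm2_sqr sqr_ge0. Qed.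

Lemma norm2N u : norm2 (- u) = norm2 u.
Proof. by congr Num.sqrt; apply: eq_bigr => i _; rewrite mxE sqrrN. Qed.

Lemma norm2Bc u v : norm2 (u - v) = norm2 (v - u).
Proof. by rewrite -norm2N opprB. Qed.

Lemma norm2_0 : norm2 (0 : 'rV[R]_n) = 0.
Proof. by rewrite /norm2 big1 ?sqrtr0// => i _; rewrite mxE expr0n. Qed.

Lemma norm2Z (c : R) u : norm2 (c *: u) = `|c| * norm2 u.
Proof.
rewrite /norm2 -sqrtr_sqr -sqrtrM ?sqr_ge0// mulr_sumr; congr Num.sqrt.
by apply: eq_bigr => i _; rewrite mxE exprMn.
Qed.

Lemma cauchy_schwarz u v : dotv u v ^+ 2 <= dotv u u * dotv v v.
Proof.
have H t : 0 <= dotv u u * t ^+ 2 - 2 * t * dotv u v + dotv v v.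
  have <- : dotv (t *: u - v) (t *: u - v) =
            dotv u u * t ^+ 2 - 2 * t * dotv u v + dotv v v.
    rewrite /dotv mulr_suml mulr_sumr -sumrB -big_split/=.
    by apply: eq_bigr => i _; rewrite !mxE; ring.
  exact: dotvv_ge0.
have uu := dotvv_ge0 u; have vv := dotvv_ge0 v.
move: uu; rewrite le_eqVlt => /orP[/eqP uu0|uu0].
  have [->|uv0] := eqVneq (dotv u v) 0; first by rewrite expr0n/= -uu0 mul0r.
  have := H ((dotv v v + 1) / (2 * dotv u v)).
  rewrite -uu0 mul0r add0r.
  rewrite (_ : 2 * _ * _ = dotv v v + 1); first lra.
  by field.
have := H (dotv u v / dotv u u).
rewrite (_ : _ - _ + _ = dotv v v - dotv u v ^+ 2 / dotv u u); last first.
  by field; rewrite gt_eqF.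
by rewrite subr_ge0 ler_pdivrMr// mulrC.
Qed.

Lemma dotv_le u v : dotv u v <= norm2 u * norm2 v.
Proof.
have [uv|/ltW uv] := leP (dotv u v) 0.
  by rewrite (le_trans uv)// mulr_ge0 ?norm2_ge0.
rewrite -(@ler_pXn2r _ 2)// ?nnegrE ?mulr_ge0 ?norm2_ge0//.
by rewrite exprMn !norm2_sqr cauchy_schwarz.
Qed.

Lemma norm2D u v : norm2 (u + v) <= norm2 u + norm2 v.
Proof.
rewrite -(@ler_pXn2r _ 2)// ?nnegrE ?addr_ge0 ?norm2_ge0//.
rewrite sqrrD !norm2_sqr.
have -> : dotv (u + v) (u + v) = dotv u u + dotv u v *+ 2 + dotv v v.
  rewrite /dotv -sumrMnl -!big_split/=.
  by apply: eq_bigr => i _; rewrite !mxE; ring.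
by rewrite lerD2r lerD2l lerMn2r/= dotv_le.
Qed.

Lemma norm2_triangle v u w : norm2 (u - w) <= norm2 (u - v) + norm2 (v - w).
Proof. by have := norm2D (u - v) (v - w); rewrite addrA subrK. Qed.

Lemma coord_le_norm2 u i : `|u 0 i| <= norm2 u.
Proof.
rewrite -sqrtr_sqr ler_wsqrtr// (bigD1 i)//= lerDl sumr_ge0// => j _.
exact: sqr_ge0.
Qed.

Lemma norm_le_norm2 u : `|u| <= norm2 u.
Proof.
rewrite [leLHS]mx_normrE; apply/bigmax_leP; split; first exact: norm2_ge0.
by move=> [i j] _ /=; rewrite (ord1 i) coord_le_norm2.
Qed.

Lemma norm2_le_sum u : norm2 u <= \sum_(i < n) `|u 0 i|.
Proof.
rewrite -(@ler_pXn2r _ 2)// ?nnegrE ?norm2_ge0 ?sumr_ge0//.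
rewrite norm2_sqr /dotv expr2 mulr_suml ler_sum// => i _.
have -> : u 0 i * u 0 i = `|u 0 i| * `|u 0 i|.
  by rewrite -normrM ger0_norm// -expr2 sqr_ge0.
rewrite ler_wpM2l//.
by rewrite (bigD1 i)//= lerDl sumr_ge0.
Qed.

Lemma norm2_le_norm u : norm2 u <= n%:R * `|u|.
Proof.
apply: (le_trans (norm2_le_sum u)).
rewrite mulr_natl -[X in _ *+ X](card_ord n) -sumr_const ler_sum// => i _.
by rewrite [leRHS]mx_normrE; apply/bigmax_geP; right; exists (0, i).
Qed.

End euclidean_norm.

(** * Borel sets are measurable for the Hausdorff outer measure *)

Section metric_outer_measure.
Context {R : realType} {n : nat}.
Implicit Types A B U X : set 'rV[R]_n.
Local Open Scope ereal_scope.
Notation H := (@hausdorff1 R n).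

Lemma hausdorff1_ge0 A : 0 <= H A.
Proof. exact: (outer_measure_ge0 (@hausdorff1_outer R n)). Qed.

Lemma hausdorff10 : H set0 = 0.
Proof. exact: (outer_measure0 (@hausdorff1_outer R n)). Qed.

Lemma le_hausdorff1 A B : A `<=` B -> H A <= H B.
Proof. exact: (le_outer_measure (@hausdorff1_outer R n)). Qed.

Lemma hausdorff1U A B : H (A `|` B) <= H A + H B.
Proof. exact: (outer_measureU2 (@hausdorff1_outer R n)). Qed.

Lemma hausdorff1_bigcup (F : (set 'rV[R]_n)^nat) :
  H (\bigcup_i F i) <= \sum_(i <oo) H (F i).
Proof. exact: (outer_measure_sigma_subadditive (@hausdorff1_outer R n)). Qed.

Lemma diam2_ge0 A : 0 <= diam2 A.
Proof. by apply: ereal_sup_ubound; left. Qed.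

Lemma diam2_ub A u v : A u -> A v -> (norm2 (u - v))%:E <= diam2 A.
Proof. by move=> Au Av; apply: ereal_sup_ubound; right; exists u => //; exists v. Qed.

Lemma diam2_le A e : 0 <= e ->
  (forall u v, A u -> A v -> (norm2 (u - v))%:E <= e) -> diam2 A <= e.
Proof.
move=> e0 h; apply: ge_ereal_sup => _ [->//|[u Au [v Av <-]]]; exact: h.
Qed.

Lemma le_diam2 A B : A `<=` B -> diam2 A <= diam2 B.
Proof.
move=> AB; apply: diam2_le; first exact: diam2_ge0.
by move=> u v Au Av; apply: diam2_ub; exact: AB.
Qed.

Lemma diam2_set0 : diam2 (set0 : set 'rV[R]_n) = 0.
Proof. by apply/eqP; rewrite eq_le diam2_ge0 andbT diam2_le. Qed.

Lemma hausdorff1_delta_le d A : (0 < d)%R -> hausdorff1_delta d A <= H A.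
Proof. by move=> d0; apply: ereal_sup_ubound; exists d. Qed.

Lemma hausdorff1_delta_anti (d d' : R) A : (d <= d')%R ->
  hausdorff1_delta d' A <= hausdorff1_delta d A.
Proof.
move=> dd; apply: ereal_inf_le_tmp => _ [U [AU dU] <-]; exists U => //.
by split => // i; rewrite (le_trans (dU i)) ?lee_fin.
Qed.

Lemma hausdorff1_delta_ge0 (d : R) A : 0 <= hausdorff1_delta d A.
Proof.
by apply: le_ereal_inf_tmp => _ [U _ <-]; apply: nneseries_ge0 => *; exact: diam2_ge0.
Qed.

(** A set of diameter at most [d] cannot meet both [A] and [B], so that a
    covering of the union splits into coverings of the two. *)
Lemma hausdorff1_delta_separated A B (d : R) : (0 < d)%R ->
  (forall u v, A u -> B v -> (d < norm2 (u - v))%R) ->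
  hausdorff1_delta d A + hausdorff1_delta d B <= hausdorff1_delta d (A `|` B).
Proof.
move=> d0 sep; apply: le_ereal_inf_tmp => _ [U [ABU dU] <-].
apply: (@le_trans _ _ (\sum_(i <oo) (diam2 (U i `&` A) + diam2 (U i `&` B)))).
  rewrite nneseriesD//; last 2 first.
  - by move=> *; exact: diam2_ge0.
  - by move=> *; exact: diam2_ge0.
  apply: leeD; apply: ereal_inf_lbound.
    exists (fun i => U i `&` A) => //; split.
      move=> x Ax; have [|i _ Ux] := ABU x; first by left.
      by exists i.
    by move=> i; apply: le_trans (dU i); apply: le_diam2 => z [].
  exists (fun i => U i `&` B) => //; split.
    move=> x Bx; have [|i _ Ux] := ABU x; first by right.
    by exists i.
  by move=> i; apply: le_trans (dU i); apply: le_diam2 => z [].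
apply: lee_nneseries => [i _ _|i _].
  by apply: adde_ge0; exact: diam2_ge0.
have [UA0|/set0P[u [Uu Au]]] := eqVneq (U i `&` A) set0.
  by rewrite UA0 diam2_set0 add0e; apply: le_diam2 => z [].
have [UB0|/set0P[v [Uv Bv]]] := eqVneq (U i `&` B) set0.
  by rewrite UB0 diam2_set0 adde0; apply: le_diam2 => z [].
have := le_trans (diam2_ub Uu Uv) (dU i).
by rewrite lee_fin leNgt sep.
Qed.

Lemma hausdorff1_separated A B (d : R) : (0 < d)%R ->
  (forall u v, A u -> B v -> (d < norm2 (u - v))%R) ->
  H A + H B <= H (A `|` B).
Proof.
move=> d0 sep; have [->|] := eqVneq (H (A `|` B)) +oo; first by rewrite leey.
rewrite -ltey => ABoo.
have HA : H A \is a fin_num.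
  rewrite ge0_fin_numE ?hausdorff1_ge0//.
  exact: le_lt_trans (le_hausdorff1 (@subsetUl _ A B)) ABoo.
have HB : H B \is a fin_num.
  rewrite ge0_fin_numE ?hausdorff1_ge0//.
  exact: le_lt_trans (le_hausdorff1 (@subsetUr _ A B)) ABoo.
have key d1 d2 : (0 < d1)%R -> (0 < d2)%R ->
    hausdorff1_delta d1 A + hausdorff1_delta d2 B <= H (A `|` B).
  move=> d10 d20; pose m := Num.min d (Num.min d1 d2).
  have m0 : (0 < m)%R by rewrite !lt_min d0 d10.
  apply: le_trans (hausdorff1_delta_le (A `|` B) m0).
  apply: le_trans (@hausdorff1_delta_separated A B m m0 _); last first.
    by move=> u v Au Bv; rewrite (le_lt_trans _ (sep _ _ Au Bv))// ge_min lexx.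
  by apply: leeD; apply: hausdorff1_delta_anti; rewrite !ge_min lexx ?orbT.
have ABf : H (A `|` B) \is a fin_num by rewrite ge0_fin_numE ?hausdorff1_ge0.
have fd (d1 : R) X : (0 < d1)%R -> H X \is a fin_num -> hausdorff1_delta d1 X \is a fin_num.
  move=> d10 HX; rewrite ge0_fin_numE ?hausdorff1_delta_ge0//.
  by rewrite (le_lt_trans (hausdorff1_delta_le _ d10))// ltey_eq HX.
rewrite -leeBrDl//; apply: ge_ereal_sup => _ [d2 /= d20 <-].
rewrite leeBrDl// -leeBrDr; last exact: fd.
apply: ge_ereal_sup => _ [d1 /= d10 <-].
rewrite leeBrDr; last exact: fd.
exact: key.
Qed.

(** Closed sets that exhaust an open [U]. They measure distances with the norm
    of the topology, which is at most the Euclidean one, and so have gaps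
    between them for the latter too. *)
Definition inner U k : set 'rV[R]_n :=
  [set z | forall w, (`|z - w| < k.+1%:R^-1)%R -> U w].

Lemma inner_sub U k : inner U k `<=` U.
Proof. by move=> z; apply; rewrite subrr normr0 invr_gt0. Qed.

Lemma inner_mono U k l : (k <= l)%N -> inner U k `<=` inner U l.
Proof.
move=> kl z zk w zw; apply: zk; rewrite (lt_le_trans zw)//.
by rewrite lef_pV2 ?posrE// ler_nat.
Qed.

Lemma inner_bigcup U : open U -> U `<=` \bigcup_k inner U k.
Proof.
move=> oU z Uz.
have /nbhs_ballP[e /= e0 zeU] : nbhs z U by exact: open_nbhs_nbhs.
near \oo => k; exists k => // w zw; apply: zeU.
rewrite mx_norm_ball /ball_/= (lt_trans zw)//.
near: k; exact: (near_infty_natSinv_lt (PosNum e0)).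
Unshelve. all: by end_near. Qed.

Lemma inner_gap U k : exists2 d : R, (0 < d)%R &
  forall u v, inner U k u -> ~ inner U k.+1 v -> (d < norm2 (u - v))%R.
Proof.
have kk : (k.+2%:R^-1 < k.+1%:R^-1 :> R)%R by rewrite ltf_pV2 ?posrE// ltr_nat.
exists ((k.+1%:R^-1 - k.+2%:R^-1) / 2)%R; first by rewrite divr_gt0// subr_gt0.
move=> u v ku /existsNP[w /not_implyP[vw Uw]].
have uw : (k.+1%:R^-1 <= `|u - w|)%R by rewrite leNgt; apply/negP => /ku.
have := ler_distD v u w; have := norm_le_norm2 (u - v).
move: (k.+1%:R^-1)%R (k.+2%:R^-1)%R vw uw kk => p q vw uw qp; lra.
Qed.

Lemma inner_gap0 U k : exists2 d : R, (0 < d)%R &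
  forall u v, inner U k u -> ~ U v -> (d < norm2 (u - v))%R.
Proof.
have [d d0 h] := inner_gap U k; exists d => // u v uk Uv.
by apply: h => // /inner_sub.
Qed.

Let ring_ U X k := X `&` (inner U k.+1 `\` inner U k).

(** Rings whose indices have the same parity are separated by the ring between
    them. *)
Lemma sum_ring_le U X (p : nat) N :
  \sum_(0 <= i < N.+1) H (ring_ U X (i.*2 + p)%N) <=
  H (X `&` inner U (N.*2 + p).+1).
Proof.
elim: N => [|N IH].
  by rewrite big_nat1; apply: le_hausdorff1 => z [Xz []].
rewrite big_nat_recr//=; apply: le_trans (leeD2r _ IH) _.
have [d d0 h] := inner_gap U (N.*2 + p).+1.
apply: le_trans (hausdorff1_separated d0 _) _.
  by move=> u v [_ uk] [_ [_ vk]]; apply: h.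
apply: le_hausdorff1 => z [[Xz zk]|[Xz [zk _]]]; split => //.
by apply: inner_mono zk; rewrite ltnS leq_add2r leq_double.
Qed.

Lemma sum_ring_fin U X : H X < +oo -> \sum_(i <oo) H (ring_ U X i) < +oo.
Proof.
move=> Xoo; apply: (@le_lt_trans _ _ (H X + H X)); last exact: lte_add_pinfty.
apply: lime_le; first by apply: is_cvg_nneseries => *; exact: hausdorff1_ge0.
near=> N.
apply: (@le_trans _ _ (\sum_(0 <= i < N.+1.*2) H (ring_ U X i))).
  apply: lee_sum_nneg_natr => *; rewrite ?hausdorff1_ge0//.
  by rewrite -addnn addSn ltnW// ltnS leq_addr.
have -> : \sum_(0 <= i < N.+1.*2) H (ring_ U X i) =
    \sum_(0 <= i < N.+1) H (ring_ U X (i.*2 + 0)%N) +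
    \sum_(0 <= i < N.+1) H (ring_ U X (i.*2 + 1)%N).
  elim: N.+1 => [|m IH]; first by rewrite double0 !big_geq// adde0.
  rewrite doubleS !big_nat_recr//= IH addn0 addn1 -!addeA; congr (_ + _).
  by rewrite addeCA.
apply: leeD; apply: le_trans (sum_ring_le _ _ _ _) _; apply: le_hausdorff1 => z [].
Unshelve. all: by end_near. Qed.

(** Metric outer measures make open sets measurable: an open [U] is exhausted
    by the sets [inner U k], which are at positive distance from the complement
    of [U]. What they leave out of [X] is a union of rings; every other ring is
    separated from the previous ones, so that the lengths of the rings form a
    convergent series, whose remainder tends to zero. *)
Lemma open_caratheodory U : open U -> (@hausdorff1_outer R n).-caratheodory U.
Proof.
move=> oU; apply: le_caratheodory_measurable => X.
change (H (X `&` U) + H (X `&` ~` U) <= H X).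
have [->|] := eqVneq (H X) +oo; first by rewrite leey.
rewrite -ltey => Xoo.
have XU : H (X `&` ~` U) \is a fin_num.
  by rewrite ge0_fin_numE ?hausdorff1_ge0// (le_lt_trans _ Xoo)//; apply: le_hausdorff1 => z [].
have Xf : H X \is a fin_num by rewrite ge0_fin_numE ?hausdorff1_ge0.
have tail := nneseries_tail_cvg (sum_ring_fin U Xoo) (fun k _ => hausdorff1_ge0 _).
have bound k : H (X `&` U) <= H X - H (X `&` ~` U) + \sum_(k <= i <oo) H (ring_ U X i).
  have sub : X `&` U `<=` (X `&` inner U k) `|`
      \bigcup_(i in ~` `I_k) ring_ U X i.
    move=> z [Xz /(inner_bigcup oU)[l _ zl]].
    have [zk|zk] := pselect (inner U k z); [by left|right].
    have [m] : exists m, inner U (k + m) z.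
      by exists l; apply: inner_mono zl; rewrite leq_addl.
    elim: m => [|m IH]; first by rewrite addn0.
    have [/IH//|zm] := pselect (inner U (k + m) z).
    rewrite addnS => zm1; exists (k + m)%N; last by split.
    by rewrite /= ltnNge leq_addr.
  apply: le_trans (le_hausdorff1 sub) _; apply: le_trans (hausdorff1U _ _) _.
  apply: leeD.
    rewrite leeBrDr//; have [d d0 h] := inner_gap0 U k.
    apply: le_trans (hausdorff1_separated d0 _) _.
      by move=> u v [_ uk] [_ vU]; exact: h.
    by apply: le_hausdorff1 => z [[]|[]].
  exact: (outer_measure_sigma_subadditive_tail (@hausdorff1_outer R n)).
rewrite -leeBrDr//.
suff cv : H X - H (X `&` ~` U) + \sum_(k <= i <oo) H (ring_ U X i) @[k --> \oo]
    --> H X - H (X `&` ~` U) by apply: (cvge_ge _ cv); exact: nearW.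
rewrite -[X in _ --> X]adde0; apply: cvgeD => //; last exact: cvg_cst.
by rewrite fin_num_adde_defl.
Qed.

Lemma borel_caratheodory B : borel_set B -> (@hausdorff1_outer R n).-cara.-measurable B.
Proof.
apply: smallest_sub; first exact: sigma_algebra_measurable.
by move=> U; exact: open_caratheodory.
Qed.

End metric_outer_measure.

(** * Lower bounds of the Hausdorff measure by projection *)

Section hausdorff1_lower_bound.
Context {R : realType} {n : nat}.
Notation H := (@hausdorff1 R n).
Notation mu := (@lebesgue_measure R).

(** The infimum and the supremum of [f] on [U] are at most a diameter apart.
    *)
Lemma projection_itv (f : 'rV[R]_n -> R) (U : set 'rV[R]_n) :
  (forall u v, `|f u - f v| <= norm2 (u - v)) -> (diam2 U < +oo)%E ->
  exists I : set R, [/\ measurable I, f @` U `<=` I & (mu I <= diam2 U)%E].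
Proof.
move=> f1 Uoo.
have dU : (diam2 U)%E = (fine (diam2 U))%:E.
  by rewrite fineK// ge0_fin_numE// diam2_ge0.
have [->|/set0P[z Uz]] := eqVneq U set0.
  by exists set0; rewrite image_set0 measure0; split => //; exact: diam2_ge0.
have fd x y : (f @` U) x -> (f @` U) y -> x - y <= fine (diam2 U).
  move=> [u Uu <-] [v Uv <-]; rewrite -lee_fin -dU.
  apply: le_trans (diam2_ub Uu Uv); rewrite lee_fin.
  exact: le_trans (ler_norm _) (f1 _ _).
have fz : (f @` U) (f z) by exists z.
have ub x : (f @` U) x -> x <= sup (f @` U).
  apply: ub_le_sup; exists (f z + fine (diam2 U)) => y /fd /(_ fz).
  by rewrite lerBlDl.
have lb x : (f @` U) x -> inf (f @` U) <= x.
  apply: ge_inf; exists (f z - fine (diam2 U)) => y /(fd _ _ fz).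
  by rewrite lerBlDl lerBlDr.
exists `[inf (f @` U), sup (f @` U)]%classic; split => //.
  by move=> x fx; rewrite /= in_itv/= lb// ub.
have le : sup (f @` U) - inf (f @` U) <= fine (diam2 U).
  rewrite lerBlDr; apply: ge_sup; first by exists (f z).
  move=> x fx; rewrite -lerBlDl; apply: lb_le_inf; first by exists (f z).
  by move=> y fy; rewrite lerBlDr -lerBlDl; exact: fd.
rewrite lebesgue_measure_itv/=; case: ifPn => _; last exact: diam2_ge0.
by rewrite dU -EFinD lee_fin.
Qed.

(** A function that is 1-Lipschitz maps a covering of [A] into intervals that
    are not longer than the covering sets. The set [D] makes room for the
    values that are not taken on [A]. *)
Lemma hausdorff1_lower (f : 'rV[R]_n -> R) (A : set 'rV[R]_n) (D E : set R) :
  (forall u v, `|f u - f v| <= norm2 (u - v)) -> measurable D -> measurable E ->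
  E `<=` f @` A `|` D -> (mu E <= H A + mu D)%E.
Proof.
move=> f1 mD mE EAD.
have [->|] := eqVneq (mu D) +oo%E.
  by rewrite addey ?leey// gt_eqF// (lt_le_trans ltNy0)// hausdorff1_ge0.
rewrite -ltey => Doo.
have Df : mu D \is a fin_num by rewrite ge0_fin_numE.
rewrite -leeBlDr//; apply: le_trans (hausdorff1_delta_le A (@ltr01 R)).
apply: le_ereal_inf_tmp => _ [U [AU dU] <-]; rewrite leeBlDr//.
have /choice[I HI] i : exists I : set R,
    [/\ measurable I, f @` (U i) `<=` I & (mu I <= diam2 (U i))%E].
  by apply: projection_itv => //; rewrite (le_lt_trans (dU i)) ?ltry.
have mI : measurable (\bigcup_i I i) by apply: bigcup_measurable => i _; case: (HI i).
apply: (@le_trans _ _ (mu ((\bigcup_i I i) `|` D))).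
  apply: le_measure; rewrite ?inE//; first exact: measurableU.
  move=> x /EAD[[u Au <-]|Dx]; [left|by right].
  by have [i _ Uu] := AU _ Au; exists i => //; case: (HI i) => _ + _; apply; exists u.
apply: (le_trans (measureU2 mu mI mD)); apply: leeD => //.
apply: (@le_trans _ _ (\sum_(i <oo) mu (I i))%E).
  by apply: generalized_Boole_inequality => // i; case: (HI i).
by apply: lee_nneseries => // i _; case: (HI i).
Qed.

Lemma norm2_dist_lip (z u v : 'rV[R]_n) :
  `|norm2 (u - z) - norm2 (v - z)| <= norm2 (u - v).
Proof.
have := norm2_triangle v u z; have := norm2_triangle u v z; rewrite (norm2Bc v u).
by move=> h1 h2; rewrite ler_norml lerBlDr h2 andbT; lra.
Qed.

End hausdorff1_lower_bound.

(** * Arcs with a measurable speed *)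

Section lipschitz_density.
Context {R : realType}.
Notation mu := (@lebesgue_measure R).

Lemma stieltjes_ocitv (F : cumulative R R) (a b : R) : a <= b ->
  lebesgue_stieltjes_measure F `]a, b]%classic = (F b - F a)%:E.
Proof.
move=> ab; rewrite /lebesgue_stieltjes_measure /measure_extension/=.
rewrite measurable_mu_extE/=; last exact: is_ocitv.
by rewrite wlength_itv_bnd.
Qed.

(** Both measures are infima over the same coverings by half-open intervals.
    *)
Lemma stieltjes_le (F : cumulative R R) (K : R) (A : set R) : 0 < K ->
  (forall s t, s <= t -> F t - F s <= K * (t - s)) ->
  (lebesgue_stieltjes_measure F A <= K%:E * mu A)%E.
Proof.
move=> K0 FK; rewrite /lebesgue_measure /lebesgue_stieltjes_measure.
rewrite /measure_extension /mu_ext -lee_pdivrMl//.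
apply: le_ereal_inf_tmp => _ [U [mU AU] <-].
rewrite lee_pdivrMl// -nneseriesZl; last by move=> *.
apply: ge_ereal_inf; exists (\sum_(k <oo) wlength F (U k))%E; first by exists U.
apply: lee_nneseries => // k _.
case/ocitvP: (mU k) => [->|[[a b]/= /ltW ab ->]].
  have w0 G : wlength G (set0 : set R) = 0%E :> \bar R by exact: wlength0.
  by rewrite [leLHS]w0 [X in (_ * X)%E]w0 mule0.
by rewrite !wlength_itv_bnd// -EFinM lee_fin FK.
Qed.

(** A Lipschitz function plus a steep linear function is nondecreasing; its
    Stieltjes measure is at most a multiple of Lebesgue measure, and by
    Lebesgue differentiation its Radon-Nikodym density is the derivative. *)
Lemma lipschitz_density (f : R -> R) (K : R) : 0 < K ->
  (forall s t, `|f s - f t| <= K * `|s - t|) ->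
  exists g : R -> R, [/\ measurable_fun setT g, mu.-integrable `[0, 1] (EFin \o g),
    forall s t : R, 0 <= s -> s <= t -> t <= 1 ->
      (\int[mu]_(u in `]s, t]) (g u)%:E)%E = (f t - f s)%:E &
    {ae mu, forall t : R, 0 < t -> t < 1 -> is_derive t 1 f (g t)}].
Proof.
move=> K0 fK.
pose F t := f t + K * t.
have Flip s t : s <= t -> 0 <= F t - F s <= 2 * K * (t - s).
  move=> st; have := fK t s; rewrite [X in _ * X]ger0_norm ?subr_ge0// ler_norml => /andP[].
  by rewrite /F => h1 h2; apply/andP; split; lra.
have Fnd : nondecreasing F.
  by move=> s t /Flip /andP[]; rewrite subr_ge0.
have Fc : continuous F.
  move=> t; apply: continuousD; last by apply: mulrl_continuous.
  apply/cvgrPdist_le => e e0; near=> s.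
  apply: le_trans (fK _ _) _; rewrite -ler_pdivlMl//.
  near: s; apply: cvgr_dist_le => //; by rewrite mulr_gt0// invr_gt0.
have Frc : right_continuous F := right_continuousW Fc.
pose FF : cumulative R R := HB.pack F (isCumulative.Build R _ R F Fnd Frc).
pose LS := lebesgue_stieltjes_measure FF.
have K20 : 0 < 2 * K by rewrite mulr_gt0.
(* The Stieltjes measure is made finite by restricting it to an interval with
   [0, 1] in its interior. *)
have mD : measurable (`]-1, 2]%classic : set (measurableTypeR R)).
  exact: (measurable_itv `]-1, 2]).
have LSD : (LS `](-1)%R, 2%R]%classic < +oo)%E by rewrite /LS stieltjes_ocitv ?ltry//; lra.
pose nu : {finite_measure set (measurableTypeR R) -> \bar R} :=
  @mfrestr _ (measurableTypeR R) _ _ _ mD LSD.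
have numu : nu `<< (mu : {sigma_finite_measure set (measurableTypeR R) -> \bar R}).
  apply/null_content_dominatesP => A mA A0.
  apply/eqP; rewrite eq_le measure_ge0 andbT.
  have -> : 0%E = ((2 * K)%:E * mu A)%E by rewrite A0 mule0.
  apply: le_trans (@stieltjes_le FF _ A K20 _); last first.
    by move=> s t st; have /andP[_ h] := Flip _ _ st; exact: h.
  by apply: le_measure; rewrite ?inE//; exact: measurableI.
have [h [h0 hfin hint hE]] := radon_nikodym_sigma_finite numu.
pose hr t := fine (h t).
have hrE : EFin \o hr = h by apply/funext => t; rewrite /= fineK.
have hrint : mu.-integrable setT (EFin \o hr) by rewrite hrE.
have Fst s t : -1 <= s -> s <= t -> t <= 2 ->
    (\int[mu]_(u in `]s, t]) (hr u)%:E)%E = (F t - F s)%:E.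
  move=> s1 st t2; under eq_integral do rewrite -[(hr _)%:E]/((EFin \o hr) _) hrE.
  rewrite -hE//= /nu /mfrestr /mrestr setIidl; first exact: stieltjes_ocitv.
  by move=> u /=; rewrite !in_itv/= => /andP[su ut]; rewrite (le_lt_trans s1)// (le_trans ut).
have hrm : measurable_fun setT hr by apply/measurable_EFinP; case/integrableP : hrint.
have ints (A : set R) : measurable A -> mu.-integrable A (EFin \o hr).
  by move=> mA; apply: integrableS hrint.
have intK (A : set R) : measurable A -> (mu A < +oo)%E -> mu.-integrable A (EFin \o cst K).
  by move=> mA Aoo; apply: measurable_bounded_integrable => //; exact: bounded_cst.
exists (fun t => hr t - K); split.
- by apply: measurable_funB.
- have : mu.-integrable `[0, 1] ((EFin \o hr) \- (EFin \o cst K))%E.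
    apply: integrableB => //; first exact: ints.
    by apply: intK => //; rewrite lebesgue_measure_itv/=; case: ifPn => _; rewrite ?ltry.
  by [].
- move=> s t s0 st t1.
  have itvoo : (mu `]s, t] < +oo)%E.
    by rewrite lebesgue_measure_itv/=; case: ifPn => _; rewrite -?EFinB ltry.
  under eq_integral do rewrite EFinB.
  rewrite integralB//=; [|exact: ints|exact: intK].
  rewrite Fst//; [|lra|lra].
  rewrite integral_cst//= lebesgue_measure_itv/= lte_fin.
  move: st; rewrite le_eqVlt => /orP[/eqP ->|st].
    by rewrite ltxx mule0 sube0 !subrr.
  by rewrite st; apply: (congr1 EFin); rewrite /F; ring.
have hrloc : locally_integrable setT hr by apply: open_integrable_locally => //; exact: openT.
have hy y : mu.-integrable `]-oo, y] (EFin \o hr) by apply: integrableS hrint.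
pose G (x : R) := \int[mu]_(t in `]-oo, x]) hr t.
have : {ae mu, forall x, derivable G x 1 /\ G^`()%classic x = hr x}.
  exact: FTC1Ny.
apply: filterS; first exact: (ae_filter_ringOfSetsType mu).
move=> t [dG GE] t0 t1.
have GF u : 0 < u -> u < 1 -> f u = G u + F (-1) - K * u.
  move=> u0 u1; rewrite /G /Rintegral.
  under eq_integral do rewrite -[(hr _)%:E]/((EFin \o hr) _) hrE.
  rewrite -hE//= /nu /mfrestr /mrestr.
  rewrite (_ : _ `&` _ = `]-1, u]%classic); last first.
    apply/seteqP; split => v /=; rewrite !in_itv/=; first by move=> [-> /andP[->]].
    by move=> /andP[v1 vu]; split => //; apply/andP; split => //; lra.
  by rewrite stieltjes_ocitv /=; [rewrite /F; lra|lra].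
have GD : is_derive t (1 : R) G (hr t) by apply: DeriveDef => //; rewrite -derive1E.
have dK : is_derive t (1 : R) (fun u => G u + F (-1) - K * u) (hr t - K).
  rewrite (_ : (fun u => _) = (G \+ cst (F (-1))) \- (K \*: id)).
    by apply: is_derive_eq; rewrite addr0 /GRing.scale/= mulr1.
  by apply/funext => u /=.
apply: near_eq_is_derive dK; near=> u; rewrite GF//; near: u.
- exact: lt_nbhsr.
- exact: lt_nbhsl.
Unshelve. all: by end_near. Qed.

End lipschitz_density.

Section arcs.
Context {R : realType} {n : nat}.
Notation mu := (@lebesgue_measure R).
Implicit Types g : R -> 'rV[R]_n.

(** Here [rho] is a measurable version of the speed of [g] on the unit
    interval. The speed itself, having a default value where [g] has no
    derivative, need not be measurable. *)
Definition is_arc (C : R) g (rho : R -> R) : Prop :=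
 [/\ forall s t, norm2 (g s - g t) <= C * `|s - t|,
   measurable_fun setT rho, forall t, 0 <= rho t <= C,
   forall s t : R, 0 <= s -> s <= t -> t <= 1 ->
     ((norm2 (g t - g s))%:E <= \int[mu]_(u in `[s, t]) (rho u)%:E)%E &
   {ae mu, forall t : R, 0 < t -> t < 1 -> derivable g t 1 /\ speed g t = rho t}].

Lemma norm2_dist_continuous (c : 'rV[R]_n) : continuous (fun z : 'rV[R]_n => norm2 (z - c)).
Proof.
move=> z; apply/(@cvgrPdist_le _ _ _ _ (@nbhs_filter _ z)) => e e0.
apply/nbhs_ballP; exists (e / n.+1%:R) => /=; first by rewrite divr_gt0.
move=> u; rewrite mx_norm_ball /ball_/= => zu.
apply: le_trans (norm2_dist_lip c z u) _; apply: (le_trans (norm2_le_norm _)).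
apply: (@le_trans _ _ (n.+1%:R * `|z - u|)); first by rewrite ler_wpM2r// ler_nat.
by rewrite -ler_pdivlMl// mulrC ltW.
Qed.

Lemma norm2_continuous : continuous (@norm2 R n).
Proof.
rewrite (_ : @norm2 R n = fun z : 'rV[R]_n => norm2 (z - 0)).
  exact: norm2_dist_continuous.
by apply/funext => z; rewrite subr0.
Qed.

Lemma norm2_derive1_le (C : R) g t :
  (forall s t, norm2 (g s - g t) <= C * `|s - t|) ->
  derivable g t 1 -> speed g t <= C.
Proof.
move=> gC dg.
pose q (h : R) : 'rV[R]_n := h^-1 *: (g (h + t) - g t).
have cv : q h @[h --> 0^'] --> g^`()%classic t.
  have := dg; rewrite /derivable /derive1.
  suff -> : (fun h : R => h^-1 *: ((g \o shift t) (h *: 1) - g t)) = q by [].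
  by apply/funext => h; congr (_ *: (g (_ + _) - _)); exact: mulr1.
have cvn : norm2 (q h) @[h --> 0^'] --> speed g t.
  by apply: continuous_cvg cv; exact: norm2_continuous.
apply: (@closed_cvg _ _ _ _ _ (fun r => r <= C) (@closed_le _ C) _ _ cvn).
near=> h; have h0 : h != 0 by near: h; exact: nbhs_dnbhs_neq.
rewrite /q norm2Z normfV ler_pdivrMl ?normr_gt0// mulrC.
by apply: le_trans (gC _ _) _; rewrite addrK.
Unshelve. all: by end_near. Qed.

Lemma measurable_norm2 (f : R -> 'rV[R]_n) :
  (forall i, measurable_fun setT (fun t => f t 0 i)) ->
  measurable_fun setT (fun t => norm2 (f t)).
Proof.
move=> mf; rewrite /norm2.
apply: (measurableT_comp (f := @Num.sqrt R)).
  by apply: continuous_measurable_fun; exact: sqrt_continuous.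
by apply: measurable_sum => i; exact: measurable_funX.
Qed.

(** Each coordinate has a density, which is its derivative almost everywhere.
    The chord is bounded by testing the integral of the vector of densities
    against the direction of the chord. *)
Lemma arc_exists (C : R) g : 0 < C ->
  (forall s t, norm2 (g s - g t) <= C * `|s - t|) ->
  exists rho, is_arc C g rho.
Proof.
move=> C0 gC.
have gCi (i : 'I_n) s t : `|g s 0 i - g t 0 i| <= C * `|s - t|.
  apply: le_trans (gC s t).
  by have := coord_le_norm2 (g s - g t) i; rewrite !mxE.
have /choice[d Hd] (i : 'I_n) := lipschitz_density C0 (gCi i).
pose D u : 'rV[R]_n := \row_i d i u.
have mD : measurable_fun setT (fun u => norm2 (D u)).
  apply: measurable_norm2 => i; under eq_fun do rewrite mxE.
  by case: (Hd i).
(* The bounds of [rho] are required everywhere, so the densities are set to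
   zero where they exceed the Lipschitz constant, which is on a null set. *)
pose E u : 'rV[R]_n := if norm2 (D u) <= C then D u else 0.
have mEi i : measurable_fun setT (fun u => E u 0 i).
  rewrite (_ : (fun u => _) = fun u => if norm2 (D u) <= C then d i u else 0); last first.
    by apply/funext => u; rewrite /E; case: ifPn => _; rewrite !mxE.
  apply: measurable_fun_ifT => //.
    by apply: measurable_fun_ler.
  by case: (Hd i).
pose rho u := norm2 (E u).
have mrho : measurable_fun setT rho by apply: measurable_norm2.
have rhoC u : 0 <= rho u <= C.
  by rewrite norm2_ge0 /rho /E; case: ifPn => //; rewrite norm2_0 => _; exact: ltW.
have aeE : {ae mu, forall t : R, 0 < t -> t < 1 ->
    [/\ derivable g t 1, speed g t = rho t & E t = D t]}.
  have aei i : {ae mu, forall t : R, 0 < t -> t < 1 ->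
      is_derive t (1 : R) (fun t => g t 0 i) (d i t)}.
    by case: (Hd i).
  have : {ae mu, forall (t : R) (i : 'I_n), 0 < t -> t < 1 ->
      is_derive t (1 : R) (fun t => g t 0 i) (d i t)}.
    exact: (filter_forall (ae_filter_ringOfSetsType mu) aei).
  apply: filterS; first exact: (ae_filter_ringOfSetsType mu).
  move=> t dt t0 t1.
  have dg : derivable g t 1.
    by apply/derivable_mxP => i j; rewrite (ord1 i); case: (dt j t0 t1).
  have gD : g^`()%classic t = D t.
    rewrite derive1E derive_mx//; apply/matrixP => i j; rewrite !mxE (ord1 i).
    by case: (dt j t0 t1).
  have sC := norm2_derive1_le gC dg.
  have ED : E t = D t by rewrite /E -gD -/(speed g t) sC.
  by split => //; rewrite /rho ED -gD.
exists rho; split => //; last first.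
  move: aeE; apply: filterS; first exact: (ae_filter_ringOfSetsType mu).
  by move=> t h t0 t1; case: (h t0 t1).
move=> s t s0 st t1.
pose A : set R := `[s, t]%classic.
have mA : measurable A by exact: measurable_itv.
have Aoo : (mu A < +oo)%E.
  by rewrite lebesgue_measure_itv/=; case: ifPn => _; rewrite ?ltry.
have boundedint (f : R -> R) : measurable_fun setT f -> (forall u, `|f u| <= C) ->
    mu.-integrable A (EFin \o f).
  move=> mf fC; apply: measurable_bounded_integrable => //.
    exact: measurable_funTS.
  by exists C; split; [exact: num_real|move=> M CM u _; exact: le_trans (fC u) (ltW CM)].
pose v := g t - g s.
have vE (i : 'I_n) : (\int[mu]_(u in A) (E u 0 i)%:E)%E = (v 0 i)%:E.
  have [md _ + _] := Hd i => /(_ s t s0 st t1).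
  rewrite !mxE => <-; rewrite /A integral_itv_bndoo; last first.
    by apply/measurable_EFinP; exact: measurable_funTS.
  rewrite [RHS]integral_itv_bndoo; last first.
    by apply/measurable_EFinP; exact: measurable_funTS.
  apply: ae_eq_integral => //.
  - apply/measurable_EFinP; exact: (measurable_funTS (mEi i)).
  - apply/measurable_EFinP; exact: (measurable_funTS md).
  move: aeE; apply: filterS; first exact: (ae_filter_ringOfSetsType mu).
  move=> u h; rewrite /= in_itv/= => /andP[su ut].
  have [||_ _ ->] := h; [lra|lra|]; by rewrite mxE.
have [v0|v0] := eqVneq (norm2 v) 0.
  rewrite -/v v0; apply: integral_ge0 => u _; rewrite lee_fin.
  by case/andP: (rhoC u).
have vpos : 0 < norm2 v by rewrite lt_neqAle eq_sym v0 norm2_ge0.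
have irho : mu.-integrable A (EFin \o rho).
  by apply: boundedint => // u; have /andP[r0 rC] := rhoC u; rewrite ger0_norm.
have iEi i : mu.-integrable A (EFin \o (fun u => E u 0 i)).
  apply: boundedint => // u.
  by apply: le_trans (coord_le_norm2 _ _) _; case/andP: (rhoC u).
have iE i : mu.-integrable A (fun u => (v 0 i)%:E * (E u 0 i)%:E)%E.
  by apply: integrableZl => //; exact: iEi.
rewrite -(@lee_pmul2l _ (norm2 v)%:E) ?lte_fin// -EFinM -expr2 norm2_sqr /dotv.
have -> : (\sum_(i < n) v 0 i * v 0 i)%:E =
    (\sum_(i < n) \int[mu]_(u in A) ((v 0%R i)%:E * (E u 0%R i)%:E))%E.
  rewrite -sumEFin; apply: eq_bigr => i _; rewrite integralZl ?EFinM//; last exact: iEi.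
  by rewrite vE.
rewrite -integral_sum// -integralZl//; apply: le_integral => //.
- exact: integrable_sum.
- exact: integrableZl.
move=> u _; under eq_bigr do rewrite -EFinM.
by rewrite sumEFin -EFinM lee_fin; exact: dotv_le.
Qed.

End arcs.

(** * Borel sets and nonmeasurable integrands *)

Section nonmeasurable_integrand.
Context d (T : measurableType d) (R : realType) (mu : {measure set T -> \bar R}).
Local Open Scope ereal_scope.
Import HBNNSimple.

(** The integral of a nonnegative function is the supremum of the integrals of
    the simple functions below it; changing a measurable integrand on a null
    set, even in a nonmeasurable way, does not affect it. *)
Lemma ge0_ae_eq_integral_measurable (D : set T) (f g : T -> \bar R) :
  measurable D -> (forall x, D x -> 0 <= f x) -> (forall x, D x -> 0 <= g x) ->
  measurable_fun D g -> {ae mu, forall x, D x -> f x = g x} ->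
  \int[mu]_(x in D) f x = \int[mu]_(x in D) g x.
Proof.
move=> mD f0 g0 mg fg; apply/eqP; rewrite eq_le; apply/andP; split.
  rewrite ge0_integralE//; apply: ge_ereal_sup => _ [h /= hf <-].
  have -> : sintegral mu h = \int[mu]_(x in setT) (h x)%:E.
    by rewrite integral_nnsfun// patch_setT.
  rewrite [leRHS]integral_mkcond; apply: ae_ge0_le_integral => //.
  - by move=> x _; rewrite lee_fin.
  - exact/measurable_EFinP.
  - by move=> x _; rewrite patchE; case: ifPn => // /set_mem; exact: g0.
  - exact/(measurable_restrictT _ mD).1.
  apply: filterS fg => x fgx _; apply: le_trans (hf x) _; rewrite !patchE.
  by case: ifPn => // /set_mem /fgx ->.
case: fg => N [mN N0 fgN].
rewrite (ge0_negligible_integral mN mD mg g0 N0) [leRHS]ge0_integralE//.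
rewrite ge0_integralE; last by move=> x [Dx _]; exact: g0.
apply: ge_ereal_sup => _ [h /= hg <-]; apply: ereal_sup_ubound; exists h => //= x.
apply: le_trans (hg x) _; rewrite !patchE.
case: ifPn => [/set_mem[Dx Nx]|_].
  rewrite mem_set//; suff -> : f x = g x by [].
  by apply: contrapT => fgx; apply: Nx; apply: fgN => /= /(_ Dx).
by case: ifPn => // /set_mem; exact: f0.
Qed.

End nonmeasurable_integrand.

Section borel_sets.
Context {R : realType} {n : nat}.

Definition borelV := g_sigma_algebraType [set U : set 'rV[R]_n | open U].

Lemma open_borel (U : set 'rV[R]_n) : open U -> measurable (U : set borelV).
Proof. exact: sub_sigma_algebra. Qed.

Lemma closed_borel (F : set 'rV[R]_n) : closed F -> measurable (F : set borelV).
Proof.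
by move=> cF; have := measurableC (open_borel (closed_openC cF)); rewrite setCK.
Qed.

Lemma continuous_borel (g : R -> 'rV[R]_n) : continuous g ->
  measurable_fun setT (g : R -> borelV).
Proof.
move=> cg; apply: (@measurability _ _ _ borelV setT g _ erefl).
move=> _ [U oU <-]; rewrite setTI; apply: open_measurable.
by apply: open_comp => // x _; exact: cg.
Qed.

Lemma id_borel_caratheodory :
  measurable_fun setT (id : caratheodory_type (@hausdorff1_outer R n) -> borelV).
Proof. by move=> _ B mB; rewrite setTI; exact: borel_caratheodory. Qed.

End borel_sets.

(** * Length of arcs and Hausdorff measure of their images *)

Section integral_itv_additive.
Context {R : realType}.
Notation mu := (@lebesgue_measure R).
Local Open Scope ereal_scope.

Lemma ge0_integral_itv_cat (f : R -> \bar R) (a b c : R) : (a <= b)%R -> (b <= c)%R ->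
  measurable_fun `[a, c] f -> (forall t, 0 <= f t) ->
  \int[mu]_(t in `[a, c]) f t =
  \int[mu]_(t in `[a, b]) f t + \int[mu]_(t in `[b, c]) f t.
Proof.
move=> ab bc mf f0.
have mbc : measurable_fun `]b, c] f.
  apply: measurable_funS mf => // t /=; rewrite !in_itv/= => /andP[bt ->].
  by rewrite andbT (le_trans ab)// ltW.
rewrite -(integral_itv_obnd_cbnd mbc) -ge0_integral_setU//.
- by rewrite -itv_bndbnd_setU// bnd_simp.
- by rewrite -itv_bndbnd_setU// bnd_simp.
- by apply/disj_setPLR => t /=; rewrite !in_itv/= => /andP[_ tb]; rewrite ltNge tb.
Qed.

Lemma sum_integral_partition (f : R -> \bar R) (p : nat -> R) N :
  (forall i, (p i <= p i.+1)%R) -> measurable_fun setT f -> (forall t, 0 <= f t) ->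
  \sum_(0 <= i < N) \int[mu]_(t in `[p i, p i.+1]) f t =
  \int[mu]_(t in `[p 0%N, p N]) f t.
Proof.
move=> pS mf f0; elim: N => [|N IH].
  by rewrite big_geq// set_itv1 integral_set1.
rewrite big_nat_recr//= IH -ge0_integral_itv_cat//.
- by elim: N {IH} => // N; move=> /le_trans; apply.
- exact: measurable_funTS.
Qed.

End integral_itv_additive.

Section arc_length.
Context {R : realType} {n : nat}.
Notation mu := (@lebesgue_measure R).
Notation H := (@hausdorff1 R n).
Variables (C : R) (g : R -> 'rV[R]_n) (rho : R -> R).
Hypothesis arcg : is_arc C g rho.
Local Open Scope ereal_scope.

Lemma arc_lip s t : (norm2 (g s - g t) <= C * `|s - t|)%R.
Proof. by case: arcg. Qed.

Lemma arc_rho_measurable : measurable_fun setT rho.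
Proof. by case: arcg. Qed.

Lemma arc_rho_emeasurable (D : set R) : measurable_fun D (EFin \o rho).
Proof. by apply/measurable_EFinP; apply: measurable_funTS; case: arcg. Qed.

Lemma arc_rho_ge0 t : (0 <= rho t)%R.
Proof. by case: arcg => _ _ /(_ t) /andP[]. Qed.

Lemma arc_rho_le t : (rho t <= C)%R.
Proof. by case: arcg => _ _ /(_ t) /andP[]. Qed.

Lemma arc_chord s t : (0 <= s)%R -> (s <= t)%R -> (t <= 1)%R ->
  (norm2 (g t - g s))%:E <= \int[mu]_(u in `[s, t]) (rho u)%:E.
Proof. by case: arcg => _ _ _ + _; apply. Qed.

Lemma arc_int_ge0 A : 0 <= \int[mu]_(t in A) (rho t)%:E.
Proof. by apply: integral_ge0 => t _; rewrite lee_fin arc_rho_ge0. Qed.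

Lemma arc_int_subset A B : measurable A -> measurable B -> A `<=` B ->
  \int[mu]_(t in A) (rho t)%:E <= \int[mu]_(t in B) (rho t)%:E.
Proof.
move=> mA mB AB; apply: ge0_subset_integral => //; first exact: arc_rho_emeasurable.
by move=> t _; rewrite lee_fin arc_rho_ge0.
Qed.

Lemma arc_continuous : continuous g.
Proof.
have C0 : (0 <= C)%R by apply: le_trans (arc_rho_ge0 0) (arc_rho_le 0).
move=> t; apply/cvgrPdist_le => e e0.
near=> s; apply: le_trans (norm_le_norm2 _) _; apply: le_trans (arc_lip _ _) _.
apply: (@le_trans _ _ ((C + 1) * `|t - s|)%R); first by rewrite ler_wpM2r// lerDl.
rewrite -ler_pdivlMl ?ltr_wpDl//; near: s.
by apply: cvgr_dist_le => //; rewrite mulr_gt0// invr_gt0 ltr_wpDl.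
Unshelve. all: by end_near. Qed.

Lemma arc_diam2 s t : (0 <= s)%R -> (s <= t)%R -> (t <= 1)%R ->
  diam2 (g @` `[s, t]) <= \int[mu]_(u in `[s, t]) (rho u)%:E.
Proof.
move=> s0 st t1; apply: diam2_le; first exact: arc_int_ge0.
move=> _ _ [u + <-] [v + <-]; rewrite /= !in_itv/=.
wlog uv : u v / (v <= u)%R.
  by move=> wl; case: (leP v u) => [|/ltW] uv hu hv; [|rewrite norm2Bc]; exact: wl.
move=> /andP[su ut] /andP[sv vt].
apply: (@le_trans _ _ (\int[mu]_(w in `[v, u]) (rho w)%:E)).
  by apply: arc_chord => //; [exact: le_trans sv|exact: le_trans t1].
apply: arc_int_subset => // w /=; rewrite !in_itv/= => /andP[vw wu].
by rewrite (le_trans sv)// (le_trans wu).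
Qed.

(** The images of short pieces of equal duration form a fine covering, and the
    diameter of a piece is at most its length. *)
Lemma arc_hausdorff_itv s t : (0 <= s)%R -> (s <= t)%R -> (t <= 1)%R ->
  H (g @` `[s, t]) <= \int[mu]_(u in `[s, t]) (rho u)%:E.
Proof.
move=> s0 st t1; apply: ge_ereal_sup => _ [d /= d0 <-].
have [N Nd] : exists N, (C * ((t - s) / N.+1%:R) <= d)%R.
  exists (Num.bound (d^-1 * (C * (t - s)))).
  rewrite mulrA ler_pdivrMr// -ler_pdivrMl// ltW//.
  apply: lt_trans (archi_boundP _) _; last by rewrite ltr_nat.
  rewrite mulr_ge0 ?invr_ge0 ?mulr_ge0 ?subr_ge0//; first exact: ltW.
  exact: le_trans (arc_rho_ge0 0) (arc_rho_le 0).
pose p i : R := (s + i%:R * ((t - s) / N.+1%:R))%R.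
have st0 : (0 <= (t - s) / N.+1%:R)%R by rewrite divr_ge0 ?subr_ge0.
have pS i : (p i <= p i.+1)%R by rewrite lerD2l ler_wpM2r// ler_nat.
have pN : p N.+1 = t by rewrite /p mulrC divfK ?pnatr_eq0// subrKC.
have ple i j : (i <= j)%N -> (p i <= p j)%R by move=> ij; rewrite lerD2l ler_wpM2r// ler_nat.
have p0 : p 0%N = s by rewrite /p mul0r addr0.
pose U i := if (i < N.+1)%N then g @` `[p i, p i.+1] else set0.
have dU i : (i < N.+1)%N -> diam2 (U i) <= \int[mu]_(u in `[p i, p i.+1]) (rho u)%:E.
  move=> iN; rewrite /U iN; apply: arc_diam2 => //.
    by apply: le_trans s0 _; rewrite -p0 ple.
  by apply: le_trans t1; rewrite -pN ple.
apply: ge_ereal_inf; exists (\sum_(i <oo) diam2 (U i)).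
  exists U => //; split.
    move=> _ [u + <-]; rewrite /= in_itv/= => /andP[su ut].
    have [k [kN pk pk1]] : exists k, [/\ (k < N.+1)%N, (p k <= u)%R & (u <= p k.+1)%R].
      have : (u <= p N.+1)%R by rewrite pN.
      elim: {1 2}N => [|m IH] um; first by exists 0%N; rewrite p0.
      have [/IH[k [km pk pk1]]|/ltW mu] := leP u (p m.+1); last by exists m.+1.
      by exists k; split => //; rewrite ltnW.
    by exists k => //; rewrite /U kN; exists u => //=; rewrite in_itv/= pk.
  move=> i; rewrite /U; case: ifPn => iN; last by rewrite diam2_set0 lee_fin ltW.
  apply: diam2_le; first by rewrite lee_fin ltW.
  move=> _ _ [u + <-] [v + <-]; rewrite /= !in_itv/= lee_fin => /andP[u1 u2] /andP[v1 v2].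
  apply: le_trans Nd; apply: le_trans (arc_lip _ _) _.
  rewrite ler_wpM2l//; first exact: le_trans (arc_rho_ge0 0) (arc_rho_le 0).
  have : (p i.+1 = p i + (t - s) / N.+1%:R)%R by rewrite /p -natr1 mulrDl mul1r addrA.
  rewrite ler_norml; move: (p i.+1) (p i) ((t - s) / N.+1%:R)%R u1 u2 v1 v2.
  by move=> x y q u1 u2 v1 v2 xyq; apply/andP; split; lra.
rewrite (nneseries_split 0 N.+1); last by move=> *; exact: diam2_ge0.
rewrite add0n eseries0 ?adde0; last first.
  by move=> i iN _; rewrite /U ltnNge iN diam2_set0.
rewrite -p0 -[in leRHS]pN -sum_integral_partition//.
- rewrite big_seq [in leRHS]big_seq; apply: lee_sum => i; rewrite mem_index_iota => /andP[_ iN].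
  exact: dU.
- exact: arc_rho_emeasurable.
- by move=> u; rewrite lee_fin arc_rho_ge0.
Qed.

End arc_length.

Section arc_length_measure.
Context {R : realType} {n : nat}.
Notation mu := (@lebesgue_measure R).
Notation H := (@hausdorff1 R n).
Variables (C : R) (g : R -> 'rV[R]_n) (rho : R -> R).
Hypothesis arcg : is_arc C g rho.
Local Open Scope ereal_scope.

Lemma arc_hausdorff_interval (A : set R) : measurable A -> is_interval A ->
  A `<=` `[0%R, 1%R] -> H (g @` A) <= \int[mu]_(t in A) (rho t)%:E.
Proof.
move=> mA iA A01.
have [->|/set0P[c Ac]] := eqVneq A set0.
  by rewrite image_set0 hausdorff10 integral_set0.
have A0 x : A x -> (0 <= x)%R by move=> /A01; rewrite /= in_itv/= => /andP[].
have A1 x : A x -> (x <= 1)%R by move=> /A01; rewrite /= in_itv/= => /andP[].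
have hi : has_inf A by split; [exists c|exists 0%R].
have hs : has_sup A by split; [exists c|exists 1%R].
have infc : (inf A <= c)%R by apply: ge_inf => //; case: hi.
have supc : (c <= sup A)%R by apply: ub_le_sup => //; case: hs.
apply: (@le_trans _ _ (H (g @` `[inf A, sup A]))).
  apply: le_hausdorff1; apply: image_subset => x Ax; rewrite /= in_itv/=.
  by rewrite ge_inf ?ub_le_sup//; [case: hs|case: hi].
apply: le_trans (arc_hausdorff_itv arcg _ _ _) _.
- by apply: lb_le_inf; [exists c|move=> x /A0].
- exact: le_trans supc.
- by apply: ge_sup; [exists c|move=> x /A1].
rewrite integral_itv_bndoo; last exact: arc_rho_emeasurable arcg _.
apply: (arc_int_subset arcg) => // x; rewrite /= in_itv/= => /andP[ix xs].
have [y Ay yx] := inf_lt hi.1 ix.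
have [z Az xz] := sup_gt hs.1 xs.
by apply: (iA y z) => //; rewrite !ltW.
Qed.

(** By outer regularity, it is enough to treat open sets, which are countable
    disjoint unions of intervals. *)
Lemma arc_hausdorff (E : set R) : measurable E -> E `<=` `[0%R, 1%R] ->
  H (g @` E) <= \int[mu]_(t in E) (rho t)%:E.
Proof.
move=> mE E01; apply/lee_addgt0Pr => e e0.
have C0 : (0 <= C)%R by apply: le_trans (arc_rho_ge0 arcg 0) (arc_rho_le arcg 0).
have eC : (0 < e / (C + 1))%R by rewrite divr_gt0// ltr_wpDl.
have Eoo : mu E < +oo.
  apply: (@le_lt_trans _ _ (mu `[0%R, 1%R])).
    by apply: le_measure; rewrite ?inE//.
  by rewrite lebesgue_measure_itv/=; case: ifPn => _; rewrite ?ltry.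
have [U [oU EU UE]] := lebesgue_regularity_outer mE Eoo eC.
pose I := open_disjoint_itv oU.
pose A k := I k `&` `[0%R, 1%R]%classic.
have mA k : measurable (A k).
  apply: measurableI => //; apply: open_measurable; exact: open_disjoint_itv_open.
have iA k : is_interval (A k).
  move=> x y [Ix x01] [Iy y01] z /andP[xz zy]; split.
    by apply: (@open_disjoint_itv_is_interval _ _ oU k x y Ix Iy); rewrite xz zy.
  move: x01 y01; rewrite /= !in_itv/= => /andP[x0 _] /andP[_ y1].
  by rewrite (le_trans x0)// (le_trans zy).
have UA : U `&` `[0%R, 1%R] = \bigcup_k A k.
  by rewrite [in LHS](open_disjoint_itv_bigcup oU) setI_bigcupl.
have mU : measurable (U : set R) by apply: open_measurable.
apply: (@le_trans _ _ (\sum_(k <oo) \int[mu]_(t in A k) (rho t)%:E)).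
  apply: (@le_trans _ _ (H (\bigcup_k (g @` A k)))).
    apply: le_hausdorff1 => _ [x Ex <-].
    have [k _ Akx] : (\bigcup_k A k) x by rewrite -UA; split; [exact: EU|exact: E01].
    by exists k => //; exists x.
  apply: (le_trans (hausdorff1_bigcup _)); apply: lee_nneseries => [i _ _|i _].
    exact: hausdorff1_ge0.
  by apply: arc_hausdorff_interval => // x [].
rewrite -ge0_integral_bigcup//; last 3 first.
- exact: arc_rho_emeasurable arcg _.
- by move=> t _; rewrite lee_fin (arc_rho_ge0 arcg).
- apply: trivIset_setIr; exact: open_disjoint_itv_trivIset.
have mUE : measurable (U `\` E) by apply: measurableD.
apply: (@le_trans _ _ (\int[mu]_(t in E `|` (U `\` E)) (rho t)%:E)).
  apply: (arc_int_subset arcg).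
  - by apply: bigcup_measurable => k _; exact: mA.
  - exact: measurableU.
  rewrite -UA => x [Ux _]; have [Ex|Ex] := pselect (E x); [by left|by right].
rewrite ge0_integral_setU//; last 3 first.
- exact: arc_rho_emeasurable arcg _.
- by move=> t _; rewrite lee_fin (arc_rho_ge0 arcg).
- by apply/disj_setPLR => x Ex [_ /(_ Ex)].
apply: leeD => //.
apply: (@le_trans _ _ (\int[mu]_(t in U `\` E) (cst C%:E t))).
  apply: ge0_le_integral => //.
  - by move=> t _; rewrite lee_fin (arc_rho_ge0 arcg).
  - exact: arc_rho_emeasurable arcg _.
  - by move=> t _; rewrite lee_fin (arc_rho_le arcg).
rewrite integral_cst//.
apply: (@le_trans _ _ (C%:E * (e / (C + 1))%:E)).
  by rewrite lee_wpmul2l ?lee_fin// ltW.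
rewrite -EFinM lee_fin mulrA ler_pdivrMr ?ltr_wpDl// mulrC.
by rewrite ler_pM2l// lerDl.
Qed.

End arc_length_measure.

Section integral_transfer.
Context d1 d2 (X : measurableType d1) (Y : measurableType d2) (R : realType).
Variables (mu : {measure set X -> \bar R}) (m : {measure set Y -> \bar R}).
Variables (phi : X -> Y) (rho : X -> R) (J : set X) (A : set Y).
Local Open Scope ereal_scope.
Import HBNNSimple.

(** The comparison of the two measures extends from sets to integrands through
    the simple functions below [w]. *)
Lemma le_integral_transfer (w : Y -> \bar R) :
  measurable_fun setT phi -> measurable_fun setT rho -> (forall x, (0 <= rho x)%R) ->
  measurable J -> measurable A -> measurable_fun setT w -> (forall y, 0 <= w y) ->
  (forall B, measurable B -> B `<=` A ->
    m B <= \int[mu]_(x in J `&` phi @^-1` B) (rho x)%:E) ->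
  \int[m]_(y in A) w y <= \int[mu]_(x in J) (w (phi x) * (rho x)%:E).
Proof.
move=> mphi mrho rho0 mJ mA mw w0 hm.
rewrite ge0_integralE//; apply: ge_ereal_sup => _ [h /= hw <-].
have mpre (B : set Y) : measurable B -> measurable (phi @^-1` B).
  by move=> mB; rewrite -[_ @^-1` _]setTI; exact: mphi.
have hwphi x : (h (phi x))%:E <= w (phi x).
  by apply: le_trans (hw _) _; rewrite patchE; case: ifPn.
apply: (@le_trans _ _ (\int[mu]_(x in J) ((h (phi x))%:E * (rho x)%:E))); last first.
  apply: ge0_le_integral => //.
  - by move=> x _; rewrite mule_ge0// lee_fin.
  - apply: emeasurable_funM; apply/measurable_EFinP; apply: measurable_funTS => //.
    by apply: measurableT_comp.
  - apply: emeasurable_funM; first by apply: measurable_funTS; exact: measurableT_comp.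
    by apply/measurable_EFinP; exact: measurable_funTS.
  - by move=> x _; rewrite lee_wpmul2r// lee_fin.
have mind r : measurable_fun setT (fun x => r * \1_(h @^-1` [set r]) (phi x))%R.
  apply: measurable_funM => //.
  by apply: (measurableT_comp (f := \1_(h @^-1` [set r]) : Y -> R)) => //; exact: measurable_indic.
rewrite (_ : \int[mu]_(x in J) _ = \sum_(r \in range h)
    \int[mu]_(x in J) ((r * \1_(h @^-1` [set r]) (phi x))%:E * (rho x)%:E)); last first.
  rewrite -ge0_integral_fsum//; last 2 first.
  - move=> r; apply: emeasurable_funM; apply/measurable_EFinP; exact: measurable_funTS.
  - by move=> r x _; rewrite EFinM mule_ge0 ?nnfun_muleindic_ge0// lee_fin.
  apply: eq_integral => x _.
  rewrite -ge0_mule_fsuml; last by move=> r; exact: nnfun_muleindic_ge0.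
  by rewrite fsumEFin// -fimfunE.
rewrite sintegralE; apply: lee_fsum => // r [y _ <-{r}].
set r := h y; have r0 : (0 <= r)%R by [].
have [->|rn0] := eqVneq r 0%R.
  by rewrite mul0e; apply: integral_ge0 => x _; rewrite mul0r mul0e.
under eq_integral do rewrite EFinM -muleA.
rewrite ge0_integralZl//; last 2 first.
- apply: emeasurable_funM; apply/measurable_EFinP; apply: measurable_funTS => //.
  by apply: (measurableT_comp (f := \1_(h @^-1` [set r]) : Y -> R)) => //; exact: measurable_indic.
- by move=> x _; rewrite mule_ge0 ?lee_fin.
apply: lee_wpmul2l; first by rewrite lee_fin.
apply: le_trans (hm _ _ _) _ => //.
  move=> z /= hz; have := hw z; rewrite patchE hz; case: ifPn => [/set_mem//|_].
  by rewrite lee_fin le_eqVlt (negbTE rn0)/= ltNge r0.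
rewrite integral_mkcondr; apply: ge0_le_integral => //.
- by move=> x _; rewrite patchE; case: ifPn => // _; rewrite lee_fin.
- apply/measurable_restrict => //; first exact: mpre.
  by apply/measurable_EFinP; exact: measurable_funTS.
- apply: emeasurable_funM; apply/measurable_EFinP; apply: measurable_funTS => //.
  by apply: (measurableT_comp (f := \1_(h @^-1` [set r]) : Y -> R)) => //; exact: measurable_indic.
move=> x _; rewrite patchE indicE.
rewrite (_ : (x \in _) = (phi x \in h @^-1` [set r])); last first.
  by apply/idP/idP => /set_mem ?; exact/mem_set.
by case: ifPn => _; rewrite ?mul1e ?mul0e.
Qed.

End integral_transfer.

(** The case of a measure that lives on a larger sigma-algebra than the
    integrand, such as Hausdorff measure on its Caratheodory sets; [iota] is
    then the identity. *)
Lemma le_integral_transfer_comp d1 d2 d3 (X : measurableType d1)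
    (Y : measurableType d2) (Z : measurableType d3) (R : realType)
    (mu : {measure set X -> \bar R}) (m : {measure set Z -> \bar R})
    (phi : X -> Y) (iota : Z -> Y) (rho : X -> R) (J : set X) (A : set Y)
    (w : Y -> \bar R) :
  measurable_fun setT iota -> measurable_fun setT phi -> measurable_fun setT rho ->
  (forall x, (0 <= rho x)%R) ->
  measurable J -> measurable A -> measurable_fun setT w -> (forall y, (0 <= w y)%E) ->
  (forall B, measurable B -> B `<=` A ->
    (m (iota @^-1` B) <= \int[mu]_(x in J `&` phi @^-1` B) (rho x)%:E)%E) ->
  (\int[m]_(z in iota @^-1` A) w (iota z) <=
  \int[mu]_(x in J) (w (phi x) * (rho x)%:E))%E.
Proof.
move=> miota mphi mrho rho0 mJ mA mw w0 hm.
rewrite -[leLHS](@ge0_integral_pushforward _ _ _ _ _ iota miota m A w)//.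
- exact: le_integral_transfer.
- exact: measurable_funTS.
Qed.

(** * Reparametrisation to global Lipschitz curves *)

Section clamp.
Context {R : realType} {n : nat}.
Notation mu := (@lebesgue_measure R).

(** Composing a path with this function freezes it outside the unit interval.
    It becomes Lipschitz on the whole line, which makes it the primitive of
    its derivative there, while its image, and its speed inside the interval,
    do not change. *)
Definition clamp (t : R) : R := if t <= 0 then 0 else if 1 <= t then 1 else t.

Lemma clamp01 t : `[0, 1]%classic (clamp t).
Proof.
rewrite /= in_itv/= /clamp; case: (leP t 0) => [_|t0]; first by rewrite lexx ler01.
by case: (leP 1 t) => [_|t1]; rewrite ?lexx ?ler01// !ltW.
Qed.

Lemma clampE t : 0 <= t -> t <= 1 -> clamp t = t.
Proof.
move=> t0 t1; rewrite /clamp; case: (leP t 0) => h; first lra.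
by case: (leP 1 t) => h'; lra.
Qed.

Lemma clamp_lip s t : `|clamp s - clamp t| <= `|s - t|.
Proof.
have h u v : u <= v -> 0 <= clamp v - clamp u <= v - u.
  move=> uv; rewrite /clamp.
  by case: (leP u 0) => ?; case: (leP v 0) => ?; case: (leP 1 u) => ?;
    case: (leP 1 v) => ?; apply/andP; split; lra.
have [/h/andP[? ?]|/ltW/h/andP[? ?]] := leP s t.
  by rewrite distrC (distrC s) !ger0_norm//; lra.
by rewrite !ger0_norm//; lra.
Qed.

Lemma image_clamp (g : R -> 'rV[R]_n) : (g \o clamp) @` `[0, 1] = g @` `[0, 1].
Proof.
apply/seteqP; split => _ [t + <-]; rewrite /= in_itv/= => /andP[t0 t1].
  by exists (clamp t) => //; exact: clamp01.
by exists t; rewrite /= ?in_itv/= ?t0//= clampE.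
Qed.

Lemma path_clamp_lip (C : R) (g : R -> 'rV[R]_n) : 0 <= C ->
  lipschitz2 C `[0, 1] g ->
  forall s t, norm2 ((g \o clamp) s - (g \o clamp) t) <= C * `|s - t|.
Proof.
move=> C0 gC s t; apply: le_trans (gC _ _ (clamp01 s) (clamp01 t)) _.
by rewrite ler_wpM2l// clamp_lip.
Qed.

Lemma speed_clamp (g : R -> 'rV[R]_n) t : 0 < t -> t < 1 ->
  speed (g \o clamp) t = speed g t.
Proof.
move=> t0 t1; rewrite /speed !derive1E; congr norm2; apply: near_eq_derive.
near=> u; rewrite /= clampE//; apply: ltW; near: u.
- exact: lt_nbhsr.
- exact: lt_nbhsl.
Unshelve. all: by end_near. Qed.

(** The speed may fail to be measurable, but differs from [rho] only on a null
    set. *)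
Lemma path_length_arc (C : R) (w : 'rV[R]_n -> \bar R) (g : R -> 'rV[R]_n) rho :
  measurable_fun setT (w : borelV -> \bar R) -> (forall z, (0 <= w z)%E) ->
  is_arc C (g \o clamp) rho ->
  path_length w g =
  (\int[mu]_(t in `[0%R, 1%R]) (w ((g \o clamp) t) * (rho t)%:E))%E.
Proof.
move=> mw w0 arcg; apply: ge0_ae_eq_integral_measurable => //.
- by move=> t _; rewrite mule_ge0// lee_fin norm2_ge0.
- by move=> t _; rewrite mule_ge0// lee_fin (arc_rho_ge0 arcg).
- apply: emeasurable_funM; last exact: arc_rho_emeasurable arcg _.
  apply: measurable_funTS; apply: (measurableT_comp mw).
  exact: continuous_borel (arc_continuous arcg).
have n01 (c : R) : {ae mu, forall t : R, t != c}.
  exists [set c]; split => //; first exact: lebesgue_measure_set1.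
  by move=> t /= /negP; rewrite negbK => /eqP.
have n0 := n01 0; have n1 := n01 1; have [_ _ _ _ ae] := arcg.
have fil := ae_filter_ringOfSetsType mu.
apply: filterS3 n0 n1 ae => t tn0 tn1 h; rewrite /= in_itv/= => /andP[t0 t1].
have {}t0 : 0 < t by rewrite lt_neqAle eq_sym tn0.
have {}t1 : t < 1 by rewrite lt_neqAle tn1.
by have [_ <-] := h t0 t1; rewrite speed_clamp// /= clampE// ltW.
Qed.

End clamp.

(** * The path distance *)

Section path_distance.
Context {R : realType} {n : nat}.
Notation mu := (@lebesgue_measure R).
Notation Hm := (@hausdorff1_measure R n).
Variable w : 'rV[R]_n -> \bar R.
Hypothesis mw : measurable_fun setT (w : borelV -> \bar R).
Hypothesis w0 : forall z, (0 <= w z)%E.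
Local Open Scope ereal_scope.
Implicit Types A B : set 'rV[R]_n.

Lemma hausdorff1_measurable_weight :
  measurable_fun setT (w : caratheodory_type (@hausdorff1_outer R n) -> \bar R).
Proof. by apply: (measurableT_comp mw); exact: id_borel_caratheodory. Qed.

Lemma closed_caratheodory A : closed A -> (@hausdorff1_outer R n).-cara.-measurable A.
Proof. by move=> cA; apply: borel_caratheodory; exact: closed_borel. Qed.

Lemma hausdorff1_integralU A B : closed A -> closed B ->
  \int[Hm]_(z in A `|` B) w z <= \int[Hm]_(z in A) w z + \int[Hm]_(z in B) w z.
Proof.
move=> /closed_caratheodory mA /closed_caratheodory mB.
have mBA := measurableD mB mA.
have mwD D := measurable_funTS (D := D) hausdorff1_measurable_weight.
have -> : A `|` B = A `|` (B `\` A).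
  apply/seteqP; split => z [Az|Bz]; [by left| |by left|by right; case: Bz].
  by have [Az|Az] := pselect (A z); [left|right].
rewrite ge0_integral_setU//; last first.
  by apply/disj_setPLR => z Az [_ /(_ Az)].
by apply: leeD => //; apply: ge0_subset_integral => //; exact: subDsetl.
Qed.

Lemma arc_image_closed (g : R -> 'rV[R]_n) (s t : R) : continuous g ->
  closed (g @` `[s, t]).
Proof.
move=> cg; apply: compact_closed; first exact: norm_hausdorff.
apply: continuous_compact; last exact: segment_compact.
exact: continuous_subspaceT.
Qed.

(** An inequality only, as a curve may run several times through the same
    point. *)
Lemma arc_integral_image (C : R) (g : R -> 'rV[R]_n) rho (s t : R) :
  is_arc C g rho -> (0 <= s)%R -> (t <= 1)%R ->
  \int[Hm]_(z in g @` `[s, t]) w z <= \int[mu]_(u in `[s, t]) (w (g u) * (rho u)%:E).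
Proof.
move=> arcg s0 t1; have cg := arc_continuous arcg.
have mA := closed_borel (arc_image_closed (s := s) (t := t) cg).
apply: (@le_integral_transfer_comp _ _ _ _ (@borelV R n)
    (caratheodory_type (@hausdorff1_outer R n)) R mu Hm g id rho `[s, t]%classic
    (g @` `[s, t]) w).
- exact: id_borel_caratheodory.
- exact: continuous_borel.
- exact: arc_rho_measurable arcg.
- exact: arc_rho_ge0 arcg.
- exact: measurable_itv.
- exact: mA.
- exact: mw.
- exact: w0.
move=> B mB BA.
apply: le_trans (arc_hausdorff arcg _ _).
- apply: le_hausdorff1 => z Bz; have [u hu uz] := BA _ Bz.
  by exists u => //; split => //=; rewrite uz.
- apply: measurableI => //; rewrite -[_ @^-1` _]setTI.
  exact: (continuous_borel cg).
- move=> u [] /=; rewrite !in_itv/= => /andP[su ut] _.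
  by rewrite (le_trans s0)// (le_trans ut).
Qed.

Lemma path_dist_ge0 x y : 0 <= path_dist w x y.
Proof. by apply: le_ereal_inf_tmp => _ [g _ <-]; exact: integral_ge0. Qed.

Lemma paths_continuous x y (g : R -> 'rV[R]_n) :
  paths x y g -> continuous (g \o clamp).
Proof.
move=> [C [_ _ _ gC]].
have C'0 : (0 < Num.max C 1)%R by rewrite lt_max ltr01 orbT.
have gC' : lipschitz2 (Num.max C 1%R) `[0%R, 1%R] g.
  move=> s t s01 t01; apply: le_trans (gC s t s01 t01) _.
  by rewrite ler_wpM2r// le_max lexx.
have [rho arcg] := arc_exists C'0 (path_clamp_lip (ltW C'0) gC').
exact: arc_continuous arcg.
Qed.

Lemma path_image_closed x y (g : R -> 'rV[R]_n) : paths x y g -> closed (g @` `[0%R, 1%R]).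
Proof. by move=> /paths_continuous cg; rewrite -image_clamp; exact: arc_image_closed. Qed.

Lemma path_dist_le x y (g : R -> 'rV[R]_n) : paths x y g ->
  path_dist w x y <= \int[Hm]_(z in g @` `[0%R, 1%R]) w z.
Proof. by move=> pg; apply: ereal_inf_lbound; exists g. Qed.

Lemma path_dist_sym_le x y : path_dist w x y <= path_dist w y x.
Proof.
apply: le_ereal_inf_tmp => _ [g [C [gcube g0 g1 gC]] <-].
have h (t : R) : t \in `[0%R, 1%R] -> (1 - t)%R \in `[0%R, 1%R] :> bool.
  by rewrite !in_itv/= => /andP[? ?]; apply/andP; split; lra.
have -> : g @` `[0%R, 1%R] = (fun t => g (1 - t)%R) @` `[0%R, 1%R].
  apply/seteqP; split => _ [t /h t01 <-]; exists (1 - t)%R => //.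
  by rewrite opprB addrC subrK.
apply: path_dist_le; exists C; split.
- by move=> t /h; exact: gcube.
- by rewrite subr0.
- by rewrite subrr.
- move=> s t /h s01 /h t01; apply: le_trans (gC _ _ s01 t01) _.
  by rewrite (_ : (1 - s - (1 - t) = t - s)%R) 1?distrC//; ring.
Qed.

Lemma path_dist_sym x y : path_dist w x y = path_dist w y x.
Proof. by apply/eqP; rewrite eq_le !path_dist_sym_le. Qed.

(** The two paths are run through one after the other at double speed. *)
Lemma paths_concat x y z (g1 g2 : R -> 'rV[R]_n) : paths x y g1 -> paths y z g2 ->
  exists2 g, paths x z g &
    g @` `[0%R, 1%R] = g1 @` `[0%R, 1%R] `|` g2 @` `[0%R, 1%R].
Proof.
move=> [C1 [cube1 g10 g11 lip1]] [C2 [cube2 g20 g21 lip2]].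
pose g (t : R) := if (2 * t <= 1)%R then g1 (2 * t)%R else g2 (2 * t - 1)%R.
have I1 (t : R) : `[0%R, 1%R]%classic t -> (2 * t <= 1)%R -> `[0%R, 1%R]%classic (2 * t)%R.
  by rewrite /= !in_itv/= => /andP[? ?] ?; apply/andP; split; lra.
have I2 (t : R) : `[0%R, 1%R]%classic t -> (1 <= 2 * t)%R -> `[0%R, 1%R]%classic (2 * t - 1)%R.
  by rewrite /= !in_itv/= => /andP[? ?] ?; apply/andP; split; lra.
have i0 : `[0%R, 1%R]%classic (0 : R)%R by rewrite /= in_itv/= lexx ler01.
have i1 : `[0%R, 1%R]%classic (1 : R)%R by rewrite /= in_itv/= lexx ler01.
pose C := Num.max 0%R (Num.max C1 C2).
have C0 : (0 <= C)%R by rewrite le_max lexx.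
have C1C : (C1 <= C)%R by rewrite !le_max lexx orbT.
have C2C : (C2 <= C)%R by rewrite !le_max lexx !orbT.
have half (t : R) : `[0%R, 1%R]%classic t -> (2 * t <= 1)%R ->
    (norm2 (g1 1%R - g1 (2 * t)%R) <= C * (1 - 2 * t))%R.
  move=> t01 ht; apply: le_trans (lip1 _ _ i1 (I1 _ t01 ht)) _.
  by rewrite ger0_norm ?subr_ge0// ler_wpM2r ?subr_ge0.
have half2 (t : R) : `[0%R, 1%R]%classic t -> (1 <= 2 * t)%R ->
    (norm2 (g2 (2 * t - 1)%R - g2 0%R) <= C * (2 * t - 1))%R.
  move=> t01 ht; apply: le_trans (lip2 _ _ (I2 _ t01 ht) i0) _.
  by rewrite subr0 ger0_norm ?subr_ge0// ler_wpM2r ?subr_ge0.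
have lipg (s t : R) : `[0%R, 1%R]%classic s -> `[0%R, 1%R]%classic t -> (s <= t)%R ->
    (norm2 (g t - g s) <= 2 * C * (t - s))%R.
  move=> s01 t01 st; rewrite /g; case: (leP (2 * s) 1)%R => hs; case: (leP (2 * t) 1)%R => ht.
  - apply: le_trans (lip1 _ _ (I1 _ t01 ht) (I1 _ s01 hs)) _.
    rewrite -mulrBr normrM ger0_norm// ger0_norm ?subr_ge0// mulrA (mulrC C1).
    by rewrite ler_wpM2r ?subr_ge0// ler_wpM2l.
  - apply: le_trans (norm2_triangle (g2 0%R) _ _) _.
    rewrite -[X in (_ + norm2 (X - _))%R](etrans g11 (esym g20)).
    have := half _ s01 hs; have := half2 _ t01 (ltW ht); lra.
  - lra.
  - apply: le_trans (lip2 _ _ (I2 _ t01 (ltW ht)) (I2 _ s01 (ltW hs))) _.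
    rewrite (_ : 2 * t - 1 - (2 * s - 1) = 2 * (t - s))%R; last by ring.
    rewrite normrM ger0_norm// ger0_norm ?subr_ge0// mulrA (mulrC C2).
    by rewrite ler_wpM2r ?subr_ge0// ler_wpM2l.
exists g.
  exists (2 * C)%R; split.
  - move=> t t01; rewrite /g; case: (leP (2 * t) 1)%R => ht.
      by apply: cube1; exact: I1.
    by apply: cube2; apply: I2 => //; exact: ltW.
  - by rewrite /g mulr0 ler01.
  - rewrite /g mulr1; case: (leP 2%R 1%R) => h; first by move: h; rewrite leNgt ltr1n.
    have -> : (2 - 1 = 1 :> R)%R by lra.
    exact: g21.
  - move=> s t s01 t01; have [st|/ltW st] := leP s t.
      by rewrite norm2Bc distrC (ger0_norm (_ : 0 <= t - s)%R) ?subr_ge0//; exact: lipg.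
    by rewrite ger0_norm ?subr_ge0//; exact: lipg.
apply/seteqP; split => [_ [t t01 <-]|_ [] [t + <-]].
- rewrite /g; case: (leP (2 * t) 1)%R => ht; [left|right].
    by exists (2 * t)%R => //; exact: I1.
  by exists (2 * t - 1)%R => //; apply: I2 => //; exact: ltW.
- rewrite /= in_itv/= => /andP[t0 t1]; exists (t / 2)%R.
    by rewrite /= in_itv/=; apply/andP; split; lra.
  by rewrite /g (_ : 2 * (t / 2) = t)%R ?t1//; field.
- rewrite /= in_itv/= => /andP[t0 t1]; exists ((t + 1) / 2)%R.
    by rewrite /= in_itv/=; apply/andP; split; lra.
  rewrite /g (_ : 2 * ((t + 1) / 2) = t + 1)%R; last by field.
  case: (leP (t + 1) 1)%R => ht; last by rewrite addrK.
  have -> : t = 0%R by clear -ht t0; lra.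
  by rewrite add0r g11 g20.
Qed.

Lemma path_dist_triangle y x z : path_dist w x z <= path_dist w x y + path_dist w y z.
Proof.
have [->|xy] := eqVneq (path_dist w x y) +oo.
  by rewrite addye ?leey// gt_eqF// (lt_le_trans ltNy0)// path_dist_ge0.
have [->|yz] := eqVneq (path_dist w y z) +oo.
  by rewrite addey ?leey// gt_eqF// (lt_le_trans ltNy0)// path_dist_ge0.
have fxy : path_dist w x y \is a fin_num by rewrite ge0_fin_numE ?path_dist_ge0// ltey.
have fyz : path_dist w y z \is a fin_num by rewrite ge0_fin_numE ?path_dist_ge0// ltey.
apply/lee_addgt0Pr => e e0; have e20 : (0 < e / 2)%R by rewrite divr_gt0.
have [_ [g1 p1 <-] d1] := lb_ereal_inf_adherent e20 fxy.
have [_ [g2 p2 <-] d2] := lb_ereal_inf_adherent e20 fyz.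
have [g pg gE] := paths_concat p1 p2.
apply: le_trans (path_dist_le pg) _; rewrite gE.
apply: le_trans (hausdorff1_integralU (path_image_closed p1) (path_image_closed p2)) _.
apply: le_trans (leeD (ltW d1) (ltW d2)) _.
by rewrite addeACA -EFinD -splitr.
Qed.

(** The piece of the curve between [s] and [t], reparametrised affinely,
    competes for the distance. *)
Lemma path_dist_arc (C : R) (g : R -> 'rV[R]_n) rho (s t : R) :
  is_arc C g rho -> (forall u, `[0%R, 1%R]%classic u -> cube (g u)) ->
  (0 <= s)%R -> (s <= t)%R -> (t <= 1)%R ->
  path_dist w (g s) (g t) <= \int[mu]_(u in `[s, t]) (w (g u) * (rho u)%:E).
Proof.
move=> arcg gcube s0 st t1.
apply: le_trans (arc_integral_image arcg s0 t1).
have C0 : (0 <= C)%R by apply: le_trans (arc_rho_ge0 arcg 0) (arc_rho_le arcg 0).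
pose h u : R := (s + u * (t - s))%R.
have hst (u : R) : `[0%R, 1%R]%classic u -> `[s, t]%classic (h u).
  rewrite /= !in_itv/= /h => /andP[u0 u1].
  rewrite lerDl mulr_ge0 ?subr_ge0//= -lerBrDl.
  by rewrite -[leRHS]mul1r ler_wpM2r ?subr_ge0.
have <- : (g \o h) @` `[0%R, 1%R] = g @` `[s, t].
  apply/seteqP; split => [_ [u /hst hu <-]|_ [v + <-]]; first by exists (h u).
  rewrite /= in_itv/= => /andP[sv vt].
  move: st; rewrite le_eqVlt => /orP[/eqP st|st].
    exists 0%R; first by rewrite /= in_itv/= lexx ler01.
    by rewrite /h/= mul0r addr0; congr g; lra.
  exists ((v - s) / (t - s))%R; last by rewrite /h/= divfK ?subr_eq0 ?gt_eqF// subrKC.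
  rewrite /= in_itv/= divr_ge0 ?subr_ge0 ?(ltW st)//=.
  by rewrite ler_pdivrMr ?subr_gt0// mul1r lerB.
apply: path_dist_le; exists (C * (t - s))%R; split.
- move=> u /hst; rewrite /= in_itv/= => /andP[su ut]; apply: gcube.
  by rewrite /= in_itv/= (le_trans s0)// (le_trans ut).
- by rewrite /h/= mul0r addr0.
- by rewrite /h/= mul1r subrKC.
- move=> u v _ _ /=; apply: le_trans (arc_lip arcg _ _) _.
  rewrite /h (_ : s + u * (t - s) - (s + v * (t - s)) = (t - s) * (u - v))%R; last by ring.
  by rewrite normrM mulrA ger0_norm ?subr_ge0.
Qed.

End path_distance.

(** * Regularity of finite Borel measures *)

Section borel_regularity.
Context {R : realType} {n : nat}.
Local Open Scope ereal_scope.
Notation H := (@hausdorff1 R n).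
Notation Hm := (@hausdorff1_measure R n).

Lemma closed_inner (U : set 'rV[R]_n) k : closed (inner U k).
Proof.
have -> : inner U k = \bigcap_(w in ~` U) [set z | (k.+1%:R^-1 <= `|z - w|)%R].
  apply/seteqP; split => [z zk w /= Uw|z zk w zw].
    by rewrite leNgt; apply/negP => /zk.
  by apply: contrapT => Uw; have := zk _ Uw; rewrite /= leNgt zw.
apply: closed_bigI => w _.
rewrite (_ : [set z | _] = ~` ball w k.+1%:R^-1).
  by apply: open_closedC; apply: ball_open; rewrite invr_gt0.
by apply/seteqP; split => z; rewrite mx_norm_ball /ball_/= distrC leNgt => /negP.
Qed.

Section regularity.
Variable m : {measure set (@borelV R n) -> \bar R}.
Hypothesis moo : m setT < +oo.

Let finite_m (A : set borelV) : measurable A -> m A < +oo.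
Proof. by move=> mA; apply: le_lt_trans moo; apply: le_measure; rewrite ?inE. Qed.

Let approximable (B : set borelV) : Prop :=
  forall e : R, (0 < e)%R -> exists F U : set 'rV[R]_n,
    [/\ closed F, open U, F `<=` B, B `<=` U & m (U `\` F) < e%:E].

Let lt_of_cvg0 (A : (set borelV)^nat) (a : \bar R) : (forall i, measurable (A i)) ->
  (forall i j, (i <= j)%N -> A j `<=` A i) -> m (\bigcap_i A i) < a ->
  exists i, m (A i) < a.
Proof.
move=> mA ndA lta.
have cv : m \o A @ \oo --> m (\bigcap_i A i).
  apply: nonincreasing_cvg_mu => //; first exact: finite_m.
    exact: bigcap_measurable.
  by move=> i j ij; apply/subsetPset; exact: ndA.
apply: contrapT => h; move: lta; rewrite ltNge => /negP; apply.
apply: (cvge_ge _ cv); apply: nearW => i /=; rewrite leNgt; apply/negP => hi.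
by apply: h; exists i.
Qed.

Let open_approximable U : open U -> approximable U.
Proof.
move=> oU e e0.
have mI k : measurable (U `\` inner U k : set borelV).
  apply: measurableD; first exact: open_borel.
  by apply: closed_borel; exact: closed_inner.
have [||k ke] := @lt_of_cvg0 (fun k => U `\` inner U k) e%:E mI.
- by move=> i j ij z [Uz zj]; split => // /(inner_mono ij).
- rewrite (_ : \bigcap_i _ = set0) ?measure0 ?lte_fin//.
  rewrite -subset0 => z zU; have [k _ zk] := inner_bigcup oU (zU 0%N I).1.
  by have [_] := zU k I.
exists (inner U k), U; split => //; [exact: closed_inner|exact: inner_sub].
Qed.

Let bigcup_approximable (B : (set borelV)^nat) :
  (forall k, approximable (B k)) -> approximable (\bigcup_k B k).
Proof.
move=> hB e e0; have e20 : (0 < e / 2)%R by rewrite divr_gt0.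
have /choice[F /choice[U FU]] k : exists F, exists U, [/\ closed F, open U, F `<=` B k,
    B k `<=` U & m (U `\` F) < (e / 2 / (2 ^ k.+1)%:R)%:E].
  by have [F [U FU]] := hB k (e / 2 / (2 ^ k.+1)%:R)%R ltac:(by rewrite divr_gt0); exists F, U.
have cF k : closed (F k) by case: (FU k).
have oU k : open (U k) by case: (FU k).
have FB k : F k `<=` B k by case: (FU k).
have BU k : B k `<=` U k by case: (FU k).
have mF k : measurable (F k : set borelV) := closed_borel (cF k).
have mU k : measurable (U k : set borelV) := open_borel (oU k).
pose G N := \big[setU/set0]_(i < N) F i.
have cG N : closed (G N) by apply: closed_bigsetU => i _.
have mUU : measurable (\bigcup_k U k : set borelV) by exact: bigcupT_measurable.
have mA N : measurable ((\bigcup_k U k) `\` G N : set borelV).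
  by apply: measurableD => //; exact: closed_borel.
have ndA i j : (i <= j)%N -> (\bigcup_k U k) `\` G j `<=` (\bigcup_k U k) `\` G i.
  by move=> ij z [Uz zG]; split => // zi; apply: zG; exact: subset_bigsetU zi.
have lte : m (\bigcap_N ((\bigcup_k U k) `\` G N)) < e%:E.
  apply: (@le_lt_trans _ _ (e / 2)%:E); last by rewrite lte_fin ltr_pdivrMr// ltr_pMr// ltr1n.
  apply: le_trans _ (epsilon_trick0 xpredT (ltW e20)).
  apply: (@le_trans _ _ (m (\bigcup_k (U k `\` F k)))).
    apply: le_measure; rewrite ?inE.
    - exact: bigcap_measurable.
    - by apply: bigcupT_measurable => k; exact: measurableD.
    move=> z zN; have [[k _ Uk] _] := zN 0%N I.
    exists k => //; split => // Fk; have [_] := zN k.+1 I; apply.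
    by rewrite /G -bigcup_mkord; exists k => /=.
  apply: (@le_trans _ _ (\sum_(k <oo) m (U k `\` F k))).
    apply: generalized_Boole_inequality.
      by move=> k; exact: measurableD.
    by apply: bigcupT_measurable => k; exact: measurableD.
  by apply: lee_nneseries => // k _; case: (FU k) => *; exact: ltW.
have [N hN] := lt_of_cvg0 mA ndA lte.
exists (G N), (\bigcup_k U k); split => //.
- exact: bigcup_open.
- by rewrite /G -bigcup_mkord => z [k _ Fk]; exists k => //; exact: FB.
- by move=> z [k _ Bk]; exists k => //; exact: BU.
Qed.

(** The sets that lie between a closed and an open set with a small difference
    form a sigma-algebra. Countable unions are the point: their inner
    approximations are finite unions of closed sets. *)
Lemma borel_approximable (B : set borelV) : measurable B -> approximable B.
Proof.
apply: smallest_sub; last exact: open_approximable.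
split.
- by apply: open_approximable; exact: open0.
- move=> A hA e e0; have [F [U [cF oU FA AU FU]]] := hA e e0.
  exists (~` U), (~` F); split.
  + exact: open_closedC.
  + exact: closed_openC.
  + by move=> z Uz; split => // /AU.
  + by move=> z [_ Az] /FA.
  + by rewrite setDE setCK setIC -setDE.
- exact: bigcup_approximable.
Qed.

End regularity.

(** The trace of Hausdorff measure on [S] is a finite Borel measure. *)
Lemma hausdorff1_inner_closed (S : set 'rV[R]_n) (e : R) : borel_set S ->
  H S < +oo -> (0 < e)%R ->
  exists K, [/\ closed K, K `<=` S & H (S `\` K) < e%:E].
Proof.
move=> bS Soo e0.
pose m0 (B : set (@borelV R n)) : \bar R := H (B `&` S).
have m00 : m0 set0 = 0 by rewrite /m0 set0I hausdorff10.
have m0_ge0 B : 0 <= m0 B by exact: hausdorff1_ge0.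
have m0_additive : semi_sigma_additive m0.
  move=> F mF tF mUF; rewrite /m0 setI_bigcupl.
  have mFS i : (@hausdorff1_outer R n).-cara.-measurable (F i `&` S).
    by apply: measurableI; apply: borel_caratheodory => //; exact: mF.
  apply: (@measure_semi_sigma_additive _ _ _ Hm (fun i => F i `&` S)) => //.
    exact: trivIset_setIr.
  by apply: bigcupT_measurable.
pose m : {measure set (@borelV R n) -> \bar R} :=
  HB.pack m0 (isMeasure.Build _ _ _ m0 m00 m0_ge0 m0_additive).
have moo : m setT < +oo by rewrite /= /m0 setTI.
have [K [U [cK oU KS SU UK]]] := borel_approximable moo bS e0.
exists K; split => //; apply: le_lt_trans UK; rewrite /= /m0.
by apply: le_hausdorff1 => z [Sz Kz]; split => //; split => //; exact: SU.
Qed.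

End borel_regularity.

(** * The weight *)

Section weight.
Context {R : realType} {n : nat}.
Variables (S : set 'rV[R]_n) (a : \bar R) (b : 'rV[R]_n -> R).
Hypothesis S_borel : borel_set S.
Hypothesis a_ge0 : (0 <= a)%E.
Hypothesis b_ge0 : forall z, S z -> 0 <= b z.
Hypothesis b_lsc : lower_semicontinuous_on S b.
Hypothesis b_le_a : forall z, S z -> ((b z)%:E <= a)%E.
Notation w := (extend S a b).

Lemma extend_in z : S z -> w z = (b z)%:E.
Proof. by move=> Sz; rewrite /extend /patch mem_set. Qed.

Lemma extend_out z : ~ S z -> w z = a.
Proof. by move=> Sz; rewrite /extend /patch memNset. Qed.

Lemma extend_ge0 z : (0 <= w z)%E.
Proof.
have [Sz|Sz] := pselect (S z); last by rewrite extend_out.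
by rewrite extend_in// lee_fin b_ge0.
Qed.

Lemma extend_le z : (w z <= a)%E.
Proof.
have [Sz|Sz] := pselect (S z); last by rewrite extend_out.
by rewrite extend_in// b_le_a.
Qed.

(** Relatively open subsets of [S] are traces of open sets. *)
Lemma lsc_open (c : R) : exists2 O : set 'rV[R]_n, open O &
  forall z, S z -> (O z <-> c < b z).
Proof.
exists (\bigcup_(U in [set U : set 'rV[R]_n | open U /\ forall z, U z -> S z -> c < b z]) U).
  by apply: bigcup_open => U [].
move=> z Sz; split; first by move=> [U [_ h] Uz]; exact: h.
move=> cbz; have [|V nV hV] := b_lsc (x := z) (a := c).
  by rewrite lte_fin.
move: nV; rewrite {1}/nbhs/= -nbhs_subspace_in// => nV.
have [U [oU Uz] UV] : exists2 U, open_nbhs z U & U `<=` [set y | S y -> V y].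
  by move: nV; rewrite /within/= nbhsE.
exists U => //; split => // y Uy Sy.
by have := hV _ (UV _ Uy Sy); rewrite /= lte_fin.
Qed.

Lemma sublevel_borel (lambda : R) : borel_set (sublevel S b lambda).
Proof.
have [V oV hV] := lsc_open lambda.
rewrite (_ : sublevel S b lambda = S `\` V).
  exact: (@measurableD _ (@borelV R n) _ _ S_borel (open_borel oV)).
apply/seteqP; split => z [Sz]; rewrite /= => h; split => //.
  by move=> /(hV _ Sz); rewrite ltNge h.
by rewrite /= leNgt; apply/negP => /(hV _ Sz).
Qed.

(** The sublevel sets of [b] are only closed relative to [S]; on a closed
    subset of [S] they are closed in the whole space. *)
Lemma closed_sublevelI (K : set 'rV[R]_n) (c : R) : closed K -> K `<=` S ->
  closed (K `&` [set z | b z <= c]).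
Proof.
move=> cK KS; have [V oV hV] := lsc_open c.
rewrite (_ : _ `&` _ = K `&` ~` V); first by apply: closedI => //; exact: open_closedC.
apply/seteqP; split => z [Kz]; rewrite /= => h; split => //.
  by move=> /(hV _ (KS _ Kz)); rewrite ltNge h.
by rewrite /= leNgt; apply/negP => /(hV _ (KS _ Kz)).
Qed.

Lemma extend_measurable : measurable_fun setT (w : borelV -> \bar R).
Proof.
apply: (@measurability _ _ _ _ setT _ _ (ErealGenOInfty.measurableE R)).
move=> _ [_ [c ->] <-]; rewrite setTI.
pose A : set 'rV[R]_n := if (c%:E < a)%E then ~` S else set0.
rewrite (_ : _ @^-1` _ = (S `\` sublevel S b c) `|` A); last first.
  apply/seteqP; split => z /=; rewrite in_itv/= andbT.
    have [Sz|Sz] := pselect (S z).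
      rewrite extend_in// lte_fin => h; left; split => // -[_] /=.
      by rewrite leNgt h.
    by rewrite extend_out// => ca; right; rewrite /A ca.
  case=> [[Sz h]|].
    by rewrite extend_in// lte_fin ltNge; apply/negP => hb; exact: h.
  by rewrite /A; case: ifPn => // h Sz; rewrite extend_out.
apply: measurableU.
  by apply: (@measurableD _ (@borelV R n)) => //; exact: sublevel_borel.
by rewrite /A; case: ifPn => _ //; exact: (@measurableC _ (@borelV R n)).
Qed.

End weight.

(** * Partitions, chords and lower limits *)

Lemma partition_index {R : realType} (p : nat -> R) (N : nat) (u : R) : p 0%N <= u -> u < p N ->
  exists i, [/\ (i < N)%N, p i <= u & u < p i.+1].
Proof.
move=> p0; elim: N => [|N IH] uN; first by move: uN; rewrite ltNge p0.
have [/IH[k [kN pk pk1]]|Nu] := ltP u (p N); last by exists N.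
by exists k; split => //; rewrite ltnW.
Qed.

(** The chord straddles the point of differentiability, so that it can be any
    piece of a partition. *)
Lemma chord_speed {R : realType} {n : nat} (g : R -> 'rV[R]_n) (u e : R) :
  derivable g u 1 -> 0 < e ->
  exists2 d : R, 0 < d & forall p q, p <= u -> u <= q -> q - p < d ->
    (speed g u - e) * (q - p) <= norm2 (g q - g p).
Proof.
move=> dg e0; pose v := g^`()%classic u.
have [d d0 hd] : exists2 d : R, 0 < d & forall h, `|h| < d ->
    norm2 (g (h + u) - g u - h *: v) <= e * `|h|.
  pose q (h : R) : 'rV[R]_n := h^-1 *: (g (h + u) - g u).
  have cv : q h @[h --> 0^'] --> v.
    have := dg; rewrite /derivable /v /derive1.
    suff -> : (fun h : R => h^-1 *: ((g \o shift u) (h *: 1) - g u)) = q by [].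
    by apply/funext => h; congr (_ *: (g (_ + _) - _)); exact: mulr1.
  have cvn : norm2 (q h - v) @[h --> 0^'] --> norm2 (v - v).
    exact: (cvg_comp _ _ cv (@norm2_dist_continuous _ _ v v)).
  rewrite subrr norm2_0 in cvn.
  have /cvgrPdist_le /(_ e e0) := cvn.
  move=> /nbhs_ballP[d /= d0 hd]; exists d => // h hd'.
  have [->|h0] := eqVneq h 0.
    by rewrite add0r subrr scale0r subrr norm2_0 normr0 mulr0.
  have := hd h; rewrite -ball_normE /ball_/= sub0r normrN => /(_ hd' h0).
  rewrite sub0r normrN ger0_norm ?norm2_ge0// => hq.
  have -> : g (h + u) - g u - h *: v = h *: (q h - v).
    by rewrite scalerBr /q scalerA mulfV// scale1r.
  by rewrite norm2Z mulrC ler_wpM2r.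
exists d => // p q pu uq qp.
have hq := hd (q - u) _; have hp := hd (p - u) _.
move: hq hp; rewrite !subrK ger0_norm ?subr_ge0// ler0_norm ?subr_le0//.
move=> /(_ ltac:(lra)) hq /(_ ltac:(lra)) hp.
have -> : speed g u = norm2 v by [].
have hv : (q - p) * norm2 v = norm2 ((q - p) *: v).
  by rewrite norm2Z ger0_norm// subr_ge0 (le_trans pu).
have : norm2 ((q - p) *: v) <= norm2 (g q - g p) + norm2 (g q - g u - (q - u) *: v) +
    norm2 (g p - g u - (p - u) *: v).
  set E1 := g q - g u - _; set E2 := g p - g u - _.
  have -> : (q - p) *: v = (g q - g p) + (- E1) + E2.
    rewrite /E1 /E2 !opprB !scalerBl; apply/matrixP => i j; rewrite !mxE; ring.
  apply: le_trans (norm2D _ _) _; rewrite lerD2r.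
  by apply: le_trans (norm2D _ _) _; rewrite norm2N.
by rewrite -hv; lra.
Qed.

Lemma ler_mul_approx {R : realType} (m v q r e : R) : 0 <= m -> 0 <= q -> 0 <= v ->
  0 <= r -> 0 < e -> v - e <= m -> r - e <= q -> v * r - e * (v + r + 1) <= m * q.
Proof.
move=> m0 q0 v0 r0 e0 vm rq; have mq := mulr_ge0 m0 q0; have er := mulr_ge0 (ltW e0) r0.
have ev := mulr_ge0 (ltW e0) v0.
have [ve|/ltW ve] := leP v e; first by have := ler_wpM2r r0 ve; lra.
have [re|/ltW re] := leP r e; first by have := ler_wpM2l v0 re; lra.
have : (v - e) * (r - e) <= m * q by apply: ler_pM; rewrite ?subr_ge0.
have := mulr_ge0 (ltW e0) (ltW e0); lra.
Qed.

Section liminf_bounds.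
Context {R : realType}.
Local Open Scope ereal_scope.

Lemma limn_einf_ge (u : (\bar R)^nat) (x : \bar R) :
  (exists N0, forall N, (N0 <= N)%N -> x <= u N) -> x <= limn_einf u.
Proof.
move=> [N0 h]; rewrite limn_einf_lim; apply: lime_ge; first exact: is_cvg_einfs.
exists N0 => // N /= N0N; apply: le_ereal_inf_tmp => _ [k /= Nk <-].
by apply: h; exact: leq_trans Nk.
Qed.

Lemma limn_einf_le (u : (\bar R)^nat) (x : \bar R) :
  (forall N, u N <= x) -> limn_einf u <= x.
Proof.
move=> h; rewrite limn_einf_lim; apply: lime_le; first exact: is_cvg_einfs.
exists 0%N => // N _; apply: le_trans (h N); apply: ereal_inf_lbound.
by exists N => //=.
Qed.

Lemma measurable_fun_limn_einf (D : set R) (f : (R -> \bar R)^nat) :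
  (forall N, measurable_fun D (f N)) ->
  measurable_fun D (fun u => limn_einf (f^~ u)).
Proof.
move=> mf; rewrite /limn_einf; apply: measurableT_comp; first exact: oppe_measurable.
apply: (@measurable_fun_limn_esup _ _ _ _ (fun N u => - f N u)) => N.
by apply: measurableT_comp; [exact: oppe_measurable|exact: mf].
Qed.

End liminf_bounds.

(** * Lower semicontinuity of the truncated length *)

Section uniform_limit_of_arcs.
Context {R : realType} {n : nat}.
Notation mu := (@lebesgue_measure R).
Notation H := (@hausdorff1 R n).
(** The set [Sl] stands for the sublevel set of the weight at [lambda]. The
    semicontinuity of the weight is stated on closed subsets of [Sl], where it
    does not refer to the topology of a subspace. *)
Variables (w : 'rV[R]_n -> \bar R) (Sl : set 'rV[R]_n) (lambda : R).
Hypothesis mw : measurable_fun setT (w : borelV -> \bar R).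
Hypothesis w0 : forall z, (0 <= w z)%E.
Hypothesis lambda_ge0 : 0 <= lambda.
Hypothesis w_in : forall z, Sl z -> (w z <= lambda%:E)%E.
Hypothesis w_out : forall z, ~ Sl z -> (lambda%:E <= w z)%E.
Hypothesis Sl_borel : borel_set Sl.
Hypothesis Sl_fin : (H Sl < +oo)%E.
Hypothesis w_level : forall K (c : R), closed K -> K `<=` Sl ->
  closed (K `&` [set z | (w z <= c%:E)%E]).
Variables (C : R) (g_ : nat -> R -> 'rV[R]_n) (rho_ : nat -> R -> R).
Variables (g : R -> 'rV[R]_n) (rho : R -> R).
Hypothesis arc_ : forall j, is_arc C (g_ j) (rho_ j).
Hypothesis arcg : is_arc C g rho.
Hypothesis unif : forall e : R, 0 < e ->
  exists N : nat, forall j u, (N <= j)%N -> norm2 (g_ j u - g u) <= e.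

(** Near each time, the limit has some room in [V]; compactness makes it
    uniform. *)
Lemma arcs_eventually_in (s t : R) (V : set 'rV[R]_n) : open V ->
  g @` `[s, t] `<=` V ->
  exists N : nat, forall j, (N <= j)%N -> g_ j @` `[s, t] `<=` V.
Proof.
move=> oV gV.
have /compact_near_coveringP cov := @segment_compact R s t.
have : \forall j \near \oo, `[s, t]%classic `<=` (fun u => V (g_ j u)).
  apply: (cov nat \oo (fun j u => V (g_ j u))) => u ust.
  have /nbhs_ballP[e /= e0 eV] : nbhs (g u) V.
    by apply: open_nbhs_nbhs; split => //; apply: gV; exists u.
  have e20 : 0 < e / 2 by rewrite divr_gt0.
  have [N hN] := unif e20.
  have := @arc_continuous _ _ _ _ _ arcg u.
  move=> /cvgrPdist_lt /(_ _ e20) gu.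
  exists ([set u' | `|g u - g u'| < e / 2], [set j | (N <= j)%N]).
    by split => //; exists N.
  move=> [u' j] /= [uu' Nj]; apply: eV; rewrite mx_norm_ball /ball_/=.
  rewrite (le_lt_trans (ler_distD (g u') _ _))// [ltRHS]splitr.
  rewrite ltr_leD//; apply: le_trans (norm_le_norm2 _) _.
  by rewrite norm2Bc; exact: hN.
move=> [N _ hN]; exists N => j Nj _ [u ust <-]; exact: hN.
Qed.

Let C_ge0 : 0 <= C.
Proof. exact: le_trans (arc_rho_ge0 arcg 0) (arc_rho_le arcg 0). Qed.

Let preimage_g (h : R -> 'rV[R]_n) (r : R -> R) (B : set 'rV[R]_n) :
  is_arc C h r -> borel_set B -> measurable (h @^-1` B).
Proof.
move=> arch bB; rewrite -[_ @^-1` _]setTI.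
exact: (continuous_borel (arc_continuous arch)).
Qed.

(** Only the length of the part of the curve in [B] is counted, and its image
    is at most as long. *)
Lemma ge0_length_lower (h : R -> 'rV[R]_n) (r : R -> R) (s t m : R) (B : set 'rV[R]_n) :
  is_arc C h r -> 0 <= s -> t <= 1 -> borel_set B -> 0 <= m ->
  (forall z, B z -> (m%:E <= w z)%E) ->
  (m%:E * H (h @` `[s, t] `&` B) <= \int[mu]_(u in `[s, t]) (w (h u) * (r u)%:E))%E.
Proof.
move=> arch s0 t1 bB m0 wB.
have mB := preimage_g arch bB.
have mE : measurable (`[s, t] `&` h @^-1` B) by exact: measurableI.
have mint D : measurable_fun D (fun u => w (h u) * (r u)%:E)%E.
  apply: emeasurable_funM; last exact: arc_rho_emeasurable arch _.
  apply: measurable_funTS; apply: (measurableT_comp mw).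
  exact: continuous_borel (arc_continuous arch).
apply: (@le_trans _ _ (m%:E * \int[mu]_(u in `[s, t] `&` h @^-1` B) (r u)%:E)%E).
  apply: lee_wpmul2l; first by rewrite lee_fin.
  apply: le_trans (arc_hausdorff arch mE _).
    by apply: le_hausdorff1 => _ [[u ust <-] Bz]; exists u.
  move=> u [] /=; rewrite !in_itv/= => /andP[su ut] _.
  by rewrite (le_trans s0)// (le_trans ut).
apply: (@le_trans _ _ (\int[mu]_(u in `[s, t] `&` h @^-1` B) (w (h u) * (r u)%:E))%E).
  rewrite -ge0_integralZl//; last 2 first.
  - exact: arc_rho_emeasurable arch _.
  - by move=> u _; rewrite lee_fin (arc_rho_ge0 arch).
  apply: ge0_le_integral => //.
  - by move=> u _; rewrite mule_ge0// lee_fin// (arc_rho_ge0 arch).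
  - by apply: emeasurable_funM => //; exact: arc_rho_emeasurable arch _.
  - exact: mint.
  - by move=> u [_ Bu]; rewrite lee_wpmul2r ?lee_fin ?(arc_rho_ge0 arch)//; exact: wB.
apply: ge0_subset_integral => //; first exact: mint.
by move=> u _; rewrite mule_ge0// lee_fin (arc_rho_ge0 arch).
Qed.

(** Along the curve, the distance to [z] takes all the values between those at
    the ends. The Hausdorff measure accounts for those taken in [V], the set
    [D] for the others. *)
Lemma chord_le_hausdorff (h : R -> 'rV[R]_n) (r : R -> R) (s t : R) (z : 'rV[R]_n)
    (V : set 'rV[R]_n) (D : set R) :
  is_arc C h r -> s <= t -> measurable D ->
  (fun y => norm2 (y - z)) @` (h @` `[s, t] `\` V) `<=` D ->
  ((norm2 (h t - z) - norm2 (h s - z))%:E <= H (h @` `[s, t] `&` V) + mu D)%E.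
Proof.
move=> arch st mD hD; pose f y : R := norm2 (y - z).
have [fst|/ltW fst] := leP (f (h t)) (f (h s)).
  apply: (@le_trans _ _ 0%E); first by rewrite lee_fin subr_le0.
  by rewrite adde_ge0 ?hausdorff1_ge0.
apply: (@le_trans _ _ (mu `[f (h s), f (h t)])).
  rewrite lebesgue_measure_itv/= lte_fin; case: ifPn => //.
  by rewrite -leNgt lee_fin subr_le0.
apply: (@hausdorff1_lower _ _ f) => //; first exact: norm2_dist_lip.
move=> v /=; rewrite in_itv/= => /andP[v1 v2].
have cf : {within `[s, t], continuous (f \o h)}.
  apply: continuous_subspaceT => u; apply: continuous_comp.
    exact: arc_continuous arch u.
  exact: norm2_dist_continuous.
have [|u ust fu] := IVT st cf (v := v).
  by rewrite ge_min v1/= le_max v2 orbT.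
have [Vu|Vu] := pselect (V (h u)).
  by left; exists (h u) => //; split => //; exists u.
by right; apply: hD; exists (h u) => //; split => //; exists u.
Qed.

(** On an interval of times, the length of the approximating curves is at
    least that of the chord of the limit, weighted with a lower bound [m] of
    the weight, up to the length of the limit in the bad set [Sl `\` K]. The
    approximating curves may use the bad set freely. But where the limit
    avoids it, the weight near the limit is almost [m] or more, except on a
    part of [Sl] of small length; only a small part of the chord can be
    covered by that part. *)
Lemma chord_weight_le (s t m eta : R) (K : set 'rV[R]_n) :
  0 <= s -> s <= t -> t <= 1 -> closed K -> K `<=` Sl ->
  0 <= m -> m <= lambda ->
  (forall u, `[s, t]%classic u -> K (g u) -> (m%:E <= w (g u))%E) -> 0 < eta ->
  exists N : nat, forall j, (N <= j)%N ->
    ((m * norm2 (g t - g s))%:E <= \int[mu]_(u in `[s, t]) (w (g_ j u) * (rho_ j u)%:E) +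
      m%:E * \int[mu]_(u in `[s, t] `&` g @^-1` (Sl `\` K)) (rho u)%:E + eta%:E)%E.
Proof.
move=> s0 st t1 cK KS m0 ml hm eta0.
have L_ge0 j : (0 <= \int[mu]_(u in `[s, t]) (w (g_ j u) * (rho_ j u)%:E))%E.
  by apply: integral_ge0 => u _; rewrite mule_ge0// lee_fin (arc_rho_ge0 (arc_ j)).
set nu := (\int[mu]_(u in _ `&` g @^-1` _) _)%E.
have nu_ge0 : (0 <= nu)%E by apply: integral_ge0 => u _; rewrite lee_fin (arc_rho_ge0 arcg).
move: m0; rewrite le_eqVlt => /orP[/eqP m0|m0].
  exists 0%N => j _; rewrite -m0 mul0r mul0e adde0 adde_ge0// lee_fin ltW//.
have l0 : 0 < lambda by apply: lt_le_trans ml.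
(* The loss [delta] in the weight is paid along a chord of length at most [C],
   the loss [e] in length, four times, with weight at most [lambda]. *)
pose delta := Num.min m (eta / (2 * (C + 1))).
have C1 : 0 < C + 1 by rewrite ltr_wpDl.
have delta0 : 0 < delta by rewrite lt_min m0/= divr_gt0// mulr_gt0.
have deltam : delta <= m by rewrite ge_min lexx.
pose m' := m - delta.
have m'0 : 0 <= m' by rewrite subr_ge0.
have m'm : m' < m by rewrite ltrBlDr ltrDl.
pose e := eta / (8 * lambda).
have e0 : 0 < e by rewrite divr_gt0// mulr_gt0.
have [K' [cK' K'S SK']] := hausdorff1_inner_closed Sl_borel Sl_fin e0.
pose K2 := K `|` K'.
have cK2 : closed K2 by exact: closedU.
have K2S : K2 `<=` Sl by move=> z [/KS|/K'S].
(* On the open set [V], the weight is at least [m'] except on a part of [Sl]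
   off [K2], which has length less than [e]. *)
pose V := ~` (K2 `&` [set z | (w z <= m'%:E)%E]).
have oV : open V by apply: closed_openC; exact: w_level.
have bSK : borel_set (Sl `\` K).
  exact: (@measurableD _ (@borelV R n) _ _ Sl_borel (closed_borel cK)).
have bB : borel_set (V `&` ~` (Sl `\` K2)).
  apply: (@measurableI _ (@borelV R n)); first exact: open_borel.
  apply: (@measurableC _ (@borelV R n)).
  exact: (@measurableD _ (@borelV R n) _ _ Sl_borel (closed_borel cK2)).
have wB z : (V `&` ~` (Sl `\` K2)) z -> (m'%:E <= w z)%E.
  move=> [Vz Sz]; have [Slz|/w_out] := pselect (Sl z); last first.
    by apply: le_trans; rewrite lee_fin (le_trans _ ml)// ltW.
  have K2z : K2 z by apply: contrapT => K2z; exact: Sz.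
  by rewrite leNgt; apply/negP => wm; apply: Vz; split => //; exact: ltW.
pose f y : R := norm2 (y - g s).
have cf : continuous f by exact: norm2_dist_continuous.
have clV (h : R -> 'rV[R]_n) : continuous h -> compact (f @` (h @` `[s, t] `\` V)).
  move=> ch; apply: continuous_compact; first exact: continuous_subspaceT.
  apply: compact_closedI; last exact: open_closedC.
  by apply: continuous_compact; [exact: continuous_subspaceT|exact: segment_compact].
pose D := f @` (g @` `[s, t] `\` V).
have mD : measurable D by apply: compact_measurable; exact: clV (arc_continuous arcg).
have D_nu : (mu D <= nu)%E.
  apply: (@le_trans _ _ (H (g @` `[s, t] `\` V))).
    rewrite -[leRHS]adde0 -(measure0 mu).
    apply: (@hausdorff1_lower _ _ f) => //; first exact: norm2_dist_lip.
  have mE : measurable (`[s, t] `&` g @^-1` (Sl `\` K)).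
    by apply: measurableI => //; exact: preimage_g arcg bSK.
  apply: le_trans (arc_hausdorff arcg mE _).
    apply: le_hausdorff1 => _ [[u ust <-] /contrapT[K2u wu]].
    exists u => //; split => //; split; first exact: K2S.
    by move=> /(hm _ ust) /le_trans /(_ wu); rewrite lee_fin leNgt m'm.
  move=> u [] /=; rewrite !in_itv/= => /andP[su ut] _.
  by rewrite (le_trans s0)// (le_trans ut).
have nuoo : (nu < +oo)%E.
  apply: (@le_lt_trans _ _ (\int[mu]_(u in `[s, t]) (cst C%:E u))%E).
    apply: (@le_trans _ _ (\int[mu]_(u in `[s, t]) (rho u)%:E)%E).
      apply: (arc_int_subset arcg); [|exact: measurable_itv|by move=> u []].
      by apply: measurableI => //; exact: preimage_g arcg bSK.
    apply: ge0_le_integral => //.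
    - by move=> u _; rewrite lee_fin (arc_rho_ge0 arcg).
    - exact: arc_rho_emeasurable arcg _.
    - by move=> u _; rewrite lee_fin (arc_rho_le arcg).
  rewrite integral_cst//= lebesgue_measure_itv/=; case: ifPn => _.
    by rewrite -EFinB -EFinM ltry.
  by rewrite mule0.
have nuf : nu \is a fin_num by rewrite ge0_fin_numE.
have [W [oW DW WD]] := lebesgue_regularity_outer mD (le_lt_trans D_nu nuoo) e0.
have W_nu : (mu W <= nu + e%:E)%E.
  have mW : measurable (W : set R) by apply: open_measurable.
  apply: (@le_trans _ _ (mu (D `|` (W `\` D)))).
    apply: le_measure; rewrite ?inE//; first by apply: measurableU => //; exact: measurableD.
    by move=> x Wx; have [Dx|Dx] := pselect (D x); [left|right].
  apply: (le_trans (measureU2 mu mD (measurableD mW mD))).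
  by apply: leeD => //; exact: ltW.
have [N1 hN1] : exists N1 : nat, forall j, (N1 <= j)%N ->
    g_ j @` `[s, t] `<=` V `|` f @^-1` W.
  apply: arcs_eventually_in.
    by apply: openU => //; apply: open_comp => // y _; exact: cf.
  move=> y gy; have [Vy|Vy] := pselect (V y); first by left.
  by right; apply: DW; exists y.
have [N2 hN2] := unif e0.
exists (maxn N1 N2) => j; rewrite geq_max => /andP[N1j N2j].
have mW : measurable (W : set R) by apply: open_measurable.
have chord := @chord_le_hausdorff (g_ j) (rho_ j) s t (g s) V W (arc_ j) st mW.
have {}chord := chord _; have {chord} /chord : f @` (g_ j @` `[s, t] `\` V) `<=` W.
  by move=> _ [y [gy Vy] <-]; have [|] := hN1 j N1j y gy.
move=> chord; set L := (\int[mu]_(u in _) (w _ * _))%E.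
pose A := H (g_ j @` `[s, t] `&` (V `&` ~` (Sl `\` K2))).
have A0 : (0 <= A)%E by exact: hausdorff1_ge0.
have LA : (m'%:E * A <= L)%E by apply: ge0_length_lower.
have VA : (H (g_ j @` `[s, t] `&` V) <= A + e%:E)%E.
  apply: (@le_trans _ _ (A + H (Sl `\` K'))%E); last by rewrite leeD2l// ltW.
  apply: le_trans (hausdorff1U _ _); apply: le_hausdorff1 => z [gz Vz].
  have [[Sz K2z]|h] := pselect ((Sl `\` K2) z); last by left.
  by right; split => // K'z; apply: K2z; right.
set X := norm2 (g t - g s).
have XA : ((X - 4 * e)%:E <= A + nu)%E.
  have : ((X - 2 * e)%:E <= (A + e%:E) + (nu + e%:E))%E.
    apply: le_trans (leeD VA W_nu); apply: le_trans chord; rewrite lee_fin.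
    have h1 := hN2 j s N2j; have h2 := hN2 j t N2j.
    have h3 := norm2_triangle (g_ j t) (g t) (g s).
    by rewrite (norm2Bc (g t) (g_ j t)) -/X in h3; lra.
  rewrite addeACA -EFinD -leeBlDr// -EFinB.
  by rewrite (_ : X - 2 * e - (e + e) = X - 4 * e)//; ring.
have XC : X <= C.
  apply: le_trans (arc_lip arcg _ _) _; rewrite ger0_norm ?subr_ge0//.
  by rewrite -[leRHS]mulr1 ler_wpM2l//; lra.
have deltaX : delta * X <= eta / 2.
  apply: (@le_trans _ _ (eta / (2 * (C + 1)) * (C + 1))).
    apply: ler_pM; rewrite ?norm2_ge0 ?(ltW delta0)//; last lra.
    by rewrite ge_min lexx orbT.
  by rewrite le_eqVlt; apply/orP; left; apply/eqP; field; rewrite gt_eqF.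
have em' : m' * (4 * e) <= eta / 2.
  apply: (@le_trans _ _ (lambda * (4 * e))); last first.
    by rewrite le_eqVlt; apply/orP; left; apply/eqP; rewrite /e; field; rewrite gt_eqF.
  by apply: ler_wpM2r; [rewrite mulr_ge0// ltW|exact: le_trans (ltW m'm) ml].
apply: (@le_trans _ _ ((m' * (X - 4 * e))%:E + eta%:E)%E).
  by rewrite -EFinD lee_fin; rewrite /m'; rewrite /m' in em'; lra.
apply: leeD => //; rewrite EFinM.
apply: (@le_trans _ _ (m'%:E * (A + nu))%E); first by apply: lee_wpmul2l.
rewrite ge0_muleDr//; apply: leeD => //; apply: lee_wpmul2r => //.
by rewrite lee_fin ltW.
Qed.

(** The estimates on the finitely many pieces of a partition hold
    simultaneously for one of the curves that are known to be short. *)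
Lemma weighted_chords_le (p m : nat -> R) (N : nat) (M : R) (K : set 'rV[R]_n) :
  closed K -> K `<=` Sl ->
  (forall i, p i <= p i.+1) -> 0 <= p 0%N -> p N <= 1 ->
  (forall i, (i < N)%N -> 0 <= m i <= lambda) ->
  (forall i u, (i < N)%N -> `[p i, p i.+1]%classic u -> K (g u) ->
    ((m i)%:E <= w (g u))%E) ->
  (forall N0 : nat, exists2 j, (N0 <= j)%N &
    (\int[mu]_(u in `[p 0%N, p N]) (w (g_ j u) * (rho_ j u)%:E) <= M%:E)%E) ->
  (\sum_(0 <= i < N) (m i * norm2 (g (p i.+1) - g (p i)))%:E <=
   M%:E + lambda%:E *
     \int[mu]_(u in `[p 0%N, p N] `&` g @^-1` (Sl `\` K)) (rho u)%:E)%E.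
Proof.
move=> cK KS pS p0 p1 m0l hm often.
have nu_ge0 D : (0 <= \int[mu]_(u in D) (rho u)%:E)%E.
  by apply: integral_ge0 => u _; rewrite lee_fin (arc_rho_ge0 arcg).
have [->|N0] := eqVneq N 0%N.
  rewrite big_geq// adde_ge0// ?mule_ge0 ?lee_fin//.
  have [j _ hj] := often 0%N; rewrite -lee_fin; apply: le_trans hj.
  by apply: integral_ge0 => u _; rewrite mule_ge0// lee_fin (arc_rho_ge0 (arc_ j)).
apply/lee_addgt0Pr => eta eta0.
have Npos : 0 < N%:R :> R by rewrite ltr0n lt0n.
have etaN : 0 < eta / N%:R by rewrite divr_gt0.
have ple i j : (i <= j)%N -> p i <= p j.
  by move=> /subnKC <-; elim: (j - i)%N => [|k IH]; rewrite ?addn0// addnS (le_trans IH).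
have bSK : borel_set (Sl `\` K).
  exact: (@measurableD _ (@borelV R n) _ _ Sl_borel (closed_borel cK)).
have mSK := preimage_g arcg bSK.
have mint (h : R -> 'rV[R]_n) r D : is_arc C h r ->
    measurable_fun D (fun u => w (h u) * (r u)%:E)%E.
  move=> arch; apply: emeasurable_funM; last exact: arc_rho_emeasurable arch _.
  apply: measurable_funTS; apply: (measurableT_comp mw).
  exact: continuous_borel (arc_continuous arch).
have /choice[Nf hNf] (i : 'I_N) : exists Ni : nat, forall j, (Ni <= j)%N ->
    ((m i * norm2 (g (p i.+1) - g (p i)))%:E <=
      \int[mu]_(u in `[p i, p i.+1]) (w (g_ j u) * (rho_ j u)%:E) +
      (m i)%:E * \int[mu]_(u in `[p i, p i.+1] `&` g @^-1` (Sl `\` K)) (rho u)%:E +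
      (eta / N%:R)%:E)%E.
  have /andP[mi0 mil] := m0l i (ltn_ord i).
  apply: chord_weight_le => //.
  - by apply: le_trans p0 _; exact: ple.
  - by apply: le_trans p1; apply: ple.
  - by move=> u; exact: hm.
have [j Nj hj] := often (\max_(i < N) Nf i)%N.
rewrite big_mkord; apply: (@le_trans _ _ (\sum_(i < N)
    (\int[mu]_(u in `[p i, p i.+1]) (w (g_ j u) * (rho_ j u)%:E) +
     (lambda%:E * \int[mu]_(u in `[p i, p i.+1] `&` g @^-1` (Sl `\` K)) (rho u)%:E) +
     (eta / N%:R)%:E))%E).
  apply: lee_sum => i _; apply: le_trans (hNf i j _) _.
    by apply: leq_trans Nj; exact: leq_bigmax.
  rewrite leeD2r// leeD2l//; apply: lee_wpmul2r; first exact: nu_ge0.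
  by rewrite lee_fin; case/andP: (m0l i (ltn_ord i)).
rewrite big_split big_split; apply: leeD; last first.
  by rewrite sumEFin lee_fin sumr_const card_ord -[leLHS]mulr_natr divfK// gt_eqF.
apply: leeD.
  apply: le_trans hj.
  have := @sum_integral_partition _ (fun u => w (g_ j u) * (rho_ j u)%:E)%E p N pS.
  rewrite big_mkord => <-; [exact: lexx|exact: mint (arc_ j)|].
  by move=> u; rewrite mule_ge0// lee_fin (arc_rho_ge0 (arc_ j)).
rewrite -ge0_sume_distrr//.
apply: lee_wpmul2l; first by rewrite lee_fin.
have := @sum_integral_partition _ ((EFin \o rho) \_ (g @^-1` (Sl `\` K))) p N pS.
rewrite big_mkord integral_mkcondr => <-.
- by apply: lee_sum => i _; rewrite integral_mkcondr.
- by apply/(measurable_restrictT (EFin \o rho) mSK); exact: arc_rho_emeasurable arcg _.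
- by move=> u; rewrite /patch; case: ifPn => // _; rewrite lee_fin (arc_rho_ge0 arcg).
Qed.

(** Off [K], the weight is replaced with [lambda]; the resulting function [v]
    is lower semicontinuous on the whole space. The weighted chords of the
    limit over ever finer partitions are the integrals of step functions.
    Where the limit is differentiable, the lower limit of these is at least
    [v] times the speed: the chords by differentiability, the least weights by
    semicontinuity. Fatou's lemma then gives the claim. *)
Lemma length_lsc_closed (s t M : R) (K : set 'rV[R]_n) :
  0 <= s -> s < t -> t <= 1 -> closed K -> K `<=` Sl ->
  (forall N0 : nat, exists2 j, (N0 <= j)%N &
    (\int[mu]_(u in `[s, t]) (w (g_ j u) * (rho_ j u)%:E) <= M%:E)%E) ->
  (\int[mu]_(u in `[s, t]) (mine (w (g u)) lambda%:E * (rho u)%:E) <=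
   M%:E + lambda%:E *
     \int[mu]_(u in `[s, t] `&` g @^-1` (Sl `\` K)) (rho u)%:E)%E.
Proof.
move=> s0 st t1 cK KS often.
set X := (M%:E + _)%E.
pose v z : R := if z \in K then fine (w z) else lambda.
have vK z : K z -> (v z)%:E = w z.
  move=> Kz; rewrite /v mem_set// fineK// ge0_fin_numE//.
  by apply: le_lt_trans (ltry lambda); apply: w_in; exact: KS.
have v_ge0 z : 0 <= v z by rewrite /v; case: ifPn => // _; exact: fine_ge0.
have v_le z : v z <= lambda.
  have [Kz|Kz] := pselect (K z); last by rewrite /v memNset.
  by rewrite -lee_fin vK//; apply: w_in; exact: KS.
have wv z : (mine (w z) lambda%:E <= (v z)%:E)%E.
  have [Kz|Kz] := pselect (K z); first by rewrite vK// ge_min lexx.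
  by rewrite /v memNset// ge_min lexx orbT.
have v_lsc u e : 0 < e -> exists2 d : R, 0 < d &
    forall u', `|u' - u| < d -> v (g u) - e < v (g u').
  move=> e0; pose V := ~` (K `&` [set z | (w z <= (v (g u) - e)%:E)%E]).
  have oV : open V by apply: closed_openC; exact: w_level.
  have gV : V (g u).
    by move=> [Kz] /=; rewrite -vK// lee_fin; apply/negP; rewrite -ltNge gtrBl.
  have /(arc_continuous arcg) : nbhs (g u) V by exact: open_nbhs_nbhs.
  move=> /nbhs_ballP[d /= d0 hd]; exists d => // u' uu'.
  have Vu' : V (g u') by apply: hd; rewrite -ball_normE /ball_/= distrC.
  have [Kz|Kz] := pselect (K (g u')).
    by rewrite ltNge; apply/negP => h; apply: Vu'; split => //=; rewrite -vK.
  by rewrite {2}/v memNset//; apply: lt_le_trans (v_le (g u)); rewrite gtrBl.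
pose h (N : nat) : R := (t - s) / N.+1%:R.
have h0 N : 0 < h N by rewrite divr_gt0 ?subr_gt0.
pose p N (i : nat) : R := s + i%:R * h N.
have pS N i : p N i.+1 - p N i = h N by rewrite /p -natr1; ring.
have pSle N i : p N i <= p N i.+1 by rewrite -subr_ge0 pS ltW.
have p0 N : p N 0%N = s by rewrite /p mul0r addr0.
have p1 N : p N N.+1 = t by rewrite /p /h mulrC divfK ?subrKC// pnatr_eq0.
pose m N i := inf ((v \o g) @` `[p N i, p N i.+1]).
have piece_lb N i : has_lbound ((v \o g) @` `[p N i, p N i.+1]).
  by exists 0 => _ [u _ <-]; exact: v_ge0.
have m_le N i u : `[p N i, p N i.+1]%classic u -> m N i <= v (g u).
  by move=> hu; apply: ge_inf => //; exists u.
have left_in N i : `[p N i, p N i.+1]%classic (p N i).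
  by rewrite /= in_itv/= lexx pSle.
have le_m N i (x : R) : (forall u, `[p N i, p N i.+1]%classic u -> x <= v (g u)) ->
    x <= m N i.
  move=> hx; apply: lb_le_inf; last by move=> _ [u hu <-]; exact: hx.
  by exists (v (g (p N i))); exists (p N i).
have m_ge0 N i : 0 <= m N i by apply: le_m.
have sums N : (\sum_(0 <= i < N.+1) (m N i * norm2 (g (p N i.+1) - g (p N i)))%:E <= X)%E.
  have := @weighted_chords_le (p N) (m N) N.+1 M K cK KS (pSle N).
  rewrite p0 p1; apply => //.
  - by move=> i _; rewrite m_ge0/=; exact: le_trans (m_le _ _ _ (left_in N i)) (v_le _).
  - by move=> i u _ hu Kgu; rewrite -vK// lee_fin m_le.
(* The step function whose value on a piece of the partition is the least
   weight times the quotient of the chord by the length of the piece. *)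
pose c N i := m N i * (norm2 (g (p N i.+1) - g (p N i)) / h N).
have c_ge0 N i : 0 <= c N i by rewrite mulr_ge0// divr_ge0 ?norm2_ge0// ltW.
pose A N i : set R := `[p N i, p N i.+1[%classic.
pose phi N u : \bar R := (\sum_(0 <= i < N.+1) ((c N i)%:E * (\1_(A N i) u)%:E))%E.
have mphi1 N i : measurable_fun `[s, t] (fun u => (c N i)%:E * (\1_(A N i) u)%:E)%E.
  apply: emeasurable_funM => //; apply/measurable_EFinP; apply: measurable_funTS.
  by apply: measurable_indic; exact: measurable_itv.
have phi1_ge0 N i u : (0 <= (c N i)%:E * (\1_(A N i) u)%:E)%E.
  by rewrite mule_ge0// lee_fin.
have mphi N : measurable_fun `[s, t] (phi N).
  by apply: emeasurable_sum => i; exact: mphi1.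
have phi_ge0 N u : (0 <= phi N u)%E by apply: sume_ge0.
have int_phi N : (\int[mu]_(u in `[s, t]) phi N u <= X)%E.
  apply: le_trans (sums N); rewrite ge0_integral_sum//; last by move=> i; exact: mphi1.
  apply: lee_sum => i _; have mI : measurable_fun `[s, t] (fun u => (\1_(A N i) u)%:E : \bar R).
    apply/measurable_EFinP; apply: measurable_funTS.
    by apply: measurable_indic; exact: measurable_itv.
  rewrite ge0_integralZl ?lee_fin//.
  rewrite integral_indic//; last exact: measurable_itv.
  apply: (@le_trans _ _ ((c N i)%:E * (h N)%:E)%E).
    apply: lee_wpmul2l; first by rewrite lee_fin.
    apply: (@le_trans _ _ (mu (A N i))).
      apply: le_measure; rewrite ?inE; [|exact: measurable_itv|by move=> u []].
      by apply: measurableI; exact: measurable_itv.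
    rewrite lebesgue_measure_itv/=; case: ifPn => _; last by rewrite lee_fin ltW.
    by rewrite -EFinB pS.
  by rewrite -EFinM lee_fin /c -mulrA divfK// gt_eqF.
have phi_cvg u : s < u -> u < t -> derivable g u 1 -> speed g u = rho u ->
    ((v (g u) * rho u)%:E <= limn_einf (phi^~ u))%E.
  move=> su ut dg gu; apply/lee_addgt0Pr => eta eta0.
  rewrite -leeBlDr// -EFinB; apply: limn_einf_ge.
  have rho0 : 0 <= rho u by exact: arc_rho_ge0 arcg u.
  pose e := eta / (v (g u) + rho u + 1).
  have D0 : 0 < v (g u) + rho u + 1 by rewrite ltr_wpDl// addr_ge0.
  have e0 : 0 < e by rewrite divr_gt0.
  have ee : e * (v (g u) + rho u + 1) = eta by rewrite /e divfK// gt_eqF.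
  have [d1 d10 hd1] := v_lsc u e e0.
  have [d2 d20 hd2] := chord_speed dg e0.
  pose d := Num.min d1 d2; have d0 : 0 < d by rewrite lt_min d10.
  have [N0 hN0] : exists N0, forall N, (N0 <= N)%N -> h N < d.
    exists (Num.trunc ((t - s) / d)).+1 => k N0N; rewrite /h ltr_pdivrMr//.
    rewrite -ltr_pdivrMl// mulrC; apply: lt_le_trans (truncnS_gt _) _.
    by rewrite ler_nat ltnW.
  exists N0 => k /hN0 hd.
  have [||i [iN pu up]] := @partition_index R (p k) k.+1 u.
  - by rewrite p0 ltW.
  - by rewrite p1.
  apply: (@le_trans _ _ ((c k i)%:E)); last first.
    rewrite /phi (bigD1_seq i) ?mem_index_iota ?iota_uniq//=.
    rewrite indicE mem_set ?mule1; last by rewrite /A/= in_itv/= pu.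
    by rewrite leeDl// sume_ge0.
  rewrite lee_fin /c; set q := _ / h k.
  have q0 : 0 <= q by rewrite divr_ge0 ?norm2_ge0// ltW.
  have qr : rho u - e <= q.
    rewrite ler_pdivlMr// -gu -(pS k i); apply: hd2 => //; first exact: ltW.
    by rewrite pS; apply: lt_le_trans hd _; rewrite ge_min lexx orbT.
  have mv : v (g u) - e <= m k i.
    apply: le_m => u' /=; rewrite in_itv/= => /andP[u1 u2]; apply/ltW/hd1.
    have : h k < d1 by apply: lt_le_trans hd _; rewrite ge_min lexx.
    by rewrite -(pS k i) ltr_norml; move=> hh; apply/andP; split; lra.
  by rewrite -ee; apply: ler_mul_approx.
apply: (@le_trans _ _ (\int[mu]_(u in `[s, t]) limn_einf (phi^~ u))%E); last first.
  by apply: le_trans (limn_einf_le int_phi); exact: fatou.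
have mwg : measurable_fun setT (fun u => w (g u)).
  by apply: (measurableT_comp mw); exact: continuous_borel (arc_continuous arcg).
have [_ _ _ _ ae_g] := arcg.
have ne (x : R) : {ae mu, forall u : R, u != x}.
  exists [set x]; split; [exact: measurable_set1|exact: lebesgue_measure_set1|].
  by move=> u /= /negP; rewrite negbK => /eqP.
apply: ae_ge0_le_integral.
- exact: measurable_itv.
- by move=> u _; rewrite mule_ge0 ?lee_fin ?(arc_rho_ge0 arcg)// le_min w0 lee_fin.
- apply: emeasurable_funM; last exact: arc_rho_emeasurable arcg _.
  by apply: measurable_mine => //; exact: measurable_funTS.
- by move=> u _; apply: limn_einf_ge; exists 0%N.
- exact: measurable_fun_limn_einf.
have fil := ae_filter_ringOfSetsType mu.
apply: filterS3 ae_g (ne s) (ne t) => u gu us ut /=; rewrite in_itv/= => /andP[su tu].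
have {}su : s < u by rewrite lt_neqAle eq_sym us.
have {}tu : u < t by rewrite lt_neqAle ut.
have [dg gr] := gu (le_lt_trans s0 su) (lt_le_trans tu t1).
apply: le_trans (phi_cvg _ su tu dg gr).
by rewrite EFinM; apply: lee_wpmul2r; rewrite ?lee_fin ?(arc_rho_ge0 arcg).
Qed.

(** Here [K] is the image of a compact set of times, which fills the times
    that the limit spends in [Sl] up to a small measure; during what remains,
    the limit has small length. *)
Lemma length_lsc_truncated (s t M : R) :
  0 <= s -> s < t -> t <= 1 ->
  (forall N0 : nat, exists2 j, (N0 <= j)%N &
    (\int[mu]_(u in `[s, t]) (w (g_ j u) * (rho_ j u)%:E) <= M%:E)%E) ->
  (\int[mu]_(u in `[s, t]) (mine (w (g u)) lambda%:E * (rho u)%:E) <= M%:E)%E.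
Proof.
move=> s0 st t1 often; apply/lee_addgt0Pr => e e0.
have cg : continuous g by exact: arc_continuous arcg.
have C0 : 0 <= C by exact: le_trans (arc_rho_ge0 arcg 0) (arc_rho_le arcg 0).
pose E := `[s, t] `&` g @^-1` Sl.
have mE : measurable E.
  apply: measurableI; first exact: measurable_itv.
  by rewrite -[_ @^-1` _]setTI; exact: (continuous_borel cg).
have Efin : (mu E < +oo)%E.
  apply: (@le_lt_trans _ _ (mu `[s, t]%classic)).
    by apply: le_measure; rewrite ?inE// => u [].
  by rewrite lebesgue_measure_itv/= lte_fin st -EFinB ltry.
pose e' := e / (lambda * C + 1).
have D0 : 0 < lambda * C + 1 by rewrite ltr_wpDl// mulr_ge0.
have e'0 : 0 < e' by rewrite divr_gt0.
have [V [cV VE EV]] := lebesgue_regularity_inner mE Efin e'0.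
have cK : closed (g @` V).
  apply: compact_closed; first exact: norm_hausdorff.
  by apply: continuous_compact => //; exact: continuous_subspaceT.
have KS : g @` V `<=` Sl by move=> _ [u /VE[_ ?] <-].
apply: le_trans (length_lsc_closed s0 st t1 cK KS often) _.
rewrite leeD2l//.
have mV : measurable V by exact: compact_measurable.
have mD : measurable (E `\` V) by exact: measurableD.
apply: (@le_trans _ _ (lambda%:E * (C * e')%:E)%E); last first.
  rewrite -EFinM lee_fin mulrA; apply: (@le_trans _ _ ((lambda * C + 1) * e')).
    by rewrite ler_wpM2r ?lerDl// ltW.
  by rewrite /e' mulrC divfK// gt_eqF.
apply: lee_wpmul2l; first by rewrite lee_fin.
apply: (@le_trans _ _ (\int[mu]_(u in E `\` V) (cst C%:E u))%E); last first.
  by rewrite integral_cst// EFinM; apply: lee_wpmul2l; [rewrite lee_fin|exact: ltW].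
apply: (@le_trans _ _ (\int[mu]_(u in E `\` V) (rho u)%:E)%E).
  apply: (arc_int_subset arcg) => //.
    apply: measurableI; first exact: measurable_itv.
    rewrite -[_ @^-1` _]setTI; apply: (continuous_borel cg) => //.
    exact: (@measurableD _ (@borelV R n) _ _ Sl_borel (closed_borel cK)).
  by move=> u [ust [Su Ku]]; split => // Vu; apply: Ku; exists u.
apply: ge0_le_integral => //.
- by move=> u _; rewrite lee_fin (arc_rho_ge0 arcg).
- exact: arc_rho_emeasurable arcg _.
- by move=> u _; rewrite lee_fin (arc_rho_le arcg).
Qed.

End uniform_limit_of_arcs.

(** * Lower semicontinuity of the weighted length *)

Section length_semicontinuity.
Context {R : realType} {n : nat}.
Notation mu := (@lebesgue_measure R).

Lemma truncation_levels (a : \bar R) : (0 < a)%E -> exists l : nat -> R,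
  [/\ forall k, 0 <= l k, forall k, ((l k)%:E < a)%E &
      forall c : R, (c%:E < a)%E -> exists N, forall k, (N <= k)%N -> c <= l k].
Proof.
case: a => [r r0||//]; last first.
  move=> _; exists (fun k => k%:R); split => [//|k|c _]; first exact: ltry.
  exists (Num.trunc c).+1 => k hk; rewrite ltW// (lt_le_trans (truncnS_gt c))//.
  by rewrite ler_nat.
rewrite lte_fin in r0; exists (fun k => r - r / k.+1%:R); split=> [k|k|c].
- by rewrite subr_ge0 ler_pdivrMr// ler_peMr ?ler1n// ltW.
- by rewrite lte_fin gtrBl divr_gt0.
rewrite lte_fin -subr_gt0 => rc; exists (Num.trunc (r / (r - c))).+1 => k hk.
rewrite lerBrDr -lerBrDl ler_pdivrMr// -ler_pdivrMl// mulrC.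
by rewrite ltW// (lt_le_trans (truncnS_gt _))// ler_nat ltnW.
Qed.

Lemma lee_mul_approx (x l : \bar R) (r : R) : (0 <= x)%E -> (0 <= l)%E -> 0 <= r ->
  (forall c : R, 0 <= c -> (c%:E < x)%E -> ((c * r)%:E <= l)%E) ->
  (x * r%:E <= l)%E.
Proof.
move=> x0 l0; rewrite le_eqVlt => /orP[/eqP <-|r0] h; first by rewrite mule0.
rewrite -lee_pdivlMr// leNgt; apply/negP => hl.
have lr0 : (0 <= l * r^-1%:E)%E by rewrite mule_ge0// lee_fin invr_ge0 ltW.
have [d ld] : exists d : R, (l * r^-1%:E = d%:E)%E.
  exists (fine (l * r^-1%:E)%E); rewrite fineK// ge0_fin_numE//.
  by apply: lt_le_trans hl (leey _).
rewrite ld in hl lr0; rewrite lee_fin in lr0.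
have [c dc cx] : exists2 c : R, d < c & (c%:E < x)%E.
  case: x x0 hl {h} => [x| |//] _; last by exists (d + 1); rewrite ?ltrDl// ltry.
  by rewrite lte_fin => dx; exists ((d + x) / 2); rewrite ?lte_fin; lra.
have := h c (le_trans lr0 (ltW dc)) cx.
by rewrite EFinM -lee_pdivlMr// ld lee_fin leNgt dc.
Qed.

Variables (S : set 'rV[R]_n) (a : \bar R) (b : 'rV[R]_n -> R).
Hypothesis S_borel : borel_set S.
Hypothesis a_ge0 : (0 <= a)%E.
Hypothesis b_ge0 : forall z, S z -> 0 <= b z.
Hypothesis b_lsc : lower_semicontinuous_on S b.
Hypothesis b_le_a : forall z, S z -> ((b z)%:E <= a)%E.
Hypothesis S_fin : forall lambda : R, 0 <= lambda -> (lambda%:E < a)%E ->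
  (hausdorff1 (sublevel S b lambda) < +oo)%E.
Notation w := (extend S a b).
Variables (C : R) (g_ : nat -> R -> 'rV[R]_n) (rho_ : nat -> R -> R).
Variables (g : R -> 'rV[R]_n) (rho : R -> R).
Hypothesis arc_ : forall j, is_arc C (g_ j) (rho_ j).
Hypothesis arcg : is_arc C g rho.
Hypothesis unif : forall e : R, 0 < e ->
  exists N : nat, forall j u, (N <= j)%N -> norm2 (g_ j u - g u) <= e.

Lemma extend_out_sublevel (lambda : R) z : (lambda%:E < a)%E ->
  ~ sublevel S b lambda z -> (lambda%:E <= w z)%E.
Proof.
move=> la Sz; have [Sz'|Sz'] := pselect (S z); last by rewrite extend_out// ltW.
rewrite extend_in// lee_fin leNgt; apply/negP => h; apply: Sz; split => //.
exact: ltW.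
Qed.

(** The truncation level tends to [a], which bounds the weight. *)
Lemma length_lsc (s t M : R) : 0 <= s -> s <= t -> t <= 1 ->
  (forall N0 : nat, exists2 j, (N0 <= j)%N &
    (\int[mu]_(u in `[s, t]) (w (g_ j u) * (rho_ j u)%:E) <= M%:E)%E) ->
  (\int[mu]_(u in `[s, t]) (w (g u) * (rho u)%:E) <= M%:E)%E.
Proof.
move=> s0 st t1 often.
have w_ge0 z : (0 <= w z)%E by exact: extend_ge0.
have M0 : 0 <= M.
  have [j _ hj] := often 0%N; rewrite -lee_fin; apply: le_trans hj.
  by apply: integral_ge0 => u _; rewrite mule_ge0// lee_fin (arc_rho_ge0 (arc_ j)).
move: st; rewrite le_eqVlt => /orP[/eqP <-|st].
  by rewrite set_itv1 integral_set1 lee_fin.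
move: (a_ge0); rewrite le_eqVlt => /orP[/eqP a0|apos].
  rewrite integral0_eq ?lee_fin// => u _.
  have : (w (g u) <= 0)%E by rewrite a0; exact: extend_le.
  by move=> h; rewrite (_ : w (g u) = 0%E) ?mul0e//; apply/eqP; rewrite eq_le h/=.
have mw : measurable_fun setT (w : borelV -> \bar R) by exact: extend_measurable.
have trunc (l : R) : 0 <= l -> (l%:E < a)%E ->
    (\int[mu]_(u in `[s, t]) (mine (w (g u)) l%:E * (rho u)%:E) <= M%:E)%E.
  move=> l0 la.
  apply: (@length_lsc_truncated _ _ w (sublevel S b l) l mw w_ge0 l0 _ _ _ _ _
    C g_ rho_ g rho arc_ arcg unif) => //.
  - by move=> z [Sz bz]; rewrite extend_in// lee_fin.
  - by move=> z; exact: extend_out_sublevel.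
  - exact: sublevel_borel.
  - exact: S_fin.
  - move=> K c cK KS; have KS' : K `<=` S by move=> z /KS[].
    rewrite (_ : _ `&` _ = K `&` [set z | b z <= c]); first exact: (closed_sublevelI b_lsc cK KS').
    by apply/seteqP; split => z [Kz] /=; rewrite extend_in ?lee_fin//; exact: KS'.
have [l [l0 la hl]] := truncation_levels apos.
pose f k u := (mine (w (g u)) (l k)%:E * (rho u)%:E)%E.
have f_ge0 k u : (0 <= f k u)%E.
  apply: mule_ge0; last by rewrite lee_fin (arc_rho_ge0 arcg).
  by rewrite le_min w_ge0/= lee_fin; exact: l0.
have mwg : measurable_fun setT (fun u => w (g u)).
  by apply: (measurableT_comp mw); exact: continuous_borel (arc_continuous arcg).
have mf k : measurable_fun `[s, t] (f k).
  apply: emeasurable_funM; last exact: arc_rho_emeasurable arcg _.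
  by apply: measurable_mine => //; exact: measurable_funTS.
apply: (@le_trans _ _ (\int[mu]_(u in `[s, t]) limn_einf (f^~ u))%E).
  apply: ge0_le_integral.
  - exact: measurable_itv.
  - by move=> u _; rewrite mule_ge0// lee_fin (arc_rho_ge0 arcg).
  - apply: emeasurable_funM; last exact: arc_rho_emeasurable arcg _.
    exact: measurable_funTS.
  - exact: measurable_fun_limn_einf.
  move=> u _; apply: lee_mul_approx => //; last 2 first.
  - exact: arc_rho_ge0 arcg u.
  - move=> c c0 cw; apply: limn_einf_ge.
    have [N hN] := hl c (lt_le_trans cw (extend_le b_le_a _)).
    exists N => k Nk; rewrite EFinM; apply: lee_wpmul2r.
      by rewrite lee_fin (arc_rho_ge0 arcg).
    by rewrite le_min ltW//= lee_fin hN.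
  by apply: limn_einf_ge; exists 0%N.
apply: (@le_trans _ _ (limn_einf (fun k => \int[mu]_(u in `[s, t]) f k u)))%E.
  exact: fatou.
by apply: limn_einf_le => k; exact: trunc.
Qed.

End length_semicontinuity.

(** * Limits of optimal curves *)

Section segments.
Context {R : realType} {n : nat}.
Notation mu := (@lebesgue_measure R).

Lemma path_dist_segment (w : 'rV[R]_n -> \bar R) (a K : R) (x y : 'rV[R]_n) :
  measurable_fun setT (w : borelV -> \bar R) -> (forall z, (0 <= w z)%E) ->
  (forall z, (w z <= a%:E)%E) -> cube x -> cube y -> 0 < K -> norm2 (y - x) <= K ->
  (path_dist w x y <= (a * K)%:E)%E.
Proof.
move=> mw w0 wa cx cy K0 xyK.
have a0 : 0 <= a by rewrite -lee_fin (le_trans (w0 x)).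
pose h (u : R) : 'rV[R]_n := x + u *: (y - x).
have hl s t : norm2 (h s - h t) <= K * `|s - t|.
  have -> : h s - h t = (s - t) *: (y - x).
    by rewrite /h opprD addrACA subrr add0r scalerBl.
  by rewrite norm2Z mulrC ler_wpM2r.
have [r arch] := arc_exists K0 hl.
have hc u : `[0, 1]%classic u -> cube (h u).
  rewrite /= in_itv/= => /andP[u0 u1] i; rewrite /h !mxE.
  have /andP[x1 x2] := cx i; have /andP[y1 y2] := cy i.
  have -> : x 0 i + u * (y 0 i - x 0 i) = (1 - u) * x 0 i + u * y 0 i by ring.
  have u1' : 0 <= 1 - u by rewrite subr_ge0.
  have e1 := ler_wpM2l u1' x1; have e2 := ler_wpM2l u1' x2.
  have e3 := ler_wpM2l u0 y1; have e4 := ler_wpM2l u0 y2.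
  by apply/andP; split; lra.
have := path_dist_arc mw w0 arch hc (lexx 0) ler01 (lexx 1).
have -> : h 0 = x by rewrite /h scale0r addr0.
have -> : h 1 = y by rewrite /h scale1r addrC subrK.
move=> /le_trans; apply.
apply: (@le_trans _ _ (\int[mu]_(u in `[0%R, 1%R]) (cst (a * K)%:E u))%E).
  apply: ge0_le_integral => //.
  - by move=> u _; rewrite mule_ge0// lee_fin (arc_rho_ge0 arch).
  - apply: emeasurable_funM; last exact: arc_rho_emeasurable arch _.
    apply: measurable_funTS; apply: (measurableT_comp mw).
    exact: continuous_borel (arc_continuous arch).
  move=> u _; rewrite /= EFinM; apply: lee_pmul => //.
    by rewrite lee_fin (arc_rho_ge0 arch).
  by rewrite lee_fin (arc_rho_le arch).
by rewrite integral_cst//= lebesgue_measure_itv/= lte_fin ltr01 sube0 mule1.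
Qed.

End segments.

Section sets_met_often.
Context {R : realType} {n : nat}.
Notation H := (@hausdorff1 R n).
Notation Hm := (@hausdorff1_measure R n).

(** In a set of finite measure, the measure of the upper limit of sets is at
    least the upper limit of their measures. *)
Lemma hausdorff1_often (A : nat -> set 'rV[R]_n) (J : nat -> Prop) (B : set 'rV[R]_n) (c : R) :
  (forall j, borel_set (A j)) -> (forall j, A j `<=` B) -> (H B < +oo)%E -> 0 < c ->
  (forall N : nat, exists2 j, (N <= j)%N & J j /\ (c%:E <= H (A j))%E) ->
  exists z, forall N : nat, exists2 j, (N <= j)%N & J j /\ A j z.
Proof.
move=> bA AB Boo c0 often; apply: contrapT => nz.
pose F N := \bigcup_(j in [set j | (N <= j)%N /\ J j]) A j.
have mF N : (@hausdorff1_outer R n).-cara.-measurable (F N).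
  by apply: bigcup_measurable => j _; exact: borel_caratheodory.
have F0 : \bigcap_N F N = set0.
  rewrite -subset0 => z Fz; apply: nz; exists z => N.
  by have [j /= [Nj Jj] Ajz] := Fz N I; exists j.
have Foo : (Hm (F 0%N) < +oo)%E.
  by apply: le_lt_trans Boo; apply: le_hausdorff1 => z [j _ /AB].
have dF : {homo F : N M / (N <= M)%N >-> (M <= N)%O}.
  move=> N M NM; apply/subsetPset => z [j /= [Mj Jj] Az].
  by exists j => //=; rewrite (leq_trans NM).
have := @nonincreasing_cvg_mu _ _ _ Hm F Foo mF _ dF.
rewrite F0 measure0 => /(_ measurable0) cv.
have : (c%:E <= limn (Hm \o F))%E.
  apply: lime_ge; first by apply/cvg_ex; exists 0%E.
  exists 0%N => // N _ /=; have [j Nj [Jj cA]] := often N.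
  by apply: le_trans cA _; apply: le_hausdorff1 => z Az; exists j.
by rewrite (cvg_lim _ cv)// lee_fin leNgt c0.
Qed.

End sets_met_often.

Section partial_integrals.
Context {R : realType}.
Notation mu := (@lebesgue_measure R).

(** The intermediate value theorem for the integral as a function of its upper
    bound. *)
Lemma integral_itv_value (f : R -> \bar R) (c : R) : measurable_fun setT f ->
  (forall u, (0 <= f u)%E) -> (\int[mu]_(u in `[0%R, 1%R]) f u < +oo)%E ->
  0 <= c -> (c%:E <= \int[mu]_(u in `[0%R, 1%R]) f u)%E ->
  exists t, [/\ 0 <= t, t <= 1 & (\int[mu]_(u in `[0%R, t]) f u = c%:E)%E].
Proof.
move=> mf f0 foo c0 cf; pose F := fine \o f.
have intf : mu.-integrable `[0, 1] f.
  apply/integrableP; split; first exact: measurable_funTS.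
  by under eq_integral do rewrite gee0_abs//.
have mF : measurable_fun setT (EFin \o F).
  by apply/measurable_EFinP; apply: (measurableT_comp (@fine_measurable R setT measurableT)).
have finf : {ae mu, forall u, `[0, 1]%classic u -> f u \is a fin_num}.
  exact: integrable_ae intf.
have sub (t : R) : t <= 1 -> `[0, t] `<=` `[0, 1].
  by move=> t1 u /=; rewrite !in_itv/= => /andP[-> /le_trans ->].
have eqF (t : R) : t <= 1 -> (\int[mu]_(u in `[0%R, t]) f u = \int[mu]_(u in `[0%R, t]) (F u)%:E)%E.
  move=> t1; apply/esym; apply: ge0_ae_eq_integral_measurable => //.
  - by move=> u _; rewrite lee_fin fine_ge0.
  - exact: measurable_funTS.
  have fil := ae_filter_ringOfSetsType mu.
  by apply: filterS finf => u hu /(sub t t1)/hu uf; rewrite fineK.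
have le1 (t : R) : t <= 1 -> (\int[mu]_(u in `[0%R, t]) f u <= \int[mu]_(u in `[0%R, 1%R]) f u)%E.
  by move=> t1; apply: ge0_subset_integral => //; [exact: measurable_funTS|exact: sub].
pose psi (t : R) := parameterized_integral mu 0 t F.
have psiE (t : R) : t <= 1 -> ((psi t)%:E = \int[mu]_(u in `[0%R, t]) f u)%E.
  move=> t1; rewrite /psi /parameterized_integral /Rintegral -eqF// fineK//.
  by rewrite ge0_fin_numE ?integral_ge0//; exact: le_lt_trans (le1 t t1) foo.
have intF : mu.-integrable `[0, 1] (EFin \o F).
  apply/integrableP; split; first exact: measurable_funTS.
  under eq_integral do rewrite gee0_abs ?lee_fin ?fine_ge0//.
  by rewrite -eqF.
have cpsi := parameterized_integral_continuous ler01 intF.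
have [|t] := IVT ler01 cpsi (v := c).
  have p0 : psi 0 = 0.
    by apply/EFin_inj; rewrite psiE// set_itv1 integral_set1.
  rewrite -/(psi 0) -/(psi 1) p0 min_l ?max_r; rewrite -?lee_fin ?psiE ?integral_ge0//.
  by rewrite lee_fin c0.
rewrite in_itv/= => /andP[t0 t1] pt; exists t; split => //.
by rewrite -psiE// -pt.
Qed.

End partial_integrals.

Section optimal_limit.
Context {R : realType} {n : nat}.
Notation mu := (@lebesgue_measure R).
Notation H := (@hausdorff1 R n).
Variables (S : set 'rV[R]_n) (a : \bar R) (b : 'rV[R]_n -> R).
Hypothesis S_borel : borel_set S.
Hypothesis a_ge0 : (0 <= a)%E.
Hypothesis b_ge0 : forall z, S z -> 0 <= b z.
Hypothesis b_lsc : lower_semicontinuous_on S b.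
Hypothesis b_le_a : forall z, S z -> ((b z)%:E <= a)%E.
Hypothesis S_fin : forall lambda : R, 0 <= lambda -> (lambda%:E < a)%E ->
  (hausdorff1 (sublevel S b lambda) < +oo)%E.
Notation w := (extend S a b).
Variables (C : R) (g_ : nat -> R -> 'rV[R]_n) (rho_ : nat -> R -> R).
Variables (g : R -> 'rV[R]_n) (rho : R -> R).
Hypothesis arc_ : forall j, is_arc C (g_ j) (rho_ j).
Hypothesis arcg : is_arc C g rho.
Hypothesis unif : forall e : R, 0 < e ->
  exists N : nat, forall j u, (N <= j)%N -> norm2 (g_ j u - g u) <= e.
Hypothesis cube_ : forall j u, `[0, 1]%classic u -> cube (g_ j u).
Hypothesis cubeg : forall u, `[0, 1]%classic u -> cube (g u).

Let mw : measurable_fun setT (w : borelV -> \bar R).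
Proof. exact: extend_measurable. Qed.

Let w0 z : (0 <= w z)%E.
Proof. exact: extend_ge0. Qed.

Local Notation len_ j s t :=
  (\int[mu]_(u in `[s, t]) (w (g_ j u) * (rho_ j u)%:E))%E.
Local Notation len s t := (\int[mu]_(u in `[s, t]) (w (g u) * (rho u)%:E))%E.

Hypothesis opt : forall j, len_ j 0%R 1%R = path_dist w (g_ j 0) (g_ j 1).

(** Going to the end points of the limit and back along straight segments
    changes the distance by little, as the weight is bounded. *)
Lemma optimal_limit_finite : (a < +oo)%E ->
  (len 0%R 1%R <= path_dist w (g 0) (g 1))%E.
Proof.
move=> aoo; have [r ar] : exists r : R, a = r%:E.
  by exists (fine a); rewrite fineK// ge0_fin_numE.
have r0 : 0 <= r by rewrite -lee_fin -ar.
have [->|doo] := eqVneq (path_dist w (g 0) (g 1)) +oo%E; first exact: leey.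
have df : path_dist w (g 0) (g 1) \is a fin_num.
  by rewrite ge0_fin_numE ?ltey//; exact: path_dist_ge0.
apply/lee_addgt0Pr => e e0; rewrite -(fineK df) -EFinD.
have D0 : 0 < 2 * r + 1 by rewrite ltr_wpDl// mulr_ge0.
pose e' := e / (2 * r + 1).
have e'0 : 0 < e' by rewrite divr_gt0.
have [N hN] := unif e'0.
have wr z : (w z <= r%:E)%E by rewrite -ar; exact: extend_le.
have i0 : `[0, 1]%classic (0 : R) by rewrite /= in_itv/= lexx ler01.
have i1 : `[0, 1]%classic (1 : R) by rewrite /= in_itv/= lexx ler01.
apply: (@length_lsc _ _ S a b S_borel a_ge0 b_ge0 b_lsc b_le_a S_fin C g_ rho_ g rho
  arc_ arcg unif) => // N0.
exists (maxn N0 N); first exact: leq_maxl.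
set j := maxn N0 N; have Nj : (N <= j)%N by exact: leq_maxr.
rewrite opt.
apply: (@le_trans _ _ ((r * e')%:E + ((fine (path_dist w (g 0) (g 1)))%:E + (r * e')%:E))%E).
  apply: le_trans (path_dist_triangle mw w0 (g 0) _ _) _; apply: leeD.
    apply: path_dist_segment => //; [exact: cube_|exact: cubeg|].
    by rewrite norm2Bc; exact: hN.
  apply: le_trans (path_dist_triangle mw w0 (g 1) _ _) _; rewrite fineK// leeD2l//.
  by apply: path_dist_segment => //; [exact: cubeg|exact: cube_|exact: hN].
rewrite -!EFinD lee_fin addrCA lerD2l.
apply: (@le_trans _ _ ((2 * r + 1) * e')); last by rewrite /e' mulrC divfK// gt_eqF.
by rewrite mulrDl mul1r; move: (ltW e'0); lra.
Qed.

Lemma limit_in_image (s t : R) (z : 'rV[R]_n) :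
  (forall N : nat, exists2 j, (N <= j)%N & exists2 v, `[s, t]%classic v & g_ j v = z) ->
  exists2 v, `[s, t]%classic v & g v = z.
Proof.
move=> often; suff : (g @` `[s, t]) z by move=> [v]; exists v.
have /closure_id -> := arc_image_closed (s := s) (t := t) (arc_continuous arcg).
move=> U /nbhs_ballP[e /= e0 eU].
have e20 : 0 < e / 2 by rewrite divr_gt0.
have [N hN] := unif e20; have [j Nj [v vst gz]] := often N.
exists (g v); split; first by exists v.
apply: eU; rewrite mx_norm_ball /ball_/= -gz.
apply: le_lt_trans (norm_le_norm2 _) _; apply: (le_lt_trans (hN j v Nj)).
by rewrite ltr_pdivrMr// ltr_pMr// ltr1n.
Qed.

Let len_ge0 j s t : (0 <= len_ j s t)%E.
Proof.
by apply: integral_ge0 => u _; rewrite mule_ge0// lee_fin (arc_rho_ge0 (arc_ j)).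
Qed.

Let mlen (h : R -> 'rV[R]_n) r D : is_arc C h r ->
  measurable_fun D (fun u => w (h u) * (r u)%:E)%E.
Proof.
move=> arch; apply: emeasurable_funM; last exact: arc_rho_emeasurable arch _.
apply: measurable_funTS; apply: (measurableT_comp mw).
exact: continuous_borel (arc_continuous arch).
Qed.

(** Where the weight is large, the curves [g_ j] cannot run for long, as their
    weighted lengths are bounded; so a fixed part of each of them lies in a
    fixed sublevel set, which has finite measure. Hence some point is on
    infinitely many of the curves, and then on the limit. The predicate [J]
    allows for selecting a subsequence beforehand. *)
Lemma meeting_point (J : nat -> Prop) (M s t : R) : a = +oo%E ->
  0 <= s -> s <= t -> t <= 1 -> g s != g t ->
  (forall j, (len_ j 0%R 1%R <= M%:E)%E) ->
  (forall N : nat, exists2 j, (N <= j)%N & J j) ->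
  exists2 v, `[s, t]%classic v & forall N : nat, exists2 j, (N <= j)%N &
    J j /\ exists2 v', `[s, t]%classic v' & g_ j v' = g v.
Proof.
move=> aoo s0 st t1 gst LM often.
have [l lE] : exists l, l = norm2 (g t - g s) by exists (norm2 (g t - g s)).
have l0 : 0 < l.
  rewrite lt_neqAle lE norm2_ge0 andbT eq_sym; apply: contra gst => /eqP l0.
  have := norm_le_norm2 (g t - g s); rewrite l0 normr_le0 subr_eq0.
  by rewrite eq_sym.
have M0 : 0 <= M by rewrite -lee_fin; apply: le_trans (LM 0%N).
(* With this level, the part of the curve outside of the sublevel set is at
   most [l / 4] long. *)
pose lambda := 4 * M / l + 1.
have lM0 : 0 <= 4 * M / l by rewrite divr_ge0 ?mulr_ge0// ltW.
have lambda0 : 0 < lambda by rewrite ltr_wpDl.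
have la : (lambda%:E < a)%E by rewrite aoo ltry.
pose A j := g_ j @` `[s, t] `&` sublevel S b lambda.
have bSl : borel_set (sublevel S b lambda) by exact: sublevel_borel.
have cl j : borel_set (g_ j @` `[s, t]).
  exact: closed_borel (arc_image_closed (arc_continuous (arc_ j))).
have l40 : 0 < l / 4 by rewrite divr_gt0.
have [N0 hN0] := unif l40.
have HA j : (N0 <= j)%N -> ((l / 4)%:E <= H (A j))%E.
  move=> N0j.
  have chord : ((l / 2)%:E <= H (g_ j @` `[s, t]))%E.
    have := @chord_le_hausdorff _ _ C (g_ j) (rho_ j) s t (g_ j s) setT set0 (arc_ j) st
      measurable0.
    rewrite setDT image_set0 measure0 adde0 setIT subrr norm2_0 subr0 => /(_ (@subset_refl _ _)).
    apply: le_trans; rewrite lee_fin.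
    have h1 := hN0 j s N0j; have h2 := hN0 j t N0j.
    have h3 := norm2_triangle (g_ j t) (g t) (g s).
    have h4 := norm2_triangle (g_ j s) (g_ j t) (g s).
    by rewrite norm2Bc in h2; rewrite -lE in h3; lra.
  have out : (H (g_ j @` `[s, t] `&` ~` sublevel S b lambda) <= (l / 4)%:E)%E.
    have h : (lambda%:E * H (g_ j @` `[s, t] `&` ~` sublevel S b lambda) <= M%:E)%E.
      apply: le_trans (LM j).
      apply: (@le_trans _ _ (len_ j s t)); last first.
        apply: ge0_subset_integral => //; first exact: mlen (arc_ j).
          by move=> u _; rewrite mule_ge0// lee_fin (arc_rho_ge0 (arc_ j)).
        move=> u /=; rewrite !in_itv/= => /andP[su ut].
        by rewrite (le_trans s0)// (le_trans ut).
      apply: (ge0_length_lower mw w0 (arc_ j)) => //.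
      - exact: (@measurableC _ (@borelV R n)).
      - exact: ltW.
      - by move=> z; exact: extend_out_sublevel.
    rewrite muleC -lee_pdivlMr// in h; apply: (le_trans h).
    rewrite -EFinM lee_fin ler_pdivrMr// /lambda mulrDr mulr1.
    apply: (@le_trans _ _ (l / 4 * (4 * M / l))); last by rewrite lerDl ltW.
    rewrite le_eqVlt; apply/orP; left; apply/eqP; field; rewrite gt_eqF//.
  have : (H (g_ j @` `[s, t]) <= H (A j) + (l / 4)%:E)%E.
    apply: le_trans (leeD2l _ out); apply: le_trans (hausdorff1U _ _).
    apply: le_hausdorff1 => z gz.
    by have [Sz|Sz] := pselect (sublevel S b lambda z); [left|right].
  move=> /(le_trans chord); rewrite -leeBlDr// -EFinB.
  by rewrite (_ : l / 2 - l / 4 = l / 4)//; lra.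
have [||||z hz] := @hausdorff1_often R n A J (sublevel S b lambda) (l / 4) _ _ _ l40.
- by move=> j; apply: (@measurableI _ (@borelV R n)); [exact: cl|exact: bSl].
- by move=> j; exact: subIsetr.
- by apply: S_fin => //; exact: ltW.
- move=> N; have [j] := often (maxn N0 N); rewrite geq_max => /andP[N0j Nj] Jj.
  by exists j => //; split => //; exact: HA.
have [|v vst gv] := @limit_in_image s t z.
  by move=> N; have [j Nj [_ [[v vst gv] _]]] := hz N; exists j => //; exists v.
exists v => // N; have [j Nj [Jj [[v' vst' gv'] _]]] := hz N.
by exists j => //; split => //; exists v' => //; rewrite gv' gv.
Qed.

Lemma constant_length (s t : R) : 0 <= s -> t <= 1 ->
  (forall u, `[s, t]%classic u -> g u = g s) -> len s t = 0%E.
Proof.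
move=> s0 t1 gc; rewrite -[RHS](integral0 mu `[s, t]).
apply: ge0_ae_eq_integral_measurable => //.
  by move=> u _; rewrite mule_ge0// lee_fin (arc_rho_ge0 arcg).
have ne (x : R) : {ae mu, forall u : R, u != x}.
  exists [set x]; split; [exact: measurable_set1|exact: lebesgue_measure_set1|].
  by move=> u /= /negP; rewrite negbK => /eqP.
have [_ _ _ _ ae_g] := arcg.
have fil := ae_filter_ringOfSetsType mu.
apply: filterS3 ae_g (ne s) (ne t) => u gu us ut /=; rewrite in_itv/= => /andP[su tu].
have {}su : s < u by rewrite lt_neqAle eq_sym us.
have {}tu : u < t by rewrite lt_neqAle ut.
have [_ <-] := gu (le_lt_trans s0 su) (lt_le_trans tu t1).
have -> : speed g u = 0; last by rewrite mule0.
have -> : speed g u = speed (cst (g s)) u.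
  rewrite /speed !derive1E; congr norm2; apply: near_eq_derive.
  near=> v; rewrite /=; apply: gc; rewrite /= in_itv/=; apply/andP; split; apply: ltW; near: v.
  - exact: lt_nbhsr.
  - exact: lt_nbhsl.
by rewrite /speed derive1_cst norm2_0.
Unshelve. all: by end_near. Qed.

Lemma nonconstant_subinterval (s t : R) : 0 <= s -> t <= 1 -> (0 < len s t)%E ->
  exists2 u, `[s, t]%classic u & g s != g u.
Proof.
move=> s0 t1 lst; apply: contrapT => h; move: lst; rewrite constant_length ?ltxx//.
by move=> u ust; apply/esym/eqP/negPn/negP => gu; apply: h; exists u.
Qed.

(** The first and the last piece of the limit, up to [t] and from [t'] on, are
    chosen with a small but positive length [e], so that the limit is not
    constant on them. Infinitely many of the approximating curves meet the
    limit in a point [g v0] of the first piece, and a point [g v1] of the last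
    one. Between these two points, an approximating curve is as short as the
    distance, hence at most [2 * e] longer than the distance of the end points
    of the limit. *)
Lemma optimal_limit_infinite (M : R) : a = +oo%E ->
  (forall j, (len_ j 0%R 1%R <= M%:E)%E) ->
  (len 0%R 1%R <= path_dist w (g 0) (g 1))%E.
Proof.
move=> aoo LM.
have lsc := @length_lsc _ _ S a b S_borel a_ge0 b_ge0 b_lsc b_le_a S_fin C g_ rho_ g rho
  arc_ arcg unif.
have LgM : (len 0%R 1%R <= M%:E)%E.
  by apply: lsc => // N; exists N.
have Lgoo := le_lt_trans LgM (ltry M).
have [->|doo] := eqVneq (path_dist w (g 0) (g 1)) +oo%E; first exact: leey.
have len0 s t : (0 <= len s t)%E.
  by apply: integral_ge0 => u _; rewrite mule_ge0// lee_fin (arc_rho_ge0 arcg).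
have df : path_dist w (g 0) (g 1) \is a fin_num.
  by rewrite ge0_fin_numE ?ltey//; exact: path_dist_ge0.
have [L LE] : exists L : R, len 0%R 1%R = L%:E.
  by exists (fine (len 0%R 1%R)); rewrite fineK// ge0_fin_numE.
have [d dE] : exists d : R, path_dist w (g 0) (g 1) = d%:E.
  by exists (fine (path_dist w (g 0) (g 1))); rewrite fineK.
rewrite dE.
have [L0|Lpos] := leP L 0.
  rewrite LE; apply: (@le_trans _ _ 0%E); first by rewrite lee_fin.
  by rewrite -dE; exact: path_dist_ge0.
rewrite LE lee_fin; apply/ler_addgt0Pr => e0' e0'0.
pose e := Num.min (e0' / 4) (L / 3).
have e0 : 0 < e by rewrite lt_min !divr_gt0.
have ee : e <= e0' / 4 by rewrite ge_min lexx.
have eL : e <= L / 3 by rewrite ge_min lexx orbT.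
move: (e) e0 ee eL => {}e e0 ee eL.
have mg := mlen (D := setT) arcg.
have pos u : (0 <= w (g u) * (rho u)%:E)%E by rewrite mule_ge0// lee_fin (arc_rho_ge0 arcg).
have cat r s t : r <= s -> s <= t -> len r t = (len r s + len s t)%E.
  by move=> rs st; apply: ge0_integral_itv_cat => //; exact: measurable_funTS.
have [|t [t0 t1 Lt]] := integral_itv_value mg pos Lgoo (ltW e0).
  by rewrite LE lee_fin; lra.
have [||t' [t'0 t'1 Lt']] := integral_itv_value (c := L - e) mg pos Lgoo.
- lra.
- by rewrite LE lee_fin; lra.
have tt' : t <= t'.
  rewrite leNgt; apply/negP => /ltW h.
  have := cat 0 t' t t'0 h; rewrite Lt Lt' => hh.
  have : ((L - e)%:E <= e%:E)%E by rewrite hh leeDl.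
  by rewrite lee_fin; lra.
have Lt'1 : len t' 1%R = e%:E.
  have := cat 0 t' 1 t'0 t'1; rewrite LE Lt' => hh.
  have : (L%:E - (L - e)%:E = len t' 1%R)%E by rewrite hh addeAC subee// add0e.
  by move=> <-; rewrite -EFinB; congr EFin; ring.
have Ltt' : (L%:E = e%:E + len t t' + e%:E)%E.
  by rewrite -LE (cat 0 t' 1)// (cat 0 t t')// Lt Lt'1.
have [u0 u0t gu0] : exists2 u, `[0, t]%classic u & g 0 != g u.
  by apply: nonconstant_subinterval => //; rewrite Lt lte_fin.
have [u1 u1t gu1] : exists2 u, `[t', 1]%classic u & g t' != g u.
  by apply: nonconstant_subinterval => //; rewrite Lt'1 lte_fin.
move: u0t u1t; rewrite /= !in_itv/= => /andP[u00 u0t] /andP[t'u1 u11].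
have u01 : u0 <= 1 by exact: le_trans t1.
have [v0 v0u [hv0]] : exists2 v, `[0, u0]%classic v & True /\ forall N : nat,
    exists2 j, (N <= j)%N & True /\ exists2 v', `[0, u0]%classic v' & g_ j v' = g v.
  have [|v vu hv] := @meeting_point (fun=> True) M 0 u0 aoo (lexx 0) u00 u01 gu0 LM.
    by move=> N; exists N.
  by exists v.
move=> hJ; pose J j := exists2 v', `[0, u0]%classic v' & g_ j v' = g v0.
have [|v1 v1u hv1] := @meeting_point J M t' u1 aoo t'0 t'u1 u11 gu1 LM.
  by move=> N; have [j Nj [_ ?]] := hJ N; exists j.
move: v0u v1u; rewrite /= !in_itv/= => /andP[v00 v0u] /andP[t'v1 v1u].
have v0t := le_trans v0u u0t; have v11 := le_trans v1u u11.
have v01 : v0 <= 1 by exact: le_trans t1.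
have v10 : 0 <= v1 by exact: le_trans t'v1.
have dmid : (path_dist w (g v0) (g v1) <= (d + 2 * e)%:E)%E.
  apply: le_trans (path_dist_triangle mw w0 (g 0) _ _) _.
  apply: (@le_trans _ _ (e%:E + (d%:E + e%:E))%E); last first.
    by rewrite -!EFinD lee_fin; lra.
  apply: leeD.
    rewrite path_dist_sym; apply: le_trans (path_dist_arc mw w0 arcg cubeg _ v00 v01) _ => //.
    by rewrite -Lt (cat 0 v0 t)// leeDl.
  apply: le_trans (path_dist_triangle mw w0 (g 1) _ _) _; rewrite dE leeD2l//.
  rewrite path_dist_sym; apply: le_trans (path_dist_arc mw w0 arcg cubeg v10 v11 _) _ => //.
  by rewrite -Lt'1 (cat t' v1 1)// leeDr.
have : (len t t' <= (d + 2 * e)%:E)%E.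
  apply: lsc => // N; have [j Nj [[p pu gp] [q qu gq]]] := hv1 N; exists j => //.
  move: pu qu; rewrite /= !in_itv/= => /andP[p0 pu] /andP[t'q qu].
  have pt := le_trans pu u0t; have q1 := le_trans qu u11.
  have q0 : 0 <= q by exact: le_trans t'q.
  have p1 : p <= 1 by exact: le_trans t1.
  have pq : p <= q by apply: (le_trans pt); exact: le_trans t'q.
  have mj := mlen (D := setT) (arc_ j).
  have posj u : (0 <= w (g_ j u) * (rho_ j u)%:E)%E.
    by rewrite mule_ge0// lee_fin (arc_rho_ge0 (arc_ j)).
  have catj r s x : r <= s -> s <= x -> len_ j r x = (len_ j r s + len_ j s x)%E.
    by move=> rs sx; apply: ge0_integral_itv_cat => //; exact: measurable_funTS.
  apply: le_trans dmid; rewrite -gp -gq.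
  (* The middle part lies between the meeting times [p] and [q], and a part of
     an optimal curve is optimal. *)
  apply: (@le_trans _ _ (len_ j p q)).
    by rewrite (catj p t q) ?(le_trans tt')// (catj t t' q)// addeCA leeDl// adde_ge0.
  have Lj : (len_ j 0%R 1%R = len_ j 0%R p + (len_ j p q + len_ j q 1%R))%E.
    by rewrite (catj 0 p 1)// (catj p q 1).
  have Lle x : (len_ j 0%R p + (x + len_ j q 1%R) <= M%:E)%E ->
    (0 <= x)%E -> (len_ j 0%R p < +oo)%E /\ (len_ j q 1%R < +oo)%E.
    move=> h x0; split; apply: le_lt_trans (ltry M); apply: le_trans h.
      by rewrite leeDl// adde_ge0.
    by apply: (@le_trans _ _ (x + len_ j q 1%R)%E); [rewrite leeDr|rewrite leeDr].
  have [Lp Lq] := Lle (len_ j p q) ltac:(by rewrite -Lj; exact: LM) (len_ge0 j p q).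
  have : (len_ j 0%R p + (len_ j p q + len_ j q 1%R) <=
      len_ j 0%R p + (path_dist w (g_ j p) (g_ j q) + len_ j q 1%R))%E.
    rewrite -Lj opt; apply: le_trans (path_dist_triangle mw w0 (g_ j p) _ _) _.
    apply: leeD; first exact: (path_dist_arc mw w0 (arc_ j) (@cube_ j) _ p0 p1).
    apply: le_trans (path_dist_triangle mw w0 (g_ j q) _ _) _; rewrite leeD2l//.
    exact: (path_dist_arc mw w0 (arc_ j) (@cube_ j) q0 q1 _).
  rewrite leeD2lE; last by rewrite ge0_fin_numE.
  by rewrite leeD2rE// ge0_fin_numE.
move=> h; have : (L%:E <= e%:E + (d + 2 * e)%:E + e%:E)%E.
  by rewrite Ltt' leeD2r// leeD2l.
by rewrite -!EFinD lee_fin; lra.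
Qed.

End optimal_limit.

(** * Uniform convergence and the extension of paths *)

Lemma uniform_limit_clamp (R : realType) (n : nat) (gamma_ : nat -> R -> 'rV[R]_n)
    (gamma : R -> 'rV[R]_n) : {uniform `[0, 1], gamma_ @ \oo --> gamma} ->
  forall e : R, 0 < e -> exists N : nat, forall j u, (N <= j)%N ->
    norm2 ((gamma_ j \o clamp) u - (gamma \o clamp) u) <= e.
Proof.
move=> cv e e0; have en : 0 < e / n.+1%:R by rewrite divr_gt0.
pose P : set (R -> 'rV[R]_n) :=
  [set h | forall u, `[0, 1]%classic u -> ball (gamma u) (e / n.+1%:R) (h u)].
have : nbhs (gamma : {uniform` `[0, 1]%classic -> 'rV[R]_n}) P.
  apply/uniform_nbhs; exists [set xy | ball xy.1 (e / n.+1%:R) xy.2].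
  by split => //; exact: entourage_ball (PosNum en).
move=> /cv[N _ hN]; exists N => j u Nj.
have := hN j Nj (clamp u) (clamp01 u); rewrite mx_norm_ball /ball_/= => h.
rewrite norm2Bc; apply: le_trans (norm2_le_norm _) _.
apply: (@le_trans _ _ (n.+1%:R * (e / n.+1%:R))); last first.
  by rewrite mulrC divfK// pnatr_eq0.
by apply: ler_pM => //; [rewrite ler_nat|exact: ltW].
Qed.

Theorem proposition2p2p6 (R : realType) (n : nat)
    (S : set 'rV[R]_n) (a : \bar R) (b : 'rV[R]_n -> R)
    (S_cube : S `<=` cube)
    (S_rect : countably_1_rectifiable S)
    (S_borel : borel_set S)
    (a_ge0 : (0 <= a)%E)
    (b_ge0 : forall z, S z -> 0 <= b z)
    (b_lsc : lower_semicontinuous_on S b)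
    (b_le_a : forall z, S z -> ((b z)%:E <= a)%E)
    (S_fin : forall lambda : R, 0 <= lambda -> (lambda%:E < a)%E ->
       (hausdorff1 (sublevel S b lambda) < +oo)%E)
    (x_ y_ : nat -> 'rV[R]_n)
    (x_cube : forall j, cube (x_ j)) (y_cube : forall j, cube (y_ j))
    (d_bounded : exists M : R, forall j,
       (path_dist (extend S a b) (x_ j) (y_ j) <= M%:E)%E)
    (C : R) (C_gt0 : 0 < C)
    (gamma_ : nat -> R -> 'rV[R]_n)
    (gamma_path : forall j, paths_lip C (x_ j) (y_ j) (gamma_ j))
    (gamma_opt : forall j, path_length (extend S a b) (gamma_ j) =
       path_dist (extend S a b) (x_ j) (y_ j))
    (gamma_speed : forall j, constant_speed (gamma_ j))
    (x y : 'rV[R]_n) (hx : cube x) (hy : cube y)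
    (gamma : R -> 'rV[R]_n) (hgamma : paths_lip C x y gamma)
    (gamma_cvg : {uniform `[0, 1], gamma_ @ \oo --> gamma}) :
  path_length (extend S a b) gamma = path_dist (extend S a b) x y.
Proof.
have w0 := @extend_ge0 R n S a b a_ge0 b_ge0.
have mw : measurable_fun setT (extend S a b : borelV -> \bar R).
  exact: extend_measurable.
have lip (g : R -> 'rV[R]_n) (xx yy : 'rV[R]_n) : paths_lip C xx yy g ->
    forall s t, norm2 ((g \o clamp) s - (g \o clamp) t) <= C * `|s - t|.
  by move=> [_ _ _ gC]; apply: path_clamp_lip => //; exact: ltW.
have /choice[rho_ arc_] j := arc_exists C_gt0 (lip _ _ _ (gamma_path j)).
have [rho arcg] := arc_exists C_gt0 (lip _ _ _ hgamma).
have inc (g : R -> 'rV[R]_n) (xx yy : 'rV[R]_n) : paths_lip C xx yy g ->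
    forall u, `[0, 1]%classic u -> cube ((g \o clamp) u).
  by move=> [gc _ _ _] u _; apply: gc; exact: clamp01.
have ends (g : R -> 'rV[R]_n) (xx yy : 'rV[R]_n) : paths_lip C xx yy g ->
    ((g \o clamp) 0 = xx) * ((g \o clamp) 1 = yy).
  by move=> [_ <- <- _]; rewrite /= !clampE.
have lenE := path_length_arc mw w0.
have opt j : (\int[lebesgue_measure]_(u in `[0%R, 1%R])
    (extend S a b ((gamma_ j \o clamp) u) * (rho_ j u)%:E) =
    path_dist (extend S a b) ((gamma_ j \o clamp) 0%R) ((gamma_ j \o clamp) 1%R))%E.
  by rewrite -(lenE _ _ _ (arc_ j)) gamma_opt !(ends _ _ _ (gamma_path j)).
rewrite (lenE _ _ _ arcg) -(ends _ _ _ hgamma).1 -(ends _ _ _ hgamma).2.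
apply/eqP; rewrite eq_le; apply/andP; split; last first.
  exact: (path_dist_arc mw w0 arcg (inc _ _ _ hgamma) (lexx 0) ler01 (lexx 1)).
have unif := uniform_limit_clamp gamma_cvg.
have cube_ j := inc _ _ _ (gamma_path j).
have [aoo|aoo] := eqVneq a +oo%E; last first.
  apply: (optimal_limit_finite S_borel a_ge0 b_ge0 b_lsc b_le_a S_fin arc_ arcg unif
    cube_ (inc _ _ _ hgamma) opt).
  by rewrite ltey.
have [M hM] := d_bounded.
apply: (optimal_limit_infinite S_borel a_ge0 b_ge0 b_lsc b_le_a S_fin arc_ arcg unif
    cube_ (inc _ _ _ hgamma) opt aoo (M := M)) => j.
by rewrite -(lenE _ _ _ (arc_ j)) gamma_opt.
Qed.
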